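(* Let $k$ be an infinite field, $S=k[x_1,\ldots,x_n]$ with the standard grading, and let $P$ be a homogeneous prime ideal of $S$ with $\dim(S/P)=d$. Let $1\le s\le d$ and $r=n-s$, let $l_1,\ldots,l_s\in S_1$ be general linear forms, and let $P_s=\Pi_{l_1\ldots l_s}(P)\subset S(r)=k[x_1,\ldots,x_r]$. Then: (1) $e_i(S/P)=e_i(S(r)/P_s)$ for $0\le i\le d-s-1$. (2) If $e_{d-s}(S/P)=e_{d-s}(S(r)/P_s)-(-1)^{d-s}$, then $\operatorname{depth}(S/P)=n-r-1$.
   Context: For $m\in\mathbb{N}$, $S(m)=k[x_1,\ldots,x_m]$ is the standard graded polynomial ring (so $S=S(n)$, $S(0)=k$). If $l=c_1x_1+\cdots+c_mx_m$ is a linear form of $S(m)$ with $c_m\neq 0$, the composite $\eta:S(m-1)\hookrightarrow S(m)\to S(m)/lS(m)$ is an isomorphism, and $\pi_l:S(m)\to S(m-1)$ is the quotient map $S(m)\to S(m)/lS(m)$ followed by $\eta^{-1}$ (so $\pi_l$ is surjective with kernel $lS(m)$). For linear forms $l_1,\ldots,l_s\in S_1$, set $\Pi_{l_1\ldots l_s}=\pi_{\overline{l_s}}\pi_{\overline{l_{s-1}}}\cdots\pi_{\overline{l_2}}\pi_{l_1}:S\to S(n-s)$, where $\overline{l_i}$ is the image of $l_i$ under $\Pi_{l_1\ldots l_{i-1}}$; this is defined whenever, at each step, the coefficient in $\overline{l_i}\in S(n-i+1)$ of the last variable $x_{n-i+1}$ is nonzero. An assertion holds for ''$s$ general linear forms''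 if there is a nonempty Zariski open subset of $(S_1)^s$ such that it holds for all $(l_1,\ldots,l_s)$ in this subset; in particular $\Pi_{l_1\ldots l_s}$ is defined for general linear forms. Hilbert coefficients: for a finitely generated graded module $M$ over a standard graded polynomial ring over $k$, let $h_M(t)=\sum_i \dim_k(M_i)t^i$ be its Hilbert series and $q_M(t)=h_M(t)(1-t)^{\dim M}$. Write $q_M(t)=e_0+e_1(t-1)+e_2(t-1)^2+\cdots$; then $e_i(M)=e_i$ is the $i$-th Hilbert coefficient of $M$ (note the sign convention: expansion in powers of $t-1$). *)

(* Defs.v *)
From HB Require Import structures.
From mathcomp Require Import all_boot all_order all_algebra.
From mathcomp Require Import boolp classical_sets cardinality.
From mathcomp Require Import mpoly.

Set Implicit Arguments.
Unset Strict Implicit.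
Unset Printing Implicit Defensive.

Import Order.TTheory GRing.Theory.
Local Open Scope classical_set_scope.
Local Open Scope ring_scope.

(* Ideals of S(m) = {mpoly k[m]} are boolean predicates, as in ring_quotient;  *)
(* under the classical axioms of boolp every set is of this form.              *)

Section Projections.
Variable k : fieldType.

Lemma linear_formE n (f : {mpoly k[n]}) :
  f \is 1.-homog -> f = \sum_(i < n) f@_(U_(i)) *: 'X_i.
Proof.
move=> f_lin; apply/mpolyP => mm; rewrite raddf_sum /=.
have [|nmm] := eqVneq (mdeg mm) 1%N; last first.
  rewrite (dhomog_nemf_coeff f_lin nmm) big1 // => i _.
  rewrite mcoeffZ mcoeffX; case: eqP => [e|_]; last by rewrite mulr0.
  by move: nmm; rewrite -e mdeg1 eqxx.
move/eqP; rewrite mdeg_eq1 => /existsP[i /eqP ->].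
rewrite (bigD1 i) //= big1 ?addr0.
  by rewrite mcoeffZ mcoeffX eqxx mulr1.
move=> j /negPf nij; rewrite mcoeffZ mcoeffX.
by rewrite eq_mnm1 nij mulr0.
Qed.

Section OneForm.
Variables (m : nat) (l : {mpoly k[m.+1]}).

Definition last_coef : k := l@_(U_(ord_max)).

Definition proj_var (i : 'I_m.+1) : {mpoly k[m]} :=
  if unlift ord_max i is Some j then 'X_j
  else - last_coef^-1 *: \sum_(j < m) l@_(U_(lift ord_max j)) *: 'X_j.

(* pi_l is substitution: solve l = 0 for the last variable.  By                *)
(* [proj_formP], for a linear form l with nonzero last coefficient it is the   *)
(* quotient map S(m+1) -> S(m+1)/l followed by the inverse of the isomorphism  *)
(* S(m) -> S(m+1)/l induced by the inclusion [mwiden].                         *)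
Definition proj_form (p : {mpoly k[m.+1]}) : {mpoly k[m]} :=
  p \mPo [tuple proj_var i | i < m.+1].

Lemma proj_formX i : proj_form 'X_i = proj_var i.
Proof. by rewrite /proj_form comp_mpolyXU -tnth_nth tnth_mktuple. Qed.

Lemma proj_form_mwiden q : proj_form (mwiden q) = q.
Proof.
rewrite /proj_form; elim/mpolyind: q => [|c mm p _ _ IH].
  by rewrite mwiden0 comp_mpoly0.
rewrite mwidenD mwidenZ comp_mpolyD comp_mpolyZ IH; congr (_ *: _ + _).
rewrite mwidenX comp_mpolyX big_ord_recr /= mnmwiden_ordmax expr0 mulr1.
rewrite [RHS]mpolyXE_id; apply: eq_bigr => i _.
rewrite mnmwiden_widen tnth_mktuple /proj_var.
have -> : widen_ord (leqnSn m) i = lift ord_max i.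
  by apply: val_inj; rewrite /= /bump leqNgt ltn_ord.
by rewrite liftK.
Qed.

Hypotheses (l_lin : l \is 1.-homog) (l_last : last_coef != 0).

Lemma proj_form_l : proj_form l = 0.
Proof.
rewrite [in LHS](linear_formE l_lin) /proj_form raddf_sum /=.
rewrite big_ord_recr /= !comp_mpolyZ -!/(proj_form _) proj_formX.
rewrite {2}/proj_var unlift_none scalerA mulrN mulfV // scaleN1r.
apply/eqP; rewrite subr_eq0; apply/eqP/eq_bigr => i _.
rewrite comp_mpolyZ -/(proj_form _) proj_formX.
have -> : widen_ord (leqnSn m) i = lift ord_max i.
  by apply: val_inj; rewrite /= /bump leqNgt ltn_ord.
by rewrite /proj_var liftK.
Qed.

Lemma proj_form_mod p : exists h, p - mwiden (proj_form p) = l * h.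
Proof.
pose E p := exists h, p - mwiden (proj_form p) = l * h.
have E0 : E 0 by exists 0; rewrite /proj_form comp_mpoly0 mwiden0 subrr mulr0.
have E1 : E 1 by exists 0; rewrite /proj_form comp_mpoly1 mwiden1 subrr mulr0.
have ED p1 p2 : E p1 -> E p2 -> E (p1 + p2).
  move=> [h1 e1] [h2 e2]; exists (h1 + h2).
  by rewrite /proj_form comp_mpolyD mwidenD opprD addrACA e1 e2 mulrDr.
have EZ c p1 : E p1 -> E (c *: p1).
  move=> [h e]; exists (c *: h).
  by rewrite /proj_form comp_mpolyZ mwidenZ -scalerBr e scalerAr.
have EM p1 p2 : E p1 -> E p2 -> E (p1 * p2).
  move=> [h1 e1] [h2 e2].
  exists (h1 * p2 + mwiden (proj_form p1) * h2).
  rewrite mulrDr mulrA -e1 mulrCA -e2 /proj_form (rmorphM (comp_mpoly _)) mwidenM.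
  by rewrite mulrBl mulrBr addrA subrK.
have EX i : E 'X_i.
  rewrite /E proj_formX /proj_var; case: unliftP => [j ->|->].
    exists 0; rewrite mulr0 /mwiden mmapX mmap1U.
    rewrite (_ : widen_ord _ j = lift ord_max j) ?subrr //.
    by apply: val_inj; rewrite /= /bump leqNgt ltn_ord.
  exists (last_coef^-1)%:MP.
  rewrite [in RHS]mulrC mul_mpolyC [in RHS](linear_formE l_lin) big_ord_recr /=.
  rewrite scalerDr scalerA mulVf // scale1r addrC mwidenZ scaleNr opprK.
  congr (_ + _); congr (_ *: _); rewrite raddf_sum; apply: eq_bigr => j _ /=.
  rewrite mwidenZ /mwiden mmapX mmap1U.
  rewrite (_ : widen_ord _ j = lift ord_max j) //.
  by apply: val_inj; rewrite /= /bump leqNgt ltn_ord.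
elim/mpolyind: p => [|c mm p _ _ Ep]; first exact: E0.
apply: ED Ep; apply: EZ; rewrite mpolyXE_id.
elim/big_ind: _ => // i _; elim: (mm i) => [|e IH]; first by rewrite expr0.
by rewrite exprS; apply: EM.
Qed.

Lemma proj_formP p q :
  (exists h, p - mwiden q = l * h) <-> proj_form p = q.
Proof.
split=> [[h e]|<-]; last exact: proj_form_mod.
have /= := congr1 proj_form e; rewrite {1}/proj_form comp_mpolyB.
rewrite -!/(proj_form _) proj_form_mwiden => eq_pq.
apply/eqP; rewrite -subr_eq0 eq_pq; apply/eqP.
transitivity (proj_form l * proj_form h); last by rewrite proj_form_l mul0r.
exact: rmorphM.
Qed.

End OneForm.

(* Pi_{l_1 .. l_s} : S(n) -> S(n-s).  Projecting along l_1 first replaces the *)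
(* remaining forms by pi_{l_1}(l_2), .., pi_{l_1}(l_s), so that the i-th form  *)
(* used is the image of l_i under Pi_{l_1 .. l_{i-1}}.                         *)
Fixpoint Proj n s :
    seq {mpoly k[n]} -> {mpoly k[n]} -> {mpoly k[(n - s)%N]} :=
  match n, s return
    seq {mpoly k[n]} -> {mpoly k[n]} -> {mpoly k[(n - s)%N]} with
  | n'.+1, s'.+1 => fun ls p =>
      let pi := proj_form (head 0 ls) in
      @Proj n' s' (map pi (behead ls)) (pi p)
  | n'.+1, 0 => fun _ p => p
  | 0, _ => fun _ p => p
  end.

Fixpoint Proj_defined n s : seq {mpoly k[n]} -> bool :=
  match n, s return seq {mpoly k[n]} -> bool with
  | n'.+1, s'.+1 => fun ls =>
      (last_coef (head 0 ls) != 0) &&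
      @Proj_defined n' s' (map (proj_form (head 0 ls)) (behead ls))
  | _, 0 => fun _ => true
  | 0, _.+1 => fun _ => false
  end.

End Projections.

Definition image_ideal (A B : Type) (f : A -> B) (I : {pred A}) : {pred B} :=
  fun y => `[< exists2 x, x \in I & f x = y >].

Section General.
Variables (k : fieldType) (n s : nat).

(* (S_1)^s is identified with the affine space of s x n coefficient matrices. *)
Definition coef_mx (l : s.-tuple {mpoly k[n]}) : 'M[k]_(s, n) :=
  \matrix_(i, j) (tnth l i)@_(U_(j)).

Definition zariski_open (U : set 'M[k]_(s, n)) : Prop :=
  exists F : set {mpoly k[(s * n)%N]},
    U = [set A | exists2 f, F f & f.@[fun i => mxvec A 0 i] != 0].

Definition for_general_forms (Q : s.-tuple {mpoly k[n]} -> Prop) : Prop :=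
  exists U : set 'M[k]_(s, n),
    [/\ zariski_open U, U !=set0 &
        forall l : s.-tuple {mpoly k[n]},
          (forall i, tnth l i \is 1.-homog) -> U (coef_mx l) -> Q l].

End General.

Section Invariants.
Variables (k : fieldType) (n : nat).
Local Notation S := {mpoly k[n]}.
Implicit Types (I : {pred S}) (fs : seq S).

Definition homogeneous_ideal I : Prop :=
  forall f, f \in I -> forall i, pihomog mdeg i f \in I.

(* The invariants below are those of the cyclic S-module S/I.  The value of    *)
(* [supremum 0] is 0 on empty or unbounded sets.                               *)

(* Chains of primes of S/I, as chains Q_0 < .. < Q_d of primes containing I. *)
Definition prime_chain I (d : nat) (Q : nat -> prime_idealr S) : Prop :=
  {subset I <= Q 0%N} /\
  forall i, (i < d)%N ->
    {subset Q i <= Q i.+1} /\ ~ {subset Q i.+1 <= Q i}.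

Definition krull_dim I : nat :=
  supremum 0%N [set d | exists Q, prime_chain I d Q].

Definition gen_by I fs : set S :=
  [set g | exists c : 'I_(size fs) -> S, g - \sum_i c i * fs`_i \in I].

Definition regular_seq I fs : Prop :=
  (forall j, (j < size fs)%N -> forall g,
     gen_by I (take j fs) (fs`_j * g) -> gen_by I (take j fs) g) /\
  ~ gen_by I fs 1.

(* Regular sequences are taken in (x_1, .., x_n), the polynomials with zero    *)
(* constant term.                                                              *)
Definition depth I : nat :=
  supremum 0%N [set t | exists fs,
    [/\ size fs = t, (forall f, f \in fs -> f@_0%MM = 0) & regular_seq I fs]].

(* dim_k (S/I)_i, as the largest number of forms of degree i that are linearly *)
(* independent modulo I.                                                       *)
Definition hilbert_fun I (i : nat) : nat :=
  supremum 0%N [set t | exists b : t.-tuple S,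
    (forall j, tnth b j \is i.-homog) /\
    forall c : 'I_t -> k,
      \sum_j c j *: tnth b j \in I -> forall j, c j = 0].

(* q(t) = (sum_i dim (S/I)_i t^i) * (1 - t)^dim, coefficientwise.  As S/I lives *)
(* in degrees >= 0, q is a polynomial (Hilbert-Serre); it is unique.           *)
Definition is_hilbert_num I (q : {poly int}) : Prop :=
  forall i, q`_i =
    \sum_(j < i.+1) ((1 - 'X) ^+ krull_dim I)`_j * (hilbert_fun I (i - j))%:Z.

Definition hilbert_num I : {poly int} := xget 0 [set q | is_hilbert_num I q].

(* Coefficient of (t - 1)^i in q, read off as that of t^i in q(t + 1). *)
Definition hilbert_coef I (i : nat) : int := (hilbert_num I \Po ('X + 1))`_i.

End Invariants.

(* Main.v *)
Require Import Defs.
From HB Require Import structures.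
From mathcomp Require Import all_boot all_order all_algebra.
From mathcomp Require Import boolp classical_sets cardinality.
From mathcomp Require Import mpoly.
From mathcomp Require Import zify ring.

(** Write [A = S/P], [A_i = S/(P + (l_1, .., l_i))], and [p_i(t)] for the
    Hilbert series of [0 :_(A_i) l_(i+1)].

    Hilbert coefficients.  The ring [S(r)/P_s] has the Hilbert function of
    [A_s] ([image_Proj]).  For general forms each [p_i] is a polynomial, and
    [h_(A_(i+1)) = (1 - t) h_(A_i) + t p_i]; after multiplication by
    [(1 - t)^(d-i-1)] this reads
    [q_(A_i) = q_(A_(i+1)) - (1 - t)^(d-i-1) t p_i].  Adding the form [l_(i+1)]
    thus leaves the coefficients of index less than [d-i-1] unchanged, and
    among the [s] steps only the last one touches the index [d-s], with
    [e_(d-s)(A) = e_(d-s)(A_s) - (-1)^(d-s) p_(s-1)(1)]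
    ([compare_numerators]).  So (1) holds, and the hypothesis of (2) means that
    [p_(s-1)(1) = 1]: exactly one element of [A_(s-1)], up to scalars, is
    killed by [l_s].

    Depth at most [s-1].  Given a regular sequence [f_1, .., f_s] on [A],
    general forms can be exchanged for its elements one after the other
    ([exchange]), so that [f_1] is regular on [A_(s-1)].  Then [A_(s-1)] has no
    socle, a general [l_s] is regular on it, and [p_(s-1) = 0].

    Depth at least [s-1].  Let [T = k[y_1, .., y_s]] act on [A] through
    [y_a -> l_a].  The standard monomials of [P + (l)] generate [A] over [T];
    let [Z] be the module of relations between them.  Since [p_(s-1)(1) = 1],
    comparing Hilbert functions leaves for [Z] the size of [T], up to terms of
    lower order, so that any two relations are proportional
    ([relations_proportional_of_defect]).  As [T] is factorial and [A] is a
    domain containing [T], all relations are multiples of a single one, [zeta]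
    ([principal_relations]).  The element killed by [l_s] gives a relation that
    is nonzero modulo [(y_1, .., y_(s-1))]; hence so is [zeta], and a
    zero-divisor [l_a] with [a < s] would give a relation contradicting this
    ([regular_of_principal]).

    The open set.  The polynomial families of elements of the ideals
    [P + (l)] form an ideal, whose leading monomials are finitely generated by
    Dickson's lemma; where the leading coefficients of its generators do not
    vanish, the Hilbert function of [P + (l)] is constant ([generic_hf]).  It
    then suffices to argue for one family of forms in this open set, whose
    members can be chosen one at a time, each general with respect to the
    previous ones and to finitely many other ideals ([choose_rows]).

    Throughout, Hilbert functions count standard monomials, and the Krull
    dimension is read off from their growth ([krull_dim_eq]). *)

Set Implicit Arguments.
Unset Strict Implicit.
Unset Printing Implicit Defensive.

Import Order.TTheory GRing.Theory.
Local Open Scope classical_set_scope.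
Local Open Scope ring_scope.

(** * Linear algebra over a domain and independence modulo an ideal *)

(** Padded with zero columns to a square matrix, [A] has determinant zero. *)
Lemma wide_dependence (R : idomainType) (T T' : finType) (A : T -> T' -> R) :
  (#|T'| < #|T|)%N ->
  exists2 c : T -> R, (exists t, c t != 0) & forall t', \sum_t c t * A t t' = 0.
Proof.
move=> lt_T'T.
pose B := \matrix_(i < #|T|, j < #|T|)
  if insub (val j) is Some j' then A (enum_val i) (@enum_val _ T' j') else 0.
have : \det B == 0.
  pose j0 := Ordinal lt_T'T.
  rewrite (expand_det_col B j0) big1 // => i _.
  by rewrite mxE insubF ?mul0r //= ltnn.
case/det0P=> v v_neq0 vB0; exists (fun t => v 0 (enum_rank t)).
  have [i vi] : exists i, v 0 i != 0.
    apply: contrapT => /forallNP v0; case/eqP: v_neq0.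
    apply/rowP=> i; rewrite mxE; apply/eqP/negPn/negP; exact: v0.
  by exists (enum_val i); rewrite enum_valK.
move=> t'; pose i' := enum_rank t'.
have lt_i' : (i' < #|T|)%N by apply: leq_trans (ltn_ord i') (ltnW lt_T'T).
have /rowP/(_ (Ordinal lt_i')) := vB0; rewrite !mxE => vBi.
rewrite -[RHS]vBi (reindex (@enum_val _ T)) /=; last first.
  by apply: onW_bij; apply: enum_val_bij.
by apply: eq_bigr => i _; rewrite enum_valK !mxE (valK i') enum_rankK.
Qed.

Definition ideal (S : comNzRingType) (I : S -> Prop) :=
  [/\ I 0, forall f g, I f -> I g -> I (f + g) & forall a f, I f -> I (a * f)].

Definition adjoin (S : comNzRingType) (I : S -> Prop) (f : S) : S -> Prop :=
  fun g => exists h, I (g - h * f).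

Definition colon (S : comNzRingType) (I : S -> Prop) (f : S) : S -> Prop :=
  fun g => I (f * g).

Section IdealTheory.
Variables (S : comNzRingType) (I : S -> Prop).
Hypothesis idI : ideal I.

Lemma ideal0 : I 0. Proof. by case: idI. Qed.

Lemma idealD f g : I f -> I g -> I (f + g).
Proof. by case: idI => _ ID _; apply: ID. Qed.

Lemma ideal_mull a f : I f -> I (a * f).
Proof. by case: idI => _ _ IM; apply: IM. Qed.

Lemma ideal_mulr a f : I f -> I (f * a).
Proof. by rewrite mulrC; apply: ideal_mull. Qed.

Lemma idealN f : I f -> I (- f).
Proof. by move=> If; rewrite -mulN1r; apply: ideal_mull. Qed.

Lemma idealB f g : I f -> I g -> I (f - g).
Proof. by move=> If /idealN; apply: idealD. Qed.

Lemma ideal_sum (J : Type) (r : seq J) (p : pred J) (F : J -> S) :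
  (forall j, p j -> I (F j)) -> I (\sum_(j <- r | p j) F j).
Proof. by move=> IF; apply: big_ind => //; [exact: ideal0 | exact: idealD]. Qed.

Lemma ideal_congr f g : I (f - g) -> I g -> I f.
Proof. by move=> Ifg Ig; rewrite -[f](subrK g); apply: idealD. Qed.

Lemma ideal_congr_sym f g : I (f - g) -> I f -> I g.
Proof. by move=> Ifg If; rewrite -[g](subKr f); apply: idealB. Qed.

Lemma ideal_adjoin f : ideal (adjoin I f).
Proof.
split; first by exists 0; rewrite mul0r subr0; apply: ideal0.
  move=> g1 g2 [h1 I1] [h2 I2]; exists (h1 + h2).
  by rewrite mulrDl opprD addrACA; apply: idealD.
by move=> a g [h Ig]; exists (a * h); rewrite -mulrA -mulrBr; apply: ideal_mull.
Qed.

Lemma sub_adjoin f g : I g -> adjoin I f g.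
Proof. by move=> Ig; exists 0; rewrite mul0r subr0. Qed.

Lemma mem_adjoin f : adjoin I f f.
Proof. by exists 1; rewrite mul1r subrr; apply: ideal0. Qed.

Lemma ideal_colon f : ideal (colon I f).
Proof.
split; first by rewrite /colon mulr0; apply: ideal0.
  by move=> g h Ig Ih; rewrite /colon mulrDr; apply: idealD.
by move=> a g Ig; rewrite /colon mulrCA; apply: ideal_mull.
Qed.

Lemma sub_colon f g : I g -> colon I f g.
Proof. exact: ideal_mull. Qed.

Section Independence.
Variables (k : fieldType) (iota : {rmorphism k -> S}).

(** The scalars act through [iota], so as to serve both for [k[x]] and for
    polynomials in [x] over [k[y]]. *)
Definition lindep (T : finType) (u : T -> S) :=
  forall c : T -> k, I (\sum_t iota (c t) * u t) -> forall t, c t = 0.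

Lemma lindep_span (T T' : finType) (u : T -> S) (w : T' -> S) :
    lindep u ->
    (forall t, exists a : T' -> k, I (u t - \sum_t' iota (a t') * w t')) ->
  (#|T| <= #|T'|)%N.
Proof.
move=> ind_u /choice[A uA]; rewrite leqNgt; apply/negP => /(wide_dependence A).
case=> c [t /eqP ct] cA0; apply: ct; apply: ind_u.
apply: (ideal_congr (g := \sum_t iota (c t) * \sum_t' iota (A t t') * w t')).
  by rewrite -sumrB; apply: ideal_sum => t1 _; rewrite -mulrBr; apply: ideal_mull.
rewrite (eq_bigr (fun t1 => \sum_t' iota (c t1 * A t1 t') * w t')); last first.
  by move=> t1 _; rewrite mulr_sumr; apply: eq_bigr => t' _; rewrite rmorphM mulrA.
rewrite exchange_big big1 /=; first exact: ideal0.
by move=> t' _; rewrite -mulr_suml -rmorph_sum cA0 rmorph0 mul0r.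
Qed.

End Independence.
End IdealTheory.

(** * Leading monomials and Noetherian induction *)

Lemma monotone_subsequence (u : nat -> nat) :
  exists2 phi : nat -> nat, {homo phi : i j / (i < j)%N} &
    {homo (u \o phi) : i j / (i <= j)%N}.
Proof.
have /choice[f fP] : forall N, exists m,
    (N <= m)%N /\ forall m', (N <= m')%N -> (u m <= u m')%N.
  move=> N; have exv : exists v, `[<exists2 m, (N <= m)%N & u m = v>].
    by exists (u N); apply/asboolP; exists N.
  case: (ex_minnP exv) => v /asboolP[m Nm <-] minv; exists m; split=> // m' Nm'.
  by apply: minv; apply/asboolP; exists m'.
pose phi := fix phi i := if i is i'.+1 then f (phi i').+1 else f 0%N.
have phiS i : (phi i < phi i.+1)%N by have [] := fP (phi i).+1.
exists phi; first exact: (homo_ltn ltn_trans phiS).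
apply: (homo_leq leqnn leq_trans) => i.
have [N [eN leN]] : exists N, phi i = f N /\ (N <= phi i.+1)%N.
  case: i => [|i]; first by exists 0%N.
  by exists (phi i).+1; split=> //; apply: ltn_trans (phiS i) (phiS i.+1).
by have [_ fN] := fP N; rewrite /comp {1}eN; apply: fN.
Qed.

(** A subsequence nondecreasing in every exponent is extracted one variable at
    a time. *)
Lemma dickson_sequence n (u : nat -> 'X_{1..n}) :
  exists i j, (i < j)%N /\ (u i <= u j)%MM.
Proof.
suff [phi phi_incr phiP] : exists2 phi : nat -> nat,
    {homo phi : i j / (i < j)%N} & forall c, c \in enum 'I_n ->
      {homo (fun i => u (phi i) c) : i j / (i <= j)%N}.
  exists (phi 0%N), (phi 1%N); split; first exact: phi_incr.
  by apply/mnm_lepP=> c; apply: phiP; rewrite ?mem_enum.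
elim: (enum _) => [|c r [phi phi_incr phiP]]; first by exists id.
have [psi psi_incr psiP] := monotone_subsequence (fun i => u (phi i) c).
have psi_mono : {homo psi : i j / (i <= j)%N}.
  apply: (homo_leq leqnn leq_trans) => i; exact/ltnW/psi_incr.
exists (phi \o psi) => [i j /psi_incr/phi_incr //|c'].
rewrite inE => /predU1P[->|/phiP phic' i j /psi_mono/phic' //].
exact: psiP.
Qed.

(** Otherwise one could go on choosing elements of [E] divisible by none of the
    previous ones. *)
Lemma dickson n (E : 'X_{1..n} -> Prop) :
  exists2 F : seq 'X_{1..n}, (forall m, m \in F -> E m) &
    forall m, E m -> exists2 m', m' \in F & (m' <= m)%MM.
Proof.
apply: contrapT => noF.
have /choice[g gP] : forall F : seq 'X_{1..n}, exists m,
    (forall m', m' \in F -> E m') ->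
    E m /\ forall m', m' \in F -> ~ (m' <= m)%MM.
  move=> F; have [FE|?] := pselect (forall m', m' \in F -> E m'); last by exists 0%MM.
  apply: contrapT => nom; apply: noF; exists F => // m Em.
  apply: contrapT => nom'; apply: nom; exists m => _; split=> // m' m'F lem.
  by apply: nom'; exists m'.
pose Fs := fix Fs i := if i is i'.+1 then g (Fs i') :: Fs i' else [::].
have FsE i m : m \in Fs i -> E m.
  elim: i m => //= i IH m; rewrite inE => /predU1P[->|/IH//].
  by have [] := gP _ IH.
have mem_Fs i j : (i < j)%N -> g (Fs i) \in Fs j.
  elim: j => //= j IH; rewrite inE ltnS leq_eqVlt => /predU1P[->|/IH ->].
    by rewrite eqxx.
  by rewrite orbT.
have [i [j [ij le_ij]]] := dickson_sequence (fun i => g (Fs i)).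
by have [_ /(_ _ (mem_Fs _ _ ij))] := gP _ (FsE j).
Qed.

Definition leading (n : nat) (R : nzRingType) (I : {mpoly R[n]} -> Prop)
    (m : 'X_{1..n}) : Prop :=
  exists f, [/\ I f, f != 0 & mlead f = m].

Lemma leadingD (n : nat) (R : idomainType) (I : {mpoly R[n]} -> Prop) m m' :
  ideal I -> leading I m -> (m <= m')%MM -> leading I m'.
Proof.
move=> idI [f [If f0 fm]] mm'; exists ('X_[m' - m] * f); split.
- exact: ideal_mull.
- by rewrite mulf_neq0 // -msupp_eq0 msuppX.
- by rewrite mleadM ?fm ?mleadXm ?submK // -msupp_eq0 msuppX.
Qed.

Section Noetherian.
Variables (k : fieldType) (n : nat).
Local Notation S := {mpoly k[n]}.
Implicit Types (I J : S -> Prop) (f g : S) (m : 'X_{1..n}).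

(** The remainder of the division of [f] by all of [I]. *)
Lemma normal_form I f : ideal I ->
  exists r, I (f - r) /\ forall m, m \in msupp r -> ~ leading I m /\ (m <= mlead f)%O.
Proof.
move=> idI; elim/mleadrect: f => f IH.
have [->|f0] := eqVneq f 0.
  by exists 0; rewrite subrr msupp0; split=> //; apply: ideal0.
have step g : mlead g = mlead f -> mleadc g = mleadc f -> g != 0 ->
    exists r, I ((f - g) - r) /\
      forall m, m \in msupp r -> ~ leading I m /\ (m <= mlead f)%O.
  move=> lg cg g0; have [->|fg0] := eqVneq (f - g) 0.
    by exists 0; rewrite subrr msupp0; split=> //; apply: ideal0.
  have lt_fg : (mlead (f - g) < mlead f)%O.
    have := mleadB_le f g; rewrite lg joinxx le_eqVlt => /predU1P[e|//].
    by move: fg0; rewrite -mleadc_eq0 e mcoeffB -{2}lg cg subrr eqxx.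
  have [r [Ir rP]] := IH _ lt_fg; exists r; split=> // m /rP[? le_m].
  by split=> //; apply: le_trans le_m (ltW lt_fg).
have c0 : mleadc f != 0 by rewrite mleadc_eq0.
have [[g [Ig g0 lg]]|nlead] := pselect (leading I (mlead f)).
  have cg0 : mleadc g != 0 by rewrite mleadc_eq0.
  have a0 : mleadc f / mleadc g != 0 by rewrite mulf_neq0 ?invr_eq0.
  have [||| r [Ir rP]] := step ((mleadc f / mleadc g) *: g).
  - by rewrite mleadZ.
  - by rewrite mleadZ // mcoeffZ mulfVK.
  - by rewrite mscalerI (negPf a0) (negPf g0).
  exists r; split=> //; rewrite -(subrK ((mleadc f / mleadc g) *: g) (f - r)).
  apply: idealD => //; first by rewrite addrAC.
  by rewrite -mul_mpolyC; apply: ideal_mull.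
have [||| r [Ir rP]] := step (mleadc f *: 'X_[mlead f]).
- by rewrite mleadZ // mleadXm.
- by rewrite mleadZ // mleadXm mcoeffZ mcoeffX eqxx mulr1.
- by rewrite mscalerI (negPf c0) -msupp_eq0 msuppX.
exists (mleadc f *: 'X_[mlead f] + r); split; first by rewrite opprD addrA.
move=> m /msuppD_le; rewrite mem_cat => /orP[|/rP//].
by rewrite msuppMCX // inE => /eqP ->.
Qed.

(** The normal form modulo [I] of an element of [J] is again in [J]; unless it
    is zero, its leading monomial is one of [J] and not one of [I]. *)
Lemma leading_inj I J :
  ideal I -> ideal J -> (forall f, I f -> J f) ->
  (forall m, leading J m -> leading I m) -> forall f, J f -> I f.
Proof.
move=> idI idJ IJ leadJI f Jf; have [r [Ir rP]] := normal_form f idI.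
suff r0 : r = 0 by rewrite r0 subr0 in Ir.
apply/eqP; apply: contrapT => /negP r0.
have [nlead _] := rP _ (mlead_supp r0); apply: nlead; apply: leadJI.
by exists r; split=> //; apply: ideal_congr_sym (IJ _ Ir) Jf.
Qed.

(** An ascending chain of ideals without end would give, by picking at each
    step a new leading monomial, a sequence of monomials none of which divides
    a later one, against Dickson's lemma. *)
Lemma noetherian_ind (Q : (S -> Prop) -> Prop) :
  (forall I, ideal I ->
     (forall J, ideal J -> (forall f, I f -> J f) -> (exists2 f, J f & ~ I f) -> Q J) ->
     Q I) ->
  forall I, ideal I -> Q I.
Proof.
move=> step I0 idI0; apply: contrapT => nQ0.
pose bad := {I | ideal I /\ ~ Q I}.
have /choice[next nextP] : forall I : bad, exists J : bad,
    (forall f, sval I f -> sval J f) /\ exists2 f, sval J f & ~ sval I f.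
  move=> [I [idI nQ]]; apply: contrapT => noJ; apply: (nQ); apply: step => // J idJ IJ ltIJ.
  by apply: contrapT => nQJ; apply: noJ; exists (exist _ J (conj idJ nQJ)).
pose chain i := iter i next (exist _ I0 (conj idI0 nQ0)).
have mono i j f : (i <= j)%N -> sval (chain i) f -> sval (chain j) f.
  by move/subnKC <-; elim: (j - i)%N => [|e IH /IH]; rewrite ?addn0 ?addnS //; apply: (nextP _).1.
have idC i : ideal (sval (chain i)) by have [] := svalP (chain i).
have /choice[z zP] : forall i, exists z, [/\ sval (chain i.+1) z, z != 0 &
    ~ leading (sval (chain i)) (mlead z)].
  move=> i; have [sub [f Jf nIf]] := nextP (chain i).
  apply: contrapT => noz; apply: nIf.
  apply: (leading_inj (idC i) (idC i.+1)) Jf => // m [g [Jg g0 <-]].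
  by apply: contrapT => nl; apply: noz; exists g.
have [i [j [ij le_ij]]] := dickson_sequence (fun i => mlead (z i)).
have [Jz zi0 _] := zP i; have [_ _] := zP j; apply.
by apply: (leadingD (idC j)) le_ij; exists (z i); split=> //; apply: mono Jz.
Qed.

End Noetherian.

(** * Hilbert functions by counting standard monomials *)

Lemma msize_leqP (R : nzRingType) n (f : {mpoly R[n]}) i :
  reflect (forall m, (i <= mdeg m)%N -> f@_m = 0) (msize f <= i)%N.
Proof.
apply: (iffP idP) => [fi m im|fi].
  by apply/memN_msupp_eq0/msize_mdeg_ge/(leq_trans fi im).
have [->|f0] := eqVneq f 0; first by rewrite msize0.
rewrite -mlead_deg // ltnNge; apply/negP => /fi/eqP.
by rewrite mleadc_eq0 (negPf f0).
Qed.

Lemma expand_monomials (R : comNzRingType) n b (A : pred 'X_{1..n}) (f : {mpoly R[n]}) :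
  (forall m, m \in msupp f -> (mdeg m < b)%N /\ A m) ->
  f = \sum_(t : {m in [pred m : 'X_{1..n < b} | A m]}) (f@_(val (val t)))%:MP * 'X_[val (val t)].
Proof.
move=> fA; have fb : (msize f <= b)%N.
  rewrite leqNgt; apply/negP => lt.
  have f0 : f != 0 by rewrite -msize_poly_eq0 -lt0n (leq_ltn_trans _ lt).
  by have [] := fA _ (mlead_supp f0); rewrite ltnNge -ltnS mlead_deg // lt.
rewrite {1}(mpolywE fb).
rewrite -(big_sub [pred m : 'X_{1..n < b} | A m] (fun m : 'X_{1..n < b} => (f@_m)%:MP * 'X_[m])).
rewrite [RHS]big_mkcond /=; apply: eq_bigr => m _; rewrite inE mul_mpolyC.
case: ifPn => // nA; rewrite memN_msupp_eq0 ?scale0r //.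
by apply: contraNN nA => /fA[].
Qed.

Lemma mcoeff_hcomp (R : nzRingType) n i (f : {mpoly R[n]}) m :
  (pihomog mdeg i f)@_m = if mdeg m == i then f@_m else 0.
Proof.
rewrite pihomogE raddf_sum /=; under eq_bigr do rewrite mcoeffZ mcoeffX.
have [mi|mi] := eqVneq (mdeg m) i; last first.
  rewrite big1 // => m' /eqP m'i; case: eqP => [mm'|]; last by rewrite mulr0.
  by rewrite -mm' m'i eqxx in mi.
have [min|nmin] := boolP (m \in msupp f).
  rewrite big_mkcond (bigD1_seq m) ?msupp_uniq //= mi !eqxx mulr1.
  rewrite big1 ?addr0 // => m' /negPf ne; case: ifP => // _.
  by rewrite ne mulr0.
rewrite (memN_msupp_eq0 nmin) big_seq_cond big1 // => m' /andP[m'in _].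
by case: eqP => [e|]; rewrite ?mulr0 //; rewrite e (negPf nmin) in m'in.
Qed.

Section Homogeneous.
Variables (k : fieldType) (n : nat).
Local Notation S := {mpoly k[n]}.
Local Notation hcomp := (pihomog mdeg).
Implicit Types (I J : S -> Prop) (f g : S) (m : 'X_{1..n}).

Definition graded I := forall f, I f -> forall i, I (hcomp i f).

Lemma hcompM i e f g : f \is e.-homog ->
  hcomp i (g * f) = if (e <= i)%N then hcomp (i - e) g * f else 0.
Proof.
move=> fe; pose K := msize g.
rewrite {1}(@pihomog_partitionE _ _ mdeg K g) // mulr_suml raddf_sum /=.
have homM j : hcomp j g * f \is (j + e).-homog.
  by apply: dhomogM fe; apply: pihomogP.
case: leqP => [ei|ie]; last first.
  rewrite big1 // => j _; apply: (pihomog_ne0 _ (homM j)).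
  by rewrite gtn_eqF // ltn_addl.
have [lt|ge] := ltnP (i - e) K.
  rewrite (bigD1 (Ordinal lt)) //= pihomog_dE; last first.
    by have := homM (i - e)%N; rewrite subnK.
  rewrite big1 ?addr0 // => j nj; apply: (pihomog_ne0 _ (homM j)).
  by apply: contraNneq nj => ji; apply/eqP/val_inj; rewrite /= -ji addnK.
rewrite big1 => [|j _].
  suff -> : hcomp (i - e) g = 0 by rewrite mul0r.
  rewrite pihomogE big_seq_cond big1 // => m /andP[/msize_mdeg_lt lt /eqP mi].
  by move: (leq_trans lt ge); rewrite mi ltnn.
apply: (pihomog_ne0 _ (homM j)).
by have := ltn_ord j; move: ge ei; lia.
Qed.

Lemma hcompB i f g : hcomp i (f - g) = hcomp i f - hcomp i g.
Proof. exact: raddfB. Qed.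

Lemma hcomp_sum i (J : Type) (r : seq J) (p : pred J) (F : J -> S) :
  hcomp i (\sum_(j <- r | p j) F j) = \sum_(j <- r | p j) hcomp i (F j).
Proof. exact: raddf_sum. Qed.

Lemma hcomp_homog i e f : f \is e.-homog -> hcomp i f = if i == e then f else 0.
Proof.
move=> fe; case: eqP => [->|/eqP ie]; first exact: pihomog_dE.
by apply: pihomog_ne0 fe; rewrite eq_sym.
Qed.

Lemma graded_adjoin I f e : ideal I -> graded I -> f \is e.-homog -> graded (adjoin I f).
Proof.
move=> idI grI fe g [h /grI Ig] i; have := Ig i; rewrite raddfB /= (hcompM _ _ fe).
case: leqP => _ Ii; first by exists (hcomp (i - e) h).
by exists 0; rewrite mul0r.
Qed.

Lemma graded_colon I f e : graded I -> f \is e.-homog -> graded (colon I f).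
Proof.
move=> grI fe g /grI Ig i; have := Ig (i + e)%N; rewrite /colon.
have -> : f * g = g * f by apply: mulrC.
by rewrite (hcompM _ _ fe) leq_addl addnK mulrC.
Qed.

Lemma graded_homog_leading I m : graded I -> leading I m ->
  exists f, [/\ I f, f != 0, mlead f = m & f \is (mdeg m).-homog].
Proof.
move=> grI [f [If f0 fm]]; exists (hcomp (mdeg m) f).
have cm : (hcomp (mdeg m) f)@_m != 0 by rewrite mcoeff_hcomp eqxx -fm mleadc_eq0.
have h0 : hcomp (mdeg m) f != 0.
  by apply: contraNneq cm => ->; rewrite mcoeff0.
split=> //; [exact: grI| |exact: pihomogP].
apply/eqP; rewrite eq_le msupp_le_mlead ?mcoeff_msupp // andbT -fm.
apply: msupp_le_mlead; have := mlead_supp h0.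
by rewrite !mcoeff_msupp mcoeff_hcomp fm; case: ifP => // _; rewrite eqxx.
Qed.

Definition std I (m : 'X_{1..n}) : bool := ~~ `[<leading I m>].

Lemma stdP I m : reflect (~ leading I m) (std I m).
Proof. exact: asboolPn. Qed.

(** For the degree-compatible order, the standard monomials of degree at most
    [j] form a basis of the polynomials of degree at most [j] modulo [I]; so
    [hfa] is the affine Hilbert function of any ideal, and, on graded ideals,
    [hf] is the Hilbert function. *)
Definition stdset I j : pred 'X_{1..n < j.+1} :=
  [pred m : 'X_{1..n < j.+1} | (mdeg m == j) && std I m].
Definition astdset I j : pred 'X_{1..n < j.+1} :=
  [pred m : 'X_{1..n < j.+1} | std I m].
Arguments stdset I j : clear implicits.
Arguments astdset I j : clear implicits.
Definition hf I j := #|stdset I j|.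
Definition hfa I j := #|astdset I j|.

Definition mono j (A : pred 'X_{1..n < j}) (t : {m in A}) : S := 'X_[val (val t)].

Lemma card_bounded_monomials b c (p : pred 'X_{1..n}) :
  (forall m, p m -> (mdeg m < b)%N) -> (b <= c)%N ->
  #|[pred m : 'X_{1..n < b} | p m]| = #|[pred m : 'X_{1..n < c} | p m]|.
Proof.
move=> pb bc; rewrite -!sum1_card.
rewrite (@ssrcomplements.big_sub_widen _ _ _ _ _ _ 'X_{1..n < b} 'X_{1..n < c} p (fun _ => 1%N)) /=.
  by apply: eq_bigl => m /=; rewrite !inE; apply/andP/idP => [[]//|pm]; split=> //; apply: pb.
by move=> m lt; apply: leq_trans lt bc.
Qed.

Lemma hfa_sum I j : hfa I j = (\sum_(i < j.+1) hf I i)%N.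
Proof.
rewrite /hfa /astdset -sum1_card (partition_big (fun m : 'X_{1..n < j.+1} => Ordinal (bmdeg m)) predT) //=.
apply: eq_bigr => i _; rewrite sum1_card /hf /stdset.
pose q m := (mdeg m == i) && std I m.
rewrite (@card_bounded_monomials _ j.+1 q) // => [|m /andP[/eqP -> _] //].
by apply: eq_card => m; rewrite !inE /q andbC.
Qed.

Lemma leq_hfa I j j' : (j <= j')%N -> (hfa I j <= hfa I j')%N.
Proof.
rewrite -ltnS => le; rewrite !hfa_sum (big_ord_widen _ _ le).
by rewrite [leqRHS](bigID (fun i : 'I__ => (i < j.+1)%N)) leq_addr.
Qed.

Lemma hfaS I j : hfa I j.+1 = (hfa I j + hf I j.+1)%N.
Proof. by rewrite !hfa_sum big_ord_recr. Qed.

Lemma monomials_lindep I (T : finType) (v : T -> 'X_{1..n}) :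
  injective v -> (forall t, ~ leading I (v t)) ->
  lindep I (@mpolyC n k) (fun t => 'X_[v t]).
Proof.
move=> v_inj stdv c; set f := \sum_t _ => If.
have cf m : f@_m = \sum_(t | v t == m) c t.
  rewrite raddf_sum [RHS]big_mkcond /=; apply: eq_bigr => t _.
  by rewrite mcoeffCM mcoeffX; case: eqP => _; rewrite ?mulr1 ?mulr0.
have cv t : f@_(v t) = c t.
  by rewrite cf (eq_bigl (pred1 t)) ?big_pred1_eq // => t'; rewrite (inj_eq v_inj).
move=> t; apply/eqP/negPn/negP => ct.
have f0 : f != 0 by apply: contraNneq ct => f0; rewrite -cv f0 mcoeff0.
have := f0; rewrite -mleadc_eq0 cf => h.
have [t' /eqP vt'] : exists t', v t' == mlead f.
  apply: contrapT => /forallNP not'; case/eqP: h; apply: big1 => t' e.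
  by case: (not' t').
by apply: (stdv t'); exists f.
Qed.

Lemma card_subset_type (T : finType) (A : pred T) : #|{: {x in A}}| = #|A|.
Proof. by rewrite card_sig; apply: eq_card. Qed.

Lemma card_stdset I j : #|{: {m in stdset I j}}| = hf I j.
Proof. exact: card_subset_type. Qed.

Lemma card_astdset I j : #|{: {m in astdset I j}}| = hfa I j.
Proof. exact: card_subset_type. Qed.

Lemma hfa_span I j f : ideal I -> (msize f <= j.+1)%N ->
  exists a : {m in astdset I j} -> k, I (f - \sum_t (a t)%:MP * mono t).
Proof.
move=> idI fj; have [r [Ir rP]] := normal_form f idI.
exists (fun t' => r@_(val (val t'))); rewrite -expand_monomials // => m /rP[stdm le].
split; last exact/stdP.
have [f0|f0] := eqVneq f 0.
  by rewrite (leq_ltn_trans (lemc_mdeg le)) // f0 mlead0 mdeg0.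
by rewrite (leq_ltn_trans (lemc_mdeg le)) // mlead_deg.
Qed.

Lemma hf_span I j f : ideal I -> graded I -> f \is j.-homog ->
  exists a : {m in stdset I j} -> k, I (f - \sum_t (a t)%:MP * mono t).
Proof.
move=> idI grI fj; have [r [Ir rP]] := normal_form f idI.
exists (fun t' => (hcomp j r)@_(val (val t'))).
rewrite -(@expand_monomials _ _ _ (fun m => (mdeg m == j) && std I m)) => [|m].
  by rewrite -(pihomog_dE fj) -linearB; apply: grI.
rewrite mcoeff_msupp mcoeff_hcomp; case: (mdeg m =P j) => [mj|]; last by rewrite eqxx.
by rewrite -mcoeff_msupp => /rP[stdm _]; rewrite mj ltnSn; split=> //; apply/stdP.
Qed.

Lemma hf_lindep I j : lindep I (@mpolyC n k) (@mono j.+1 (stdset I j)).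
Proof.
apply: monomials_lindep => [t t' /val_inj/val_inj //|].
by case=> m /= /andP[_ /stdP].
Qed.

Lemma hfa_lindep I j : lindep I (@mpolyC n k) (@mono j.+1 (astdset I j)).
Proof.
apply: monomials_lindep => [t t' /val_inj/val_inj //|].
by case=> m /= /stdP.
Qed.

Lemma mono_homog I j (t : {m in stdset I j}) : mono t \is j.-homog.
Proof. by have /andP[/eqP mj _] := valP t; rewrite dhomogX; apply/eqP. Qed.

Lemma mono_msize j (A : pred 'X_{1..n < j}) (t : {m in A}) : (msize (mono t) <= j)%N.
Proof. by rewrite msizeX bmdeg. Qed.

Lemma lindep_leq_hfa I (T : finType) (u : T -> S) j :
  ideal I -> (forall t, (msize (u t) <= j.+1)%N) -> lindep I (@mpolyC n k) u ->
  (#|T| <= hfa I j)%N.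
Proof.
move=> idI uj ind_u; rewrite -card_astdset.
by apply: (lindep_span idI ind_u) => t; apply: hfa_span.
Qed.

Lemma lindep_leq_hf I (T : finType) (u : T -> S) j :
  ideal I -> graded I -> (forall t, u t \is j.-homog) -> lindep I (@mpolyC n k) u ->
  (#|T| <= hf I j)%N.
Proof.
move=> idI grI uj ind_u; rewrite -card_stdset.
by apply: (lindep_span idI ind_u) => t; apply: hf_span.
Qed.

Lemma span_geq_hf I (T : finType) (w : T -> S) j :
  ideal I ->
  (forall f, f \is j.-homog -> exists a : T -> k, I (f - \sum_t (a t)%:MP * w t)) ->
  (hf I j <= #|T|)%N.
Proof.
move=> idI wP; rewrite -card_stdset.
by apply: (lindep_span idI (@hf_lindep I j)) => t; apply: wP (mono_homog t).
Qed.

Lemma span_geq_hfa I (T : finType) (w : T -> S) j :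
  ideal I ->
  (forall f, (msize f <= j.+1)%N -> exists a : T -> k, I (f - \sum_t (a t)%:MP * w t)) ->
  (hfa I j <= #|T|)%N.
Proof.
move=> idI wP; rewrite -card_astdset.
by apply: (lindep_span idI (@hfa_lindep I j)) => t; apply: wP (mono_msize t).
Qed.

End Homogeneous.

Arguments stdset {k n} I j.
Arguments astdset {k n} I j.
Arguments mono {k n j A} t.

Section HilbertFunction.
Variables (k : fieldType) (n : nat).
Local Notation S := {mpoly k[n]}.
Implicit Types (I J : S -> Prop) (f g : S) (m : 'X_{1..n}).

(** Additivity on the exact sequence
    [0 -> S/(I : f)(-e) -> S/I -> S/(I, f) -> 0]. *)
Lemma hf_adjoin_colon I f e j : ideal I -> graded I -> f \is e.-homog ->
  hf I j = (hf (adjoin I f) j + if (e <= j)%N then hf (colon I f) (j - e) else 0)%N.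
Proof.
move=> idI grI fe.
have idA := ideal_adjoin idI f; have idC := ideal_colon idI f.
have grA := graded_adjoin idI grI fe; have grC := graded_colon grI fe.
apply/eqP; rewrite eqn_leq; apply/andP; split.
  case: (leqP e j) => [ej|je].
    rewrite -(card_stdset (adjoin I f) j).
    rewrite -(card_stdset (colon I f) (j - e)) -card_sum.
    pose w (t : {m in stdset (adjoin I f) j} + {m in stdset (colon I f) (j - e)}) : S :=
      match t with inl t => mono t | inr t => f * mono t end.
    apply: (span_geq_hf (w := w)) => // g gj.
    have [a [h Ih]] := hf_span idA grA gj.
    set r := \sum_t _ in Ih.
    have rj : r \is j.-homog.
      by apply: rpred_sum => t _; rewrite mul_mpolyC; apply/rpredZ/mono_homog.
    have [b Ib] := hf_span idC grC (pihomogP mdeg (j - e) h).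
    exists (fun t => match t with inl t => a t | inr t => b t end).
    rewrite big_sumType /= opprD addrA -/r.
    have := grI _ Ih j; rewrite raddfB /= (hcompM _ _ fe) ej pihomog_dE ?rpredB // => Ih'.
    have := idealD idI Ih' Ib; rewrite /colon mulrBr => {}Ib.
    have -> : \sum_t (b t)%:MP * (f * mono t) = f * \sum_t (b t)%:MP * mono t.
      by rewrite mulr_sumr; apply: eq_bigr => t _; apply: mulrCA.
    by move: Ib; congr (I _); ring.
  rewrite addn0 -(card_stdset (adjoin I f) j).
  apply: (span_geq_hf (w := fun t => mono t)) => // g gj.
  have [a [h Ih]] := hf_span idA grA gj; exists a.
  set r := \sum_t _ in Ih *.
  have rj : r \is j.-homog.
    by apply: rpred_sum => t _; rewrite mul_mpolyC; apply/rpredZ/mono_homog.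
  have := grI _ Ih j; rewrite raddfB /= (hcompM _ _ fe) leqNgt je pihomog_dE ?rpredB //.
  by rewrite subr0.
case: (leqP e j) => [ej|je].
  rewrite -(card_stdset (adjoin I f) j).
  rewrite -(card_stdset (colon I f) (j - e)) -card_sum.
  pose u (t : {m in stdset (adjoin I f) j} + {m in stdset (colon I f) (j - e)}) : S :=
    match t with inl t => mono t | inr t => f * mono t end.
  apply: (lindep_leq_hf (u := u)) => // [[t|t]|c]; first exact: mono_homog.
    by have := dhomogM fe (mono_homog t); rewrite subnKC.
  rewrite big_sumType /= => Ic.
  have ef : \sum_t (c (inr t))%:MP * (f * mono t) = f * \sum_t (c (inr t))%:MP * mono t.
    by rewrite mulr_sumr; apply: eq_bigr => t _; apply: mulrCA.
  have cl : forall t, c (inl t) = 0.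
    apply: (@hf_lindep _ _ (adjoin I f) j (fun t => c (inl t))).
    exists (- \sum_t (c (inr t))%:MP * mono t).
    by move: Ic; rewrite ef; congr (I _); ring.
  move: Ic; rewrite big1 ?add0r => [|t _]; last by rewrite cl mul0r.
  rewrite ef => /(hf_lindep (c := fun t => c (inr t))) cr.
  by case.
rewrite addn0 -(card_stdset (adjoin I f) j).
apply: (lindep_leq_hf (u := fun t => mono t)) => // [t|c Ic]; first exact: mono_homog.
by apply: (@hf_lindep _ _ (adjoin I f) j); apply: sub_adjoin.
Qed.

(** Multiplication by [f] is injective on [S/Q0], and its image lies in the
    kernel of [S/Q0 -> S/Q1]. *)
Lemma hfa_prime_sub (Q0 Q1 : S -> Prop) f e j :
    ideal Q0 -> ideal Q1 -> (forall g, Q0 g -> Q1 g) ->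
    (forall g, Q0 (f * g) -> Q0 g) -> Q1 f -> (msize f <= e.+1)%N ->
  (hfa Q1 (j + e) + hfa Q0 j <= hfa Q0 (j + e))%N.
Proof.
move=> id0 id1 Q01 regf Q1f fe.
rewrite -(card_astdset Q1 (j + e)) -(card_astdset Q0 j) -card_sum.
pose u (t : {m in astdset Q1 (j + e)} + {m in astdset Q0 j}) : S :=
  match t with inl t => mono t | inr t => f * mono t end.
apply: (lindep_leq_hfa (u := u)) => // [[t|t]|c]; first exact: mono_msize.
  rewrite /u; have [->|f0] := eqVneq f 0; first by rewrite mul0r msize0.
  rewrite msizeM // -?msupp_eq0 ?msuppX //.
  by move: fe (mono_msize k t); move: (msize f) (msize (mono t)) => x y; lia.
rewrite big_sumType /= => Ic.
have ef : \sum_t (c (inr t))%:MP * (f * mono t) = f * \sum_t (c (inr t))%:MP * mono t.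
  by rewrite mulr_sumr; apply: eq_bigr => t _; apply: mulrCA.
have cl : forall t, c (inl t) = 0.
  apply: (@hfa_lindep _ _ Q1 (j + e) (fun t => c (inl t))).
  have := Q01 _ Ic; rewrite ef => Q1s.
  have := idealB id1 Q1s (ideal_mulr id1 (\sum_t (c (inr t))%:MP * mono t) Q1f).
  by rewrite addrK.
move: Ic; rewrite big1 ?add0r => [|t _]; last by rewrite cl mul0r.
rewrite ef => /regf/(hfa_lindep (c := fun t => c (inr t))) cr.
by case.
Qed.

Lemma hfa_unit I j : ideal I -> I 1 -> hfa I j = 0%N.
Proof.
move=> idI I1; apply: eq_card0 => m; apply/negbTE/negP => /stdP; apply.
apply: (leadingD (m := 0%MM) idI); last by apply/mnm_lepP=> i; rewrite mnm0E.
by exists 1; rewrite mlead1 oner_neq0.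
Qed.

Lemma hfa_gt0 I j : ideal I -> ~ I 1 -> (0 < hfa I j)%N.
Proof.
move=> idI I1; suff : (#|{: unit}| <= hfa I j)%N by rewrite card_unit.
apply: (@lindep_leq_hfa _ _ I unit (fun=> 1)) => // [_|c]; first by rewrite msize1.
rewrite (big_pred1 tt) => [|[]//]; rewrite mulr1 => Ic [].
apply/eqP; apply: contrapT => /negP c0; apply: I1.
have := ideal_mull idI (c tt)^-1%:MP Ic; by rewrite -mpolyCM mulVf.
Qed.

Lemma hfa_leq_pow I j : (hfa I j <= j.+1 ^ n)%N.
Proof.
apply: leq_trans (max_card _) _.
have -> : (j.+1 ^ n = #|{ffun 'I_n -> 'I_j.+1}|)%N by rewrite card_ffun !card_ord.
apply: (@leq_card _ _ (fun m : 'X_{1..n < j.+1} => [ffun i => inord (val m i)])).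
move=> m1 m2 /ffunP e; apply/val_inj/mnmP => i.
have lt (m : 'X_{1..n < j.+1}) : (val m i < j.+1)%N.
  by apply: leq_ltn_trans (bmdeg m); rewrite mdegE (bigD1 i) //= leq_addr.
by have := e i; rewrite !ffunE => /(congr1 val); rewrite /= (inordK (lt m1)) (inordK (lt m2)).
Qed.

End HilbertFunction.

(** * Growth of Hilbert functions and Krull dimension *)

Definition growth (F : nat -> nat) d := exists C, forall j, (F j <= C * j.+1 ^ d)%N.

Lemma growth_leq (F G : nat -> nat) d :
  (forall j, F j <= G j)%N -> growth G d -> growth F d.
Proof. by move=> FG [C GC]; exists C => j; apply: leq_trans (FG j) (GC j). Qed.

Lemma growthS F d : growth F d -> growth F d.+1.
Proof.
case=> C FC; exists C => j; apply: leq_trans (FC j) _.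
by rewrite leq_mul2l leq_pexp2l ?orbT.
Qed.

Lemma growth_leq_exp F d d' : (d <= d')%N -> growth F d -> growth F d'.
Proof. by move=> /subnKC <- gF; elim: (d' - d)%N => [|e IH]; rewrite ?addn0 ?addnS //; apply: growthS. Qed.

Lemma growthD F G d : growth F d -> growth G d -> growth (fun j => F j + G j)%N d.
Proof.
by move=> [C FC] [D GD]; exists (C + D)%N => j; rewrite mulnDl leq_add.
Qed.

(** A nondecreasing function bounded by the differences of [H], up to a
    constant, grows more slowly than [H] by a factor [j]: summing [j + 1]
    consecutive differences telescopes. *)
Lemma growth_difference (G H : nat -> nat) e K d :
    {homo G : i j / (i <= j)%N} ->
    (forall j, G (j + e) + H j <= H (j + e) + K)%N ->
    (K = 0%N) \/ (0 < d)%N ->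
  growth H d -> growth (fun j => G j * j.+1)%N d.
Proof.
move=> Gmono GH Kd [C HC].
(* Telescoping [i] differences of step [e]; used with [i = j.+1]. *)
have tel i j : (i * G j + H j <= H (j + i * e) + i * K)%N.
  elim: i => [|i IH]; first by rewrite !mul0n addn0 addn0.
  have := GH (j + i * e)%N; rewrite -addnA -mulSnr.
  have := Gmono j (j + i.+1 * e)%N (leq_addr _ _); move: IH.
  by rewrite !mulSn; lia.
exists (C * e.+1 ^ d + K)%N => j; rewrite mulnC.
apply: leq_trans (_ : H (j + j.+1 * e) + j.+1 * K <= _)%N.
  by apply: leq_trans (tel _ _); rewrite leq_addr.
rewrite mulnDl leq_add //; last first.
  case: Kd => [->|d0]; first by rewrite muln0.
  by rewrite mulnC leq_mul2l -{1}[j.+1]expn1 leq_pexp2l ?orbT.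
apply: leq_trans (HC _) _; rewrite -mulnA leq_mul2l -expnMn; apply/orP; right.
by case: d {HC Kd} => [|d]; rewrite ?expn0 // leq_exp2r //; nia.
Qed.

(** Says that [S/I] has dimension less than [d]; the factor [j + 1] makes
    [d = 0] mean that [I] is the unit ideal. *)
Definition dim_lt (k : fieldType) n (I : {mpoly k[n]} -> Prop) d :=
  growth (fun j => hfa I j * j.+1)%N d.

Lemma supremum_max (A : set nat) m :
  A m -> (forall x, A x -> (x <= m)%N) -> supremum 0%N A = m.
Proof.
move=> Am Amax; rewrite /supremum ifF; last by apply/negbTE/set0P; exists m.
case: xgetP => [x -> [ub lub]|/(_ m)[]]; last first.
  by split=> [x /Amax //|y]; apply.
by apply/eqP; rewrite eq_le ub // andbT; apply: lub => x' /Amax.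
Qed.

Section Dimension.
Variables (k : fieldType) (n : nat).
Local Notation S := {mpoly k[n]}.
Local Notation hcomp := (pihomog mdeg).
Implicit Types (I J : S -> Prop) (f g : S) (m : 'X_{1..n}).

Lemma dim_lt_growth I d : dim_lt I d.+1 <-> growth (hfa I) d.
Proof.
split=> -[C IC]; exists C => j; last first.
  by rewrite expnSr mulnA leq_mul2r IC orbT.
by have := IC j; rewrite expnSr mulnA leq_mul2r.
Qed.

Lemma dim_lt_nvars I : dim_lt I n.+1.
Proof. by apply/dim_lt_growth; exists 1%N => j; rewrite mul1n hfa_leq_pow. Qed.

Lemma dim_lt0 I : ideal I -> dim_lt I 0 <-> I 1.
Proof.
move=> idI; split=> [[C IC]|I1]; last by exists 0%N => j; rewrite hfa_unit.
apply: contrapT => nI1; have := IC C; rewrite expn0 muln1.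
have := hfa_gt0 C idI nI1; move: (hfa I C) => x; nia.
Qed.

(** By [hfa_prime_sub] the affine Hilbert function of [Q1] is bounded by the
    differences of that of [Q0]. *)
Lemma dim_lt_sub_prime (Q0 Q1 : S -> Prop) f d :
    ideal Q0 -> ideal Q1 -> (forall g, Q0 g -> Q1 g) ->
    (forall g, Q0 (f * g) -> Q0 g) -> Q1 f ->
  dim_lt Q0 d.+1 -> dim_lt Q1 d.
Proof.
move=> id0 id1 Q01 regf Q1f /dim_lt_growth gQ0.
apply: (growth_difference (e := msize f) (K := 0%N) _ _ _ gQ0).
- by move=> i j; apply: leq_hfa.
- move=> j;  rewrite addn0; apply: (hfa_prime_sub j id0 id1 Q01 regf Q1f (leqnSn _)).
- by left.
Qed.

(** Each inclusion costs one dimension, and the last prime is proper. *)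
Lemma prime_chain_dim (Q : nat -> prime_idealr S) d :
  (forall i, (i < d)%N -> {subset Q i <= Q i.+1} /\ ~ {subset Q i.+1 <= Q i}) ->
  ~ dim_lt (fun f => f \in Q 0%N) d.
Proof.
have idQ (P : prime_idealr S) : ideal (fun f => f \in P).
  split=> [|f g|a f]; [exact: idealr0 | exact: rpredD | exact: idealMr].
elim: d Q => [|d IH] Q chQ.
  by rewrite dim_lt0 // idealr1.
have [sub01 nsub] := chQ 0%N (ltn0Sn d).
have [f Q1f Q0f] : exists2 f, f \in Q 1%N & f \notin Q 0%N.
  apply: contrapT => nof; apply: nsub => f Q1f; apply/negPn/negP => Q0f.
  by apply: nof; exists f.
have regf g : f * g \in Q 0%N -> g \in Q 0%N.
  by rewrite prime_idealrM (negPf Q0f).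
move/(dim_lt_sub_prime (idQ _) (idQ (Q 1%N)) sub01 regf Q1f).
by apply: (IH (fun i => Q i.+1)) => i lt; apply: chQ.
Qed.

Lemma hcomp_eq0 f i : (msize f <= i)%N -> hcomp i f = 0.
Proof.
move=> fi; apply/mpolyP => m; rewrite mcoeff_hcomp mcoeff0.
by case: eqP => // mi; apply/memN_msupp_eq0/msize_mdeg_ge; rewrite mi.
Qed.

Lemma msize_drop_top f i : (msize f <= i.+1)%N -> (msize (f - hcomp i f) <= i)%N.
Proof.
move/msize_leqP => fi; apply/msize_leqP => m; rewrite mcoeffB mcoeff_hcomp.
by case: ltngtP => // [/fi ->|_]; rewrite ?subrr ?subr0.
Qed.

Lemma hcomp_top_mul f g p q : (msize f <= p.+1)%N -> (msize g <= q.+1)%N ->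
  hcomp (p + q) (f * g) = hcomp p f * hcomp q g.
Proof.
move=> fp gq; rewrite -{1}(subrK (hcomp q g) g) mulrDr raddfD /=.
rewrite (hcompM _ _ (pihomogP mdeg q g)) leq_addl addnK hcomp_eq0 ?add0r //.
have [->|f0] := eqVneq f 0; first by rewrite mul0r msize0.
have [->|g0] := eqVneq (g - hcomp q g) 0; first by rewrite mulr0 msize0.
rewrite msizeM //; have := msize_drop_top gq; move: fp.
by move: (msize f) (msize (g - hcomp q g)) => x y; lia.
Qed.

(** Top-degree components that lie in [I] can be removed from [a] and [b]; once
    neither does, they are the required factors. *)
Lemma graded_nonprime I a b : ideal I -> graded I ->
    I (a * b) -> ~ I a -> ~ I b ->
  exists e f e' g, [/\ f \is e.-homog, g \is e'.-homog, ~ I f, ~ I g & I (f * g)].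
Proof.
move=> idI grI; have [N] := ubnP (msize a + msize b)%N.
elim: N a b => // N IH a b; rewrite ltnS => leN Iab Ia Ib.
have I0 := ideal0 idI.
have a0 : a != 0 by apply: contra_not_neq Ia => ->.
have b0 : b != 0 by apply: contra_not_neq Ib => ->.
have [p ap] : exists p, msize a = p.+1 by exists (msize a).-1; rewrite mpolySpred.
have [q bq] : exists q, msize b = q.+1 by exists (msize b).-1; rewrite mpolySpred.
have [Iap|nIap] := pselect (I (hcomp p a)).
  apply: (IH (a - hcomp p a) b) => //.
  - apply: leq_trans leN; rewrite ap ltn_add2r ltnS.
    by apply: msize_drop_top; rewrite ap.
  - by rewrite mulrBl; apply: idealB => //; apply: ideal_mulr.
  - by move=> Ia'; apply: Ia; apply: ideal_congr Ia' Iap.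
have [Ibq|nIbq] := pselect (I (hcomp q b)).
  apply: (IH a (b - hcomp q b)) => //.
  - apply: leq_trans leN; rewrite bq ltn_add2l ltnS.
    by apply: msize_drop_top; rewrite bq.
  - by rewrite mulrBr; apply: idealB => //; apply: ideal_mull.
  - by move=> Ib'; apply: Ib; apply: ideal_congr Ib' Ibq.
exists p, (hcomp p a), q, (hcomp q b); split=> //; try exact: pihomogP.
by rewrite -hcomp_top_mul ?ap ?bq //; apply: grI.
Qed.

Lemma leq_hf I J j : (forall f, I f -> J f) -> (hf J j <= hf I j)%N.
Proof.
move=> IJ; apply/subset_leq_card/fintype.subsetP => m; rewrite !inE.
case/andP=> -> /stdP nJ; apply/stdP => -[f [If f0 fm]]; apply: nJ.
by exists f; split=> //; apply: IJ.
Qed.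

Lemma leq_hfa_sub I J j : (forall f, I f -> J f) -> (hfa J j <= hfa I j)%N.
Proof. by move=> IJ; rewrite !hfa_sum; apply: leq_sum => i _; apply: leq_hf. Qed.

(** Iterating [hf I j = hf (I, l) j + hf (I : l) (j - 1)], where [hf (I : l)]
    is at most [hf I]. *)
Lemma hf_leq_hfa_adjoin I l j :
  ideal I -> graded I -> l \is 1.-homog -> (hf I j <= hfa (adjoin I l) j)%N.
Proof.
move=> idI grI l1; elim: j => [|j IH]; rewrite (hf_adjoin_colon _ idI grI l1).
  by rewrite addn0 hfa_sum big_ord_recl leq_addr.
rewrite hfaS addnC leq_add2r subn1 /=; apply: leq_trans IH.
by apply: leq_hf => f; apply: sub_colon.
Qed.

Lemma dim_lt_adjoin_linear I l d :
  ideal I -> graded I -> l \is 1.-homog -> dim_lt (adjoin I l) d -> dim_lt I d.+1.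
Proof.
move=> idI grI l1 [C JC]; apply/dim_lt_growth; exists C => j.
apply: leq_trans (JC j); rewrite hfa_sum.
apply: leq_trans (_ : \sum_(i < j.+1) hfa (adjoin I l) j <= _)%N.
  apply: leq_sum => i _; apply: leq_trans (hf_leq_hfa_adjoin _ idI grI l1) _.
  by apply: leq_hfa; rewrite -ltnS.
by rewrite sum_nat_const card_ord mulnC.
Qed.

Lemma sum_shift (F : nat -> nat) e j :
  (\sum_(i < j) (if e <= i then F (i - e) else 0) = \sum_(i < j - e) F i)%N.
Proof.
elim: j => [|j IH]; first by rewrite sub0n !big_ord0.
rewrite big_ord_recr /= IH; case: leqP => [ej|je]; first by rewrite subSn // big_ord_recr.
by rewrite addn0; have -> : (j.+1 - e = j - e)%N by lia.
Qed.

Lemma hfa_leq_adjoin_colon I f e j : ideal I -> graded I -> f \is e.-homog ->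
  (hfa I j <= hfa (adjoin I f) j + hfa (colon I f) j)%N.
Proof.
move=> idI grI fe; rewrite !hfa_sum.
under eq_bigr do rewrite (hf_adjoin_colon _ idI grI fe).
rewrite big_split leq_add2l sum_shift.
rewrite (big_ord_widen _ _ (leq_subr e j.+1)) [leqRHS](bigID (fun i : 'I__ => (i < j.+1 - e)%N)).
by rewrite leq_addr.
Qed.

(** An ideal maximal among the graded ideals of dimension at least [d] above
    [I] is prime: for [f g] in it, [(Q, f)] or [(Q : f)] has that dimension. *)
Lemma graded_prime_above I d : ideal I -> graded I -> ~ dim_lt I d ->
  exists Q : S -> Prop, [/\ ideal Q, graded Q, (forall f, I f -> Q f), ~ dim_lt Q d &
    forall a b, Q (a * b) -> Q a \/ Q b].
Proof.
move=> idI; elim/noetherian_ind: idI => {}I idI IH grI nI.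
have [prI|nprI] := pselect (forall a b, I (a * b) -> I a \/ I b); first by exists I.
have [a [b [Iab Ia Ib]]] : exists a b, [/\ I (a * b), ~ I a & ~ I b].
  apply: contrapT => no; apply: nprI => a b Iab; apply: contrapT => /not_orP[Ia Ib].
  by apply: no; exists a, b.
have [e [f [e' [g [fe ge If Ig Ifg]]]]] := graded_nonprime idI grI Iab Ia Ib.
have [dA|nA] := pselect (dim_lt (adjoin I f) d); last first.
  have [|||||Q [idQ grQ IQ nQ prQ]] := IH (adjoin I f).
  - exact: ideal_adjoin.
  - by move=> h; apply: sub_adjoin.
  - by exists f => //; apply: mem_adjoin.
  - exact: graded_adjoin fe.
  - by [].
  by exists Q; split=> // h Ih; apply: IQ; apply: sub_adjoin.
have [dC|nC] := pselect (dim_lt (colon I f) d).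
  case: nI; apply: growth_leq (growthD dA dC) => j.
  by rewrite -mulnDl leq_mul2r (hfa_leq_adjoin_colon _ idI grI fe) orbT.
have [|||||Q [idQ grQ IQ nQ prQ]] := IH (colon I f).
- exact: ideal_colon.
- by move=> h; apply: sub_colon.
- by exists g.
- exact: graded_colon fe.
- by [].
by exists Q; split=> // h Ih; apply: IQ; apply: sub_colon.
Qed.

Lemma prime_of (I : S -> Prop) : ideal I -> ~ I 1 ->
  (forall a b, I (a * b) -> I a \/ I b) ->
  exists Q : prime_idealr S, forall f, f \in Q <-> I f.
Proof.
move=> idI I1 prI; pose Q : S -> bool := fun f => `[< I f >].
have QP f : reflect (I f) (f \in Q) by apply: asboolP.
have idQ : idealr_closed Q.
  split; first by apply/QP; apply: ideal0.
    by apply/negP => /QP.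
  move=> a f g /QP If /QP Ig; apply/QP.
  by apply: idealD => //; apply: ideal_mull.
have prQ : prime_idealr_closed Q.
  by move=> a b /QP/prI[] Ix; apply/orP; [left|right]; apply/QP.
pose Qi := isIdealr.Build S Q idQ.
pose Qp := isPrimeIdealrClosed.Build S Q prQ.
pose Qprime : prime_idealr S := HB.pack Q Qi Qp.
by exists Qprime => f; split=> /QP.
Qed.

Lemma graded_sub_irrelevant I f : ideal I -> graded I -> ~ I 1 -> I f -> f@_0%MM = 0.
Proof.
move=> idI grI I1 If; apply/eqP; apply: contrapT => /negP c0; apply: I1.
have e0 : hcomp 0 f = (f@_0%MM)%:MP.
  apply/mpolyP=> m; rewrite mcoeff_hcomp mcoeffC mdeg_eq0.
  by case: eqP => [->|]; rewrite ?mulr1 ?mulr0.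
have := ideal_mull idI ((f@_0%MM)^-1)%:MP (grI _ If 0%N).
by rewrite e0 -mpolyCM mulVf.
Qed.

Lemma dim_lt_irrelevant I d : ideal I -> (forall i, I 'X_i) -> dim_lt I d.+1.
Proof.
move=> idI IX; apply: (growth_leq_exp (d := 1)) => //.
exists 1%N => j; rewrite mul1n expn1 -{2}[j.+1]mul1n leq_mul2r; apply/orP; right.
apply/card_le1_eqP => m1 m2; rewrite !inE => /stdP n1 /stdP n2.
have z m : ~ leading I m -> m = 0%MM.
  move=> nm; apply/eqP; apply: contrapT => /negP m0; apply: nm.
  have [i mi] : exists i, m i != 0%N.
    apply: contrapT => /forallNP z; case/eqP: m0; apply/mnmP => i.
    by rewrite mnm0E; apply/eqP/negPn/negP/z.
  apply: (leadingD (m := U_(i)%MM)) => //; last by rewrite lep1mP.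
  by exists 'X_i; split; rewrite ?mleadXm // -msupp_eq0 msuppX.
by apply/val_inj; rewrite /= (z _ n1) (z _ n2).
Qed.

(** Start from a prime [Q] of dimension at least [d] and continue above
    [(Q, x_i)], where [x_i] is a variable outside [Q]: this costs one dimension
    only. *)
Lemma exists_prime_chain I d : ideal I -> graded I -> ~ dim_lt I d ->
  exists Q : nat -> prime_idealr S, (forall f, I f -> f \in Q 0%N) /\
    forall i, (i < d)%N -> {subset Q i <= Q i.+1} /\ ~ {subset Q i.+1 <= Q i}.
Proof.
elim: d I => [|d IH] I idI grI nI.
  have I1 : ~ I 1 by rewrite -dim_lt0.
  have [||| m mP] := @prime_of (fun f => f@_0%MM = 0).
  - split=> [|f g f0 g0|a f f0]; first exact: mcoeff0.
      by rewrite mcoeffD f0 g0 addr0.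
    by rewrite rmorphM /= f0 mulr0.
  - by rewrite mcoeff1 eqxx; apply/eqP/oner_neq0.
  - move=> a b; rewrite rmorphM /= => /eqP; rewrite mulf_eq0.
    by case/orP=> /eqP; [left|right].
  exists (fun=> m); split=> // f If; apply/mP => /=.
  exact: graded_sub_irrelevant If.
have [Q [idQ grQ IQ nQ prQ]] := graded_prime_above idI grI nI.
have [i Qi] : exists i, ~ Q 'X_i.
  by apply: contrapT => /forallNP/(_ _)/contrapT QX; apply/nQ/dim_lt_irrelevant.
have X1 : ('X_i : S) \is 1.-homog by rewrite dhomogX /= mdeg1.
have [|||Qs [JQ chQ]] := IH (adjoin Q 'X_i); first exact: ideal_adjoin.
- exact: graded_adjoin X1.
- by move=> dJ; apply: nQ; apply: dim_lt_adjoin_linear dJ.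
have nQ1 : ~ Q 1.
  move=> Q1; apply: Qi; rewrite -['X_i]mulr1; exact: ideal_mull.
have [Q' Q'P] := prime_of idQ nQ1 prQ.
exists (fun j => if j is j'.+1 then Qs j' else Q'); split=> [f /IQ /Q'P //|].
case=> [_|j]; last exact: chQ.
split=> [f /Q'P Qf|sub]; first exact/JQ/sub_adjoin.
by apply: Qi; apply/Q'P/sub/JQ/mem_adjoin.
Qed.

Lemma krull_dim_eq (p : {pred S}) d :
  let I := fun f => f \in p in ideal I -> graded I ->
  ~ dim_lt I d -> dim_lt I d.+1 -> krull_dim p = d.
Proof.
move=> I idI grI nI dI; apply: supremum_max.
  by have [Q QP] := exists_prime_chain idI grI nI; exists Q.
move=> x [Q [IQ chQ]]; rewrite leqNgt; apply/negP => dx.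
apply: (prime_chain_dim chQ); apply: growth_leq_exp dx _.
by apply: growth_leq dI => j; rewrite leq_mul2r leq_hfa_sub ?orbT // => f; apply: IQ.
Qed.

Lemma dim_of_krull_dim (p : {pred S}) :
  let I := fun f => f \in p in ideal I -> graded I -> ~ I 1 ->
  ~ dim_lt I (krull_dim p) /\ dim_lt I (krull_dim p).+1.
Proof.
move=> I idI grI nI1; have exd : exists d, `[< dim_lt I d >].
  by exists n.+1; apply/asboolP/dim_lt_nvars.
case: (ex_minnP exd) => -[|d] /asboolP dI mind; first by case: nI1; apply/(dim_lt0 idI).
have ndI : ~ dim_lt I d by move=> /asboolP/mind; rewrite ltnn.
by rewrite (krull_dim_eq idI grI ndI dI).
Qed.

End Dimension.

(** * General linear forms are regular up to finite length *)

Lemma mpoly_rmorph_eq (R : comNzRingType) n (A : comNzRingType)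
    (f g : {rmorphism {mpoly R[n]} -> A}) :
  (forall c, f c%:MP = g c%:MP) -> (forall i, f 'X_i = g 'X_i) -> f =1 g.
Proof.
move=> fgC fgX p; rewrite [p]mpolyE !rmorph_sum; apply: eq_bigr => m _.
rewrite -mul_mpolyC !rmorphM fgC mpolyXE_id !rmorph_prod; congr (_ * _).
by apply: eq_bigr => i _; rewrite !rmorphXn fgX.
Qed.

Lemma muni_widen (R : comNzRingType) n (i : 'I_n) :
  muni ('X_(widen_ord (leqnSn n) i) : {mpoly R[n.+1]}) = ('X_i)%:P.
Proof.
rewrite muniE msuppX big_seq1 mcoeffX eqxx scale1r mnm1E.
rewrite [_ == ord_max]negbTE ?expr0 ?alg_polyC; last first.
  by apply/eqP => /(congr1 val) /= e; have := ltn_ord i; rewrite e ltnn.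
congr (_ %:P); congr 'X_[_]; apply/mnmP => j; rewrite mnmE !mnm1E.
by rewrite -!(inj_eq val_inj).
Qed.

Lemma muni_max (R : comNzRingType) n :
  muni ('X_ord_max : {mpoly R[n.+1]}) = 'X.
Proof.
rewrite muniE msuppX big_seq1 mcoeffX eqxx scale1r mnm1E eqxx expr1.
rewrite (_ : [multinom _ | _ < n] = 0%MM) ?mpolyX0 ?scale1r //.
apply/mnmP => j; rewrite mnmE mnm1E mnm0E; apply/eqP; rewrite eqb0.
by apply/eqP => /(congr1 val) /= e; have := ltn_ord j; rewrite -e ltnn.
Qed.

Definition poly_eval_at (R : comNzRingType) n (w : 'I_n.+1 -> R) :
    {rmorphism {poly {mpoly R[n]}} -> R} :=
  horner_eval (w ord_max) \o map_poly (meval (fun i => w (widen_ord (leqnSn n) i))).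

Lemma meval_muni (R : comNzRingType) n (w : 'I_n.+1 -> R) (p : {mpoly R[n.+1]}) :
  p.@[w] = poly_eval_at w (muni p).
Proof.
move: p; apply: (mpoly_rmorph_eq (f := meval w) (g := poly_eval_at w \o @muni n R)) => [c|i] /=.
  by rewrite mevalC muniC /= map_polyC /horner_eval hornerC /= mevalC.
rewrite mevalXU; case: (unliftP ord_max i) => [j ->|->]; last first.
  by rewrite muni_max map_polyX /horner_eval hornerX.
have -> : lift ord_max j = widen_ord (leqnSn n) j.
  by apply: val_inj; rewrite /= /bump leqNgt ltn_ord.
by rewrite muni_widen map_polyC /horner_eval hornerC /= mevalXU.
Qed.

Definition mpoly_of_poly (R : comNzRingType) n :
    {rmorphism {poly {mpoly R[n]}} -> {mpoly R[n.+1]}} :=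
  horner_eval 'X_ord_max \o map_poly (@mwiden n R).

Lemma muniK (R : comNzRingType) n : cancel (@muni n R) (@mpoly_of_poly R n).
Proof.
apply: (mpoly_rmorph_eq (f := @mpoly_of_poly R n \o @muni n R) (g := idfun)) => [c|i] /=.
  by rewrite muniC /= map_polyC /horner_eval hornerC /= mwidenC.
case: (unliftP ord_max i) => [j ->|->]; last first.
  by rewrite muni_max map_polyX /horner_eval hornerX.
have -> : lift ord_max j = widen_ord (leqnSn n) j.
  by apply: val_inj; rewrite /= /bump leqNgt ltn_ord.
by rewrite muni_widen map_polyC /horner_eval hornerC /= mwidenX mnmwiden1.
Qed.

Lemma muni_eq0 (R : comNzRingType) n (p : {mpoly R[n.+1]}) : (muni p == 0) = (p == 0).
Proof. exact: (raddf_eq0 _ (can_inj (@muniK R n))). Qed.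

Section Nonvanishing.
Variable k : fieldType.
Hypothesis k_infinite : infinite_set [set: k].

Lemma exists_nonroot (p : {poly k}) : p != 0 -> exists x, p.[x] != 0.
Proof.
move=> p0; apply: contrapT => /forallNP allroot.
have [B _ sizeB] := infinite_set_fset (size p) k_infinite.
have := @max_poly_roots _ p (finmap.enum_fset B) p0.
rewrite ltnNge sizeB => ltP; suff: false by []; apply: ltP; last exact: finmap.fset_uniq.
by apply/allP => x _; apply/negPn/negP => px; apply: (allroot x).
Qed.

Lemma exists_nonvanishing n (p : {mpoly k[n]}) : p != 0 -> exists v, p.@[v] != 0.
Proof.
elim: n p => [|n IH] p p0.
  exists (fun=> 0); rewrite (nvar0_mpolyC p) mevalC; apply: contraNneq p0 => c0.
  by rewrite (nvar0_mpolyC p) c0 mpolyC0.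
have : lead_coef (muni p) != 0 by rewrite lead_coef_eq0 muni_eq0.
case/IH => v pv.
have [|x px] := @exists_nonroot (map_poly (meval v) (muni p)).
  apply: contraNneq pv => /polyP/(_ (size (muni p)).-1).
  by rewrite coef_map coef0 /= => e; rewrite /lead_coef e.
pose w (i : 'I_n.+1) := if unlift ord_max i is Some j then v j else x.
exists w; rewrite meval_muni /= /horner_eval /w unlift_none.
rewrite (_ : map_poly _ _ = map_poly (meval v) (muni p)) //.
apply/polyP => i; rewrite !coef_map /=; apply: meval_eq => j.
have -> : widen_ord (leqnSn n) j = lift ord_max j.
  by apply: val_inj; rewrite /= /bump leqNgt ltn_ord.
by rewrite liftK.
Qed.

End Nonvanishing.

Section GenericVectors.
Variables (k : fieldType) (n : nat).
Hypothesis k_infinite : infinite_set [set: k].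

Definition generic (E : 'rV[k]_n -> Prop) :=
  exists2 F : {mpoly k[n]}, F != 0 & forall v : 'rV[k]_n, F.@[v 0] != 0 -> E v.

Lemma genericT (E : 'rV[k]_n -> Prop) : (forall v, E v) -> generic E.
Proof. by move=> Ev; exists 1 => [|v _]; [exact: oner_neq0 | exact: Ev]. Qed.

Lemma genericW (E E' : 'rV[k]_n -> Prop) :
  (forall v, E v -> E' v) -> generic E -> generic E'.
Proof. by move=> EE' [F F0 FE]; exists F => // v /FE/EE'. Qed.

Lemma genericI (E E' : 'rV[k]_n -> Prop) :
  generic E -> generic E' -> generic (fun v => E v /\ E' v).
Proof.
move=> [F F0 FE] [F' F'0 FE']; exists (F * F') => [|v]; first exact: mulf_neq0.
by rewrite mevalM mulf_eq0 => /norP[/FE ? /FE'].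
Qed.

Lemma generic_exists (E : 'rV[k]_n -> Prop) : generic E -> exists v, E v.
Proof.
move=> [F /(exists_nonvanishing k_infinite)[v Fv] FE]; exists (\row_j v j).
by apply: FE; rewrite (meval_eq (v2 := v)) // => i; rewrite mxE.
Qed.

End GenericVectors.

Section GeneralForms.
Variables (k : fieldType) (n : nat).
Local Notation S := {mpoly k[n]}.
Implicit Types (I J : S -> Prop) (f g z : S).

Definition lform (v : 'rV[k]_n) : S := \sum_i v 0 i *: 'X_i.

Lemma lform_homog v : lform v \is 1.-homog.
Proof. by apply: rpred_sum => i _; apply: rpredZ; rewrite dhomogX /= mdeg1. Qed.

(** Membership in [(I : m^N)], where [m] is the ideal of the variables. *)
Fixpoint colon_power I N z : Prop :=
  if N is N'.+1 then forall i, colon_power I N' ('X_i * z) else I z.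

Definition saturation I z := exists N, colon_power I N z.

Lemma colon_power_sub I J N z :
  (forall f, I f -> J f) -> colon_power I N z -> colon_power J N z.
Proof. by move=> IJ; elim: N z => [|N IH] z /=; [exact: IJ | move=> Iz i; apply: IH]. Qed.

Lemma ideal_colon_power I N : ideal I -> ideal (colon_power I N).
Proof.
move=> idI; elim: N => [|N IH] //=; split=> [i|f g If Ig i|a f If i].
- by rewrite mulr0; apply: ideal0.
- by rewrite mulrDr; apply: idealD.
- by rewrite mulrCA; apply: ideal_mull.
Qed.

Lemma leq_colon_power I N N' z :
  ideal I -> (N <= N')%N -> colon_power I N z -> colon_power I N' z.
Proof.
move=> idI /subnKC <- Iz; elim: (N' - N)%N => [|e IH]; rewrite ?addn0 ?addnS //= => i.
exact: ideal_mull (ideal_colon_power _ idI) _ _ IH.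
Qed.

Lemma colon_power_colon I f N z : colon_power (colon I f) N z -> colon_power I N (f * z).
Proof. by elim: N z => [|N IH] z //= Iz i; rewrite mulrCA; apply: IH. Qed.

Lemma saturation_step I z : ideal I ->
  (forall i, saturation I ('X_i * z)) -> saturation I z.
Proof.
move=> idI /choice[N NP]; exists (\max_i N i).+1 => i /=.
by apply: leq_colon_power (NP i) => //; apply: (leq_bigmax i).
Qed.

Lemma saturation_no_socle I z :
  (forall z, (forall i, I ('X_i * z)) -> I z) -> saturation I z -> I z.
Proof. by move=> soc [N]; elim: N z => [|N IH] z //= Iz; apply: soc => i; apply: IH. Qed.

(** If [r a] is the normal form of the variable [x_a], then [lform v] is in [I]
    only if [sum_a v_a r_a = 0], and [r i] is nonzero: its leading monomial
    yields a nontrivial linear equation on [v]. *)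
Lemma generic_notin I i : ideal I -> ~ I 'X_i -> generic (fun v => ~ I (lform v)).
Proof.
move=> idI Ii.
have /choice[r rP] : forall a : 'I_n, exists r, I ('X_a - r) /\
    forall m, m \in msupp r -> ~ leading I m.
  by move=> a; have [r [Ir rP]] := normal_form 'X_a idI; exists r; split=> // m /rP[].
have ri0 : r i != 0.
  by apply: contra_not_neq Ii => ri0; have := (rP i).1; rewrite ri0 subr0.
pose m := mlead (r i).
exists (\sum_a (r a)@_m *: 'X_a) => [|v].
  apply/negP => /eqP/(congr1 (mcoeff U_(i)%MM)); rewrite mcoeff0 raddf_sum /= (bigD1 i) //=.
  rewrite big1 ?addr0 => [|a ai]; last by rewrite mcoeffZ mcoeffXU (negPf ai) mulr0.
  by rewrite mcoeffZ mcoeffXU eqxx mulr1 => /eqP; rewrite mleadc_eq0 (negPf ri0).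
rewrite raddf_sum /= => Fv Iv; case/eqP: Fv.
pose s := \sum_a v 0 a *: r a.
have Is : I s.
  apply: (ideal_congr_sym idI) Iv; rewrite -sumrB; apply: ideal_sum => // a _.
  by rewrite -scalerBr -mul_mpolyC; apply: ideal_mull => //; have [] := rP a.
have s0 : s = 0.
  apply/eqP; apply: contrapT => /negP s0.
  have : mlead s \in msupp s by apply: mlead_supp.
  rewrite mcoeff_msupp raddf_sum /= => ns.
  have [a na] : exists a, mlead s \in msupp (r a).
    apply: contrapT => /forallNP no; case/eqP: ns; apply: big1 => a _.
    by rewrite mcoeffZ (memN_msupp_eq0 (introN idP (no a))) mulr0.
  by apply: (rP a).2 na _; exists s.
have := congr1 (mcoeff m) s0; rewrite mcoeff0 raddf_sum /= => e; rewrite -[RHS]e.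
by apply: eq_bigr => a _; rewrite mevalZ mevalXU mcoeffZ mulrC.
Qed.

(** By Noetherian induction: for a prime this is [generic_notin], and if
    [f g] is in [I] with [f] and [g] outside, the conclusions for [(I, f)] and
    for [(I : f)] combine along
    [0 -> S/(I : f) -> S/I -> S/(I, f) -> 0]. *)
Lemma generic_filter_regular I : ideal I ->
  generic (fun v => forall z, I (lform v * z) -> saturation I z).
Proof.
move=> idI; elim/noetherian_ind: idI => {}I idI IH.
have [prI|nprI] := pselect (forall a b, I (a * b) -> I a \/ I b).
  have [allX|/existsNP[i Ii]] := pselect (forall i, I 'X_i).
    apply: genericT => v z _; exists 1%N => i /=; exact: ideal_mulr.
  apply: genericW (generic_notin idI Ii) => v nIv z /prI[//|Iz].
  by exists 0%N.
have [f [g [Ifg If Ig]]] : exists a b, [/\ I (a * b), ~ I a & ~ I b].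
  apply: contrapT => no; apply: nprI => a b Iab; apply: contrapT => /not_orP[Ia Ib].
  by apply: no; exists a, b.
have gA : generic (fun v => forall z, adjoin I f (lform v * z) -> saturation (adjoin I f) z).
  apply: IH; first exact: ideal_adjoin; first by move=> h; apply: sub_adjoin.
  by exists f => //; apply: mem_adjoin.
have gC : generic (fun v => forall z, colon I f (lform v * z) -> saturation (colon I f) z).
  apply: IH; first exact: ideal_colon; first by move=> h; apply: sub_colon.
  by exists g.
apply: genericW (genericI gA gC) => v [vA vC] z Iz.
have [N] := vA z (sub_adjoin f Iz).
(* The base case: [z = h f] modulo [I], and [l h] is in [(I : f)]. *)
elim: N z Iz => [|N IHN] z Iz /=.
  case=> h Ih; have : I (lform v * (z - h * f)) by apply: ideal_mull.
  rewrite mulrBr => Ih'; have Ih2 := ideal_congr_sym idI Ih' Iz.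
  have [|N] := vC h; first by rewrite /colon; move: Ih2; congr (I _); ring.
  move/colon_power_colon => IN; exists N.
  apply: (ideal_congr (g := h * f) (ideal_colon_power N idI)); last by rewrite mulrC.
  exact: (@leq_colon_power _ 0).
move=> Az; apply: saturation_step => // i; apply: IHN (Az i).
by rewrite mulrCA; apply: ideal_mull.
Qed.

Lemma socle_mul I z h : ideal I -> (forall i, I ('X_i * z)) -> h@_0%MM = 0 -> I (h * z).
Proof.
move=> idI Iz h0; rewrite [h]mpolyE mulr_suml big_seq; apply: ideal_sum => // m mh.
have m0 : m != 0%MM by apply: contraTneq mh => ->; rewrite mcoeff_msupp h0 eqxx.
have [i mi] : exists i, m i != 0%N.
  apply: contrapT => /forallNP no; case/eqP: m0; apply/mnmP => i.
  by rewrite mnm0E; apply/eqP/negPn/negP/no.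
have -> : m = (m - U_(i) + U_(i))%MM by rewrite submK // lep1mP.
by rewrite mpolyXD -mul_mpolyC -!mulrA; do 2 !apply: ideal_mull => //.
Qed.

(** Noetherian induction: the products of a socle element [z0] of degree [e]
    with forms of positive degree are in [I], so that [(I, z0)] and [I] agree in
    degrees above [e]. *)
Lemma saturation_large_degree I : ideal I -> graded I ->
  exists Q, forall q z, (Q <= q)%N -> z \is q.-homog -> saturation I z -> I z.
Proof.
move=> idI; elim/noetherian_ind: idI => {}I idI IH grI.
have [[e [z0 [z0e Iz0 soc]]]|nosoc] :=
    pselect (exists e z, [/\ z \is e.-homog, ~ I z & forall i, I ('X_i * z)]).
  have [||||Q QP] := IH (adjoin I z0).
  - exact: ideal_adjoin.
  - by move=> h; apply: sub_adjoin.
  - by exists z0 => //; apply: mem_adjoin.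
  - exact: graded_adjoin z0e.
  exists (maxn Q e.+1) => q z; rewrite geq_max => /andP[Qq eq] zq [N Nz].
  have [|h /grI/(_ q)] := QP q z Qq zq.
    by exists N; apply: colon_power_sub Nz => h; apply: sub_adjoin.
  rewrite raddfB /= pihomog_dE // (hcompM _ _ z0e) (ltnW eq) => Ih.
  apply: (ideal_congr idI Ih); apply: socle_mul => //.
  by rewrite mcoeff_hcomp mdeg0 eq_sym subn_eq0 leqNgt eq.
exists 0%N => q z _ zq [N]; elim: N z q zq => [|N IHN] z q zq //= Nz.
apply: contrapT => Iz; apply: nosoc; exists q, z; split=> // i.
apply: (IHN _ (1 + q)%N) => //; apply: dhomogM => //.
by rewrite dhomogX /= mdeg1.
Qed.

(** For a graded [I], this means that [0 :_(S/I) l] has finite length. *)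
Definition filter_regular I (l : S) :=
  exists Q, forall q z, (Q <= q)%N -> z \is q.-homog -> I (l * z) -> I z.

Lemma generic_filter_regular_graded I : ideal I -> graded I ->
  generic (fun v => filter_regular I (lform v)).
Proof.
move=> idI grI; have [Q QP] := saturation_large_degree idI grI.
apply: genericW (generic_filter_regular idI) => v satv.
by exists Q => q z Qq zq /satv; apply: (QP q).
Qed.

(** Without socle, [I] is saturated. *)
Lemma generic_regular I : ideal I -> (forall z, (forall i, I ('X_i * z)) -> I z) ->
  generic (fun v => forall z, I (lform v * z) -> I z).
Proof.
move=> idI soc; apply: genericW (generic_filter_regular idI) => v satv z /satv.
exact: saturation_no_socle.
Qed.

End GeneralForms.

(** * Hilbert numerators along a filter-regular sequence *)

Section Defect.
Variables (k : fieldType) (n : nat).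
Local Notation S := {mpoly k[n]}.
Implicit Types (I J : S -> Prop) (f g z l : S).

(** The Hilbert function of [(I : l) / I]. *)
Definition defect I l j := (hf I j - hf (colon I l) j)%N.

Lemma leq_hf_colon I l j : ideal I -> (hf (colon I l) j <= hf I j)%N.
Proof. by move=> idI; apply: leq_hf => f; apply: sub_colon. Qed.

Lemma hf_adjoin_step I l j : ideal I -> graded I -> l \is 1.-homog ->
  (hf (adjoin I l) j.+1 + hf I j = hf I j.+1 + defect I l j)%N.
Proof.
move=> idI grI l1; rewrite [in RHS](hf_adjoin_colon _ idI grI l1) subn1 /=.
by rewrite -addnA subnKC // leq_hf_colon.
Qed.

Lemma hf_adjoin_step0 I l : ideal I -> graded I -> l \is 1.-homog ->
  hf (adjoin I l) 0 = hf I 0.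
Proof. by move=> idI grI l1; rewrite [in RHS](hf_adjoin_colon _ idI grI l1) addn0. Qed.

Lemma defect_eq0 I l j : ideal I -> graded I -> l \is 1.-homog ->
  (forall z, z \is j.-homog -> I (l * z) -> I z) -> defect I l j = 0%N.
Proof.
move=> idI grI l1 reg; apply/eqP; rewrite subn_eq0.
apply/subset_leq_card/fintype.subsetP => m; rewrite !inE => /andP[mj /stdP nI].
rewrite mj; apply/stdP => /(graded_homog_leading (graded_colon grI l1)).
case=> f [If f0 fm fmm]; apply: nI; exists f; split=> //.
by apply: reg If; rewrite -(eqP mj).
Qed.

Lemma defect_neq0 I l j : ideal I -> graded I -> l \is 1.-homog ->
  defect I l j <> 0%N -> exists z, [/\ z \is j.-homog, I (l * z) & ~ I z].
Proof.
move=> idI grI l1 ne; apply: contrapT => no; apply: ne; apply: defect_eq0 => // z zj Iz.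
by apply: contrapT => nIz; apply: no; exists z.
Qed.

Lemma filter_regular_defect I l : ideal I -> graded I -> l \is 1.-homog ->
  filter_regular I l -> exists Q, forall j, (Q <= j)%N -> defect I l j = 0%N.
Proof.
move=> idI grI l1 [Q reg]; exists Q => j Qj; apply: defect_eq0 => // z zj.
exact: (reg j).
Qed.

Lemma hfa_adjoin_step I l j : ideal I -> graded I -> l \is 1.-homog ->
  (hfa (adjoin I l) j.+1 + hfa I j = hfa I j.+1 + \sum_(i < j.+1) defect I l i)%N.
Proof.
move=> idI grI l1; rewrite !hfa_sum big_ord_recl [in RHS]big_ord_recl.
rewrite (hf_adjoin_step0 idI grI l1) -!addnA; congr (_ + _)%N.
rewrite -!big_split; apply: eq_bigr => i _.
by rewrite !lift0; apply: hf_adjoin_step.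
Qed.

Lemma sum_defect_bounded (F : nat -> nat) Q j : (forall i, (Q <= i)%N -> F i = 0%N) ->
  (\sum_(i < j) F i <= \sum_(i < Q) F i)%N.
Proof.
move=> FQ; have [jQ|Qj] := leqP j Q.
  rewrite (big_ord_widen _ _ jQ) [leqRHS](bigID (fun i : 'I__ => (i < j)%N)).
  by rewrite leq_addr.
rewrite (big_ord_widen _ _ (ltnW Qj)) (bigID (fun i : 'I__ => (i < Q)%N)) /=.
rewrite [X in (_ + X)%N]big1 ?addn0 // => i; rewrite -leqNgt => Qi; exact: FQ.
Qed.

(** The zero-divisors of [l] contribute a bounded amount, the constant [K] of
    [growth_difference]. *)
Lemma dim_lt_filter_regular I l d : ideal I -> graded I -> l \is 1.-homog ->
  filter_regular I l -> (0 < d)%N -> dim_lt I d.+1 -> dim_lt (adjoin I l) d.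
Proof.
move=> idI grI l1 /(filter_regular_defect idI grI l1)[Q defQ] d0 /dim_lt_growth gI.
apply: (growth_difference (e := 1) (K := \sum_(i < Q) defect I l i) _ _ _ gI).
- by move=> i j; apply: leq_hfa.
- by move=> j; rewrite addn1 hfa_adjoin_step // leq_add2l; apply: sum_defect_bounded.
- by right.
Qed.

Fixpoint tower I (vs : seq 'rV[k]_n) : S -> Prop :=
  if vs is v :: vs' then tower (adjoin I (lform v)) vs' else I.

Fixpoint filter_regular_seq I (vs : seq 'rV[k]_n) : Prop :=
  if vs is v :: vs' then
    filter_regular I (lform v) /\ filter_regular_seq (adjoin I (lform v)) vs'
  else True.

Lemma tower_rcons I vs v : tower I (rcons vs v) = adjoin (tower I vs) (lform v).
Proof. by elim: vs I => //= w vs IH I; rewrite IH. Qed.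

Lemma ideal_tower I vs : ideal I -> ideal (tower I vs).
Proof. by elim: vs I => //= v vs IH I idI; apply/IH/ideal_adjoin. Qed.

Lemma graded_tower I vs : ideal I -> graded I -> graded (tower I vs).
Proof.
elim: vs I => //= v vs IH I idI grI; apply: IH; first exact: ideal_adjoin.
exact: graded_adjoin (lform_homog v).
Qed.

Lemma sub_tower I vs f : I f -> tower I vs f.
Proof. by elim: vs I => //= v vs IH I If; apply/IH/sub_adjoin. Qed.

Lemma filter_regular_seq_cat I vs ws : filter_regular_seq I (vs ++ ws) <->
  filter_regular_seq I vs /\ filter_regular_seq (tower I vs) ws.
Proof.
elim: vs I => [|v vs IH] I /=; first by split=> [|[]].
by rewrite IH; split=> [[? []]|[[]]].
Qed.

Lemma dim_lt_tower I vs d : ideal I -> graded I -> filter_regular_seq I vs ->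
  dim_lt I (d + size vs).+1 -> dim_lt (tower I vs) d.+1.
Proof.
move=> idI grI; elim: vs I idI grI => [|v vs IH] I idI grI /=; first by rewrite addn0.
case=> fv fvs dI; apply: IH => //; first exact: ideal_adjoin.
  exact: graded_adjoin (lform_homog v).
by apply: dim_lt_filter_regular => //; [exact: lform_homog | rewrite -addnS].
Qed.

(** A linear form lowers the dimension by at most one. *)
Lemma ndim_lt_tower I vs d : ideal I -> graded I ->
  ~ dim_lt I (d + size vs) -> ~ dim_lt (tower I vs) d.
Proof.
elim: vs I => [|v vs IH] I idI grI /=; first by rewrite addn0.
rewrite addnS => nI; apply: IH; first exact: ideal_adjoin.
  exact: graded_adjoin (lform_homog v).
by move/(dim_lt_adjoin_linear idI grI (lform_homog v)).
Qed.

Lemma dim_lt1_hf I : dim_lt I 1 -> exists Q, forall j, (Q <= j)%N -> hf I j = 0%N.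
Proof.
case/dim_lt_growth=> C bC; apply: contrapT => no.
have big N : exists j, (N <= hfa I j)%N.
  elim: N => [|N [j Nj]]; first by exists 0%N.
  have [i [ji hi]] : exists i, (j < i)%N /\ hf I i <> 0%N.
    apply: contrapT => noi; apply: no; exists j.+1 => i ji; apply: contrapT => hi.
    by apply: noi; exists i.
  case: i ji hi => // i ji /eqP hi; exists i.+1; rewrite hfaS -addn1 leq_add ?lt0n //.
  by apply: leq_trans Nj (leq_hfa _ _).
by have [j] := big C.+1; rewrite ltnNge; have := bC j; rewrite expn0 muln1 => ->.
Qed.

End Defect.

Definition convolution (a : {poly int}) (h : nat -> int) i : int :=
  \sum_(j < i.+1) a`_j * h (i - j)%N.

Lemma convolution_coef a h N i : (i < N)%N ->
  convolution a h i = (a * \poly_(j < N) h j)`_i.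
Proof.
move=> iN; rewrite coefM; apply: eq_bigr => j _; rewrite coef_poly.
by rewrite (leq_ltn_trans (leq_subr _ _) iN).
Qed.

Lemma convolutionM a b h i : convolution (a * b) h i = convolution a (convolution b h) i.
Proof.
rewrite (convolution_coef _ _ (ltnSn i)) -mulrA coefM; apply: eq_bigr => j _.
by rewrite (@convolution_coef b h i.+1 (i - j)%N) // ltnS leq_subr.
Qed.

Lemma eq_convolution a h h' i : h =1 h' -> convolution a h i = convolution a h' i.
Proof. by move=> e; apply: eq_bigr => j _; rewrite e. Qed.

(** [q] is [(1 - t)^D] times the Hilbert series of [S/I]. *)
Definition hilbert_numerator (k : fieldType) n (I : {mpoly k[n]} -> Prop) D (q : {poly int}) :=
  forall i, q`_i = convolution ((1 - 'X) ^+ D) (fun j => (hf I j)%:Z) i.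

Section Numerator.
Variables (k : fieldType) (n : nat).
Local Notation S := {mpoly k[n]}.
Implicit Types (I J : S -> Prop) (l : S).

(** The identity [h_(S/(I, l)) = (1 - t) h_(S/I) + t p], where [p] is the
    Hilbert series of [(I : l) / I], multiplied by [(1 - t)^D]. *)
Lemma hilbert_numerator_step I l D q : ideal I -> graded I -> l \is 1.-homog ->
  filter_regular I l -> hilbert_numerator (adjoin I l) D q ->
  exists Q, (forall j, (Q <= j)%N -> defect I l j = 0%N) /\
   hilbert_numerator I D.+1
     (q - (1 - 'X) ^+ D * ('X * \poly_(j < Q) (defect I l j)%:Z)).
Proof.
move=> idI grI l1 /(filter_regular_defect idI grI l1)[Q defQ] qP; exists Q; split=> // i.
set p := \poly_(j < Q) _; rewrite coefB qP exprSr convolutionM.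
have pE j : p`_j = (defect I l j)%:Z.
  by rewrite coef_poly; case: ltnP => // /defQ ->.
clearbody p.
have step j : convolution (1 - 'X) (fun j => (hf I j)%:Z) j =
    (hf (adjoin I l) j)%:Z - ('X * p)`_j.
  rewrite (convolution_coef _ _ (ltnSn j)) mulrBl mul1r coefB !coefXM !coef_poly ltnSn.
  case: j => [|j] /=; first by rewrite (hf_adjoin_step0 idI grI l1) !subr0.
  have := congr1 Posz (hf_adjoin_step j idI grI l1); rewrite !PoszD => e.
  rewrite pE ltnS leqnSn; apply/eqP; rewrite subr_eq addrAC eq_sym subr_eq.
  by rewrite e.
rewrite (eq_convolution _ _ step) /convolution coefM -sumrB.
by apply: eq_bigr => j _; rewrite mulrBr.
Qed.

Lemma hilbert_numerator_exists I vs : ideal I -> graded I -> filter_regular_seq I vs ->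
  dim_lt I (size vs).+1 -> exists q, hilbert_numerator I (size vs) q.
Proof.
elim: vs I => [|v vs IH] I idI grI /=.
  move=> _ /dim_lt1_hf[Q hQ]; exists (\poly_(j < Q) (hf I j)%:Z) => i.
  rewrite expr0 (convolution_coef _ _ (ltnSn i)) mul1r !coef_poly ltnSn.
  by case: ltnP => // /hQ ->.
case=> fv fvs dI; have idA := ideal_adjoin idI (lform v).
have grA := graded_adjoin idI grI (lform_homog v).
have [|q qP] := IH _ idA grA fvs.
  by apply: dim_lt_filter_regular => //; apply: lform_homog.
by have [Q [_ ?]] := hilbert_numerator_step idI grI (lform_homog v) fv qP; eexists; eassumption.
Qed.

Lemma hilbert_numerator_unique I D q q' :
  hilbert_numerator I D q -> hilbert_numerator I D q' -> q = q'.
Proof. by move=> qP q'P; apply/polyP => i; rewrite qP q'P. Qed.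

(** Expansion of [q] in powers of [t - 1]. *)
Definition shifted (q : {poly int}) := q \Po ('X + 1).

Lemma shifted_step q p D : shifted (q - (1 - 'X) ^+ D * ('X * p)) =
  shifted q - (-1) ^+ D *: ('X^D * (('X + 1) * shifted p)).
Proof.
rewrite /shifted comp_polyB; congr (_ - _).
rewrite !comp_polyM comp_polyX (rmorphXn (comp_poly ('X + 1))) /=.
rewrite comp_polyB comp_polyX -{1}polyC1 comp_polyC polyC1.
have -> : 1 - ('X + 1) = - 'X :> {poly int} by ring.
by rewrite [(- 'X) ^+ D]exprNn -mul_polyC polyC_exp polyCN polyC1 -!mulrA.
Qed.

Lemma coef_shifted_lt q p D i : (i < D)%N ->
  (shifted (q - (1 - 'X) ^+ D * ('X * p)))`_i = (shifted q)`_i.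
Proof. by move=> iD; rewrite shifted_step coefB coefZ coefXnM iD mulr0 subr0. Qed.

Lemma coef_shifted_eq q p D :
  (shifted (q - (1 - 'X) ^+ D * ('X * p)))`_D = (shifted q)`_D - (-1) ^+ D * p.[1].
Proof.
rewrite shifted_step coefB coefZ coefXnM ltnn subnn -[X in _ * X]horner_coef0.
rewrite hornerM /shifted horner_comp !hornerE.
by rewrite /= mulr1.
Qed.

Lemma hilbert_numerator_tower I vs D q' : ideal I -> graded I -> filter_regular_seq I vs ->
  hilbert_numerator (tower I vs) D q' ->
  exists q, hilbert_numerator I (D + size vs) q /\
    forall i, (i < D)%N -> (shifted q)`_i = (shifted q')`_i.
Proof.
elim: vs I => [|v vs IH] I idI grI /=; first by exists q'; rewrite addn0.
case=> fv fvs q'P; have idA := ideal_adjoin idI (lform v).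
have grA := graded_adjoin idI grI (lform_homog v).
have [q [qP qi]] := IH _ idA grA fvs q'P.
have [Q [_ rP]] := hilbert_numerator_step idI grI (lform_homog v) fv qP.
exists (q - (1 - 'X) ^+ (D + size vs) * ('X * \poly_(j < Q) (defect I (lform v) j)%:Z)).
rewrite addnS; split=> // i iD; rewrite coef_shifted_lt ?qi //.
exact: leq_trans iD (leq_addr _ _).
Qed.

Lemma hilbert_funE (p : {pred S}) j :
  let I := fun f => f \in p in ideal I -> graded I -> hilbert_fun p j = hf I j.
Proof.
move=> I idI grI; apply: supremum_max => [|t [b [bj ind_b]]].
  exists [tuple mono (enum_val (cast_ord (esym (card_stdset I j)) i)) | i < hf I j].
  split=> [i|c Ic i]; first by rewrite tnth_mktuple mono_homog.
  have := @hf_lindep _ _ I j (fun t => c (cast_ord (card_stdset I j) (enum_rank t))).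
  move=> ind; rewrite -(ind _ (enum_val (cast_ord (esym (card_stdset I j)) i))).
    by rewrite enum_valK cast_ordKV.
  move: Ic; congr (I _); rewrite (reindex_onto (fun t => cast_ord (card_stdset I j) (enum_rank t))
    (fun i => enum_val (cast_ord (esym (card_stdset I j)) i))) /=.
    apply: eq_big => t; first by rewrite cast_ordK enum_rankK eqxx.
    by rewrite tnth_mktuple cast_ordK enum_rankK mul_mpolyC.
  by move=> i' _; rewrite enum_valK cast_ordKV.
rewrite -(card_ord t); apply: (lindep_leq_hf (u := tnth b)) => // c.
by under eq_bigr do rewrite mul_mpolyC; apply: ind_b.
Qed.

Lemma hilbert_numE (p : {pred S}) q :
  let I := fun f => f \in p in ideal I -> graded I ->
  hilbert_numerator I (krull_dim p) q -> hilbert_num p = q.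
Proof.
move=> I idI grI qP; rewrite /hilbert_num.
have isP q' : is_hilbert_num p q' <-> hilbert_numerator I (krull_dim p) q'.
  by split=> q'P i; rewrite q'P; apply: eq_bigr => j _; rewrite hilbert_funE.
case: xgetP => [q' _ /isP q'P|/(_ q)[]]; last exact/isP.
exact: hilbert_numerator_unique q'P qP.
Qed.

End Numerator.

(** * Polynomial rings over a field have enough primes *)

Definition divides (A : comNzRingType) (a b : A) := exists c, b = c * a.

Definition prime_element (A : idomainType) (p : A) :=
  [/\ p != 0, p \isn't a GRing.unit &
      forall a b, divides p (a * b) -> divides p a \/ divides p b].

(** Existence of a factorization into prime elements implies its uniqueness. *)
Definition factorial_ring (A : idomainType) := forall a : A, a != 0 ->
  exists u (ps : seq A), [/\ u \is a GRing.unit,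
    (forall p, p \in ps -> prime_element p) & a = u * \prod_(p <- ps) p].

Section Factorial.
Variable R : idomainType.
Implicit Types f g : {poly R}.

Lemma divides_polyC (p : R) f : divides p%:P f <-> forall i, divides p f`_i.
Proof.
split=> [[g ->] i|/choice[c cP]]; first by exists g`_i; rewrite coefMC.
exists (\poly_(i < size f) c i); apply/polyP => i; rewrite coefMC coef_poly.
by case: ltnP => [_|/leq_sizeP ->]; rewrite ?mul0r // -cP.
Qed.

Lemma divides_sum (A : comNzRingType) (p : A) (I : Type) (r : seq I) (P : pred I) (F : I -> A) :
  (forall i, P i -> divides p (F i)) -> divides p (\sum_(i <- r | P i) F i).
Proof.
move=> pF; apply: big_ind => //; first by exists 0; rewrite mul0r.
by move=> x y [c ->] [d ->]; exists (c + d); rewrite mulrDl.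
Qed.

Lemma prime_polyC (p : R) : prime_element p -> prime_element p%:P.
Proof.
case=> p0 pu pP; split.
- by rewrite polyC_eq0.
- by rewrite poly_unitE coefC eqxx (negPf pu) andbF.
move=> f g pfg; apply: contrapT => /not_orP[/divides_polyC pf /divides_polyC pg].
have min_coef (h : {poly R}) : ~ (forall i, divides p h`_i) ->
    exists i, ~ divides p h`_i /\ forall j, (j < i)%N -> divides p h`_j.
  move=> /existsNP[i0 i0P]; have exi : exists i, ~~ `[< divides p h`_i >].
    by exists i0; apply/asboolPn.
  case: (ex_minnP exi) => i /asboolPn iP imin; exists i; split=> // j ji.
  apply: contrapT => jP; have := imin j; rewrite leqNgt ji => /(_ _)/negP; case=> //.
  exact/asboolPn.
have [i [fi fmin]] := min_coef f pf; have [j [gj gmin]] := min_coef g pg.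
have [c] := (divides_polyC _ _).1 pfg (i + j)%N.
have iP : (i < (i + j).+1)%N by rewrite ltnS leq_addr.
rewrite coefM (bigD1 (Ordinal iP)) //= addKn => e.
suff [/fi|/gj] : divides p f`_i \/ divides p g`_j by [].
apply: pP.
have [d de] : divides p (\sum_(a < (i + j).+1 | a != Ordinal iP) f`_a * g`_(i + j - a)).
  apply: divides_sum => a ai; case: (ltngtP a i) => [/fmin[b ->]|ia|ia].
  - by exists (b * g`_(i + j - a)); rewrite mulrAC.
  - have /gmin[b ->] : (i + j - a < j)%N by have := ltn_ord a; move: ia; lia.
    by exists (f`_a * b); rewrite mulrA.
  - by case/eqP: ai; apply: val_inj.
by exists (c - d); rewrite mulrBl -de -e addrK.
Qed.

(** No prime of [R] divides [g]: the polynomials whose divisibilities over the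
    fraction field of [R] descend to [R]. *)
Definition primitive g := forall p : R, prime_element p -> ~ divides p%:P g.

(** Remove the prime factors of [c] one at a time: none of them divides [g], so
    each divides [h]. *)
Lemma primitive_cancel (c : R) f g h : factorial_ring R -> primitive g -> c != 0 ->
  c%:P * f = h * g -> divides g f.
Proof.
move=> facR prg /facR[u [ps [uu psP ->]]].
elim: ps h psP => [|p ps IH] h psP.
  rewrite big_nil mulr1 => e; exists ((u^-1)%:P * h).
  by rewrite -mulrA -e mulrA -polyCM mulVr // mul1r.
rewrite big_cons mulrCA polyCM -mulrA => e.
have prp := prime_polyC (psP p (mem_head _ _)); have [p0 _ pM] := prp.
have [|[h1 h1E]|pg] := pM h g; last by case: (prg p (psP p (mem_head _ _))).
  by exists ((u * \prod_(j <- ps) j)%:P * f); rewrite -e mulrC.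
apply: (IH h1) => [q qps|]; first by apply: psP; rewrite inE qps orbT.
by apply: (mulfI p0); rewrite e h1E; ring.
Qed.

(** Each prime factor of [c] divides [g] or [h], and can be removed from it. *)
Lemma pseudo_divisor (c : R) f g h : factorial_ring R -> c != 0 -> c%:P * f = h * g ->
  exists2 g', divides g' f & size g' = size g.
Proof.
move=> facR /facR[u [ps [uu psP ->]]].
elim: ps g h psP => [|p ps IH] g h psP.
  rewrite big_nil mulr1 => e; exists g => //; exists ((u^-1)%:P * h).
  by rewrite -mulrA -e mulrA -polyCM mulVr // mul1r.
rewrite big_cons mulrCA polyCM -mulrA => e.
have prp := prime_polyC (psP p (mem_head _ _)); have [p0 _ pM] := prp.
have psP' q : q \in ps -> prime_element q by move=> qps; apply: psP; rewrite inE qps orbT.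
have [|[h1 h1E]|[g1 g1E]] := pM h g.
- by exists ((u * \prod_(j <- ps) j)%:P * f); rewrite -e mulrC.
- by apply: (IH g h1) => //; apply: (mulfI p0); rewrite e h1E; ring.
have [|g' g'f sg'] := IH g1 h psP'; first by apply: (mulfI p0); rewrite e g1E; ring.
exists g' => //; rewrite sg' g1E mulrC size_Cmul //.
by rewrite -polyC_eq0.
Qed.

Lemma dividesT (A : comNzRingType) (a b c : A) : divides a b -> divides b c -> divides a c.
Proof. by move=> [x ->] [y ->]; exists (y * x); rewrite mulrA. Qed.

(** Gauss: if no prime of [R] divides [f], a divisor of [f] of least positive
    degree is prime. *)
Lemma poly_prime_divisor f : factorial_ring R -> f != 0 -> f \isn't a GRing.unit ->
  exists2 q, prime_element q & divides q f.
Proof.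
move=> facR f0 fu; apply: contrapT => noq.
have prf : primitive f.
  by move=> p pp pf; apply: noq; exists p%:P => //; apply: prime_polyC.
have sf : (1 < size f)%N.
  rewrite ltnNge; apply/negP => /size1_polyC fE.
  have c0 : f`_0 != 0 by apply: contraNneq f0 => c0; rewrite fE c0.
  have [u [[|p ps] [uu psP e]]] := facR _ c0.
    case/negP: fu; rewrite fE poly_unitE size_polyC c0 coefC eqxx e big_nil mulr1.
    by rewrite uu.
  apply: (prf p); first by apply: psP; rewrite mem_head.
  exists (u * \prod_(j <- ps) j)%:P; rewrite fE e big_cons -polyCM.
  by congr (_%:P); ring.
have exd : exists m, `[< exists g, [/\ divides g f, (1 < size g)%N & size g = m] >].
  by exists (size f); apply/asboolP; exists f; split=> //; exists 1; rewrite mul1r.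
(* A divisor [g] of least positive degree: over the fraction field it is
   irreducible, and being primitive it is prime over [R]. *)
case: (ex_minnP exd) => m /asboolP[g [gf sg gm]] minm; rewrite -{}gm in minm.
apply: noq; exists g => //; have g0 : g != 0 by rewrite -size_poly_gt0 ltnW.
have prg : primitive g.
  by move=> p pp pg; apply: (prf p pp); apply: dividesT pg gf.
split=> //; first by rewrite poly_unitE gtn_eqF.
move=> u v [w uvE].
have descend x : (g %| x)%R -> divides g x.
  case/Pdiv.WeakIdomain.dvdpP => -[c h] /= c0 e.
  by apply: (primitive_cancel (c := c) (h := h)) => //; rewrite mul_polyC.
have guv : (g %| u * v)%R by rewrite uvE dvdp_mulIr.
have [cop|ncop] := boolP (coprimep g u).
  by right; apply: descend; rewrite -(Gauss_dvdpr _ cop).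
left; apply: descend; set h := gcdp g u.
have /Pdiv.WeakIdomain.dvdpP[[c h2] /= c0 e] : (h %| g)%R by apply: dvdp_gcdl.
have [|h' h'g sh'] := @pseudo_divisor c g h h2 facR c0; first by rewrite mul_polyC.
have h0 : h != 0 by rewrite gcdp_eq0 negb_and g0.
have sh : (size g <= size h)%N.
  rewrite -sh'; apply: minm; apply/asboolP; exists h'; split=> //.
    exact: dividesT h'g gf.
  rewrite sh' ltn_neqAle eq_sym size_poly_gt0 h0 andbT.
  by rewrite -coprimep_def.
have : (h %= g)%R.
  by rewrite -dvdp_size_eqp ?dvdp_gcdl // eqn_leq sh andbT dvdp_leq ?dvdp_gcdl.
by move=> /eqp_dvdl <-; apply: dvdp_gcdr.
Qed.

End Factorial.

Lemma prime_element_iso (A B : idomainType) (f : {rmorphism A -> B}) (g : {rmorphism B -> A}) p :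
  cancel f g -> cancel g f -> prime_element p -> prime_element (g p).
Proof.
move=> fK gK [p0 pu pM]; split.
- by apply: contraNneq p0 => gp0; rewrite -(gK p) gp0 rmorph0.
- by apply: contraNN pu => gpu; rewrite -(gK p) rmorph_unit.
have fdiv a : divides (g p) a -> divides p (f a).
  by case=> c ->; exists (f c); rewrite rmorphM gK.
have gdiv a : divides p (f a) -> divides (g p) a.
  by case=> c e; exists (g c); rewrite -rmorphM -e fK.
by move=> a b /fdiv; rewrite rmorphM => /pM[]/gdiv; [left|right].
Qed.

Section MpolyFactorial.
Variable k : fieldType.

Lemma mpoly_of_polyK n : cancel (@mpoly_of_poly k n) (@muni n k).
Proof.
have CK (c : {mpoly k[n]}) : muni (mwiden c) = c%:P.
  move: c; apply: (mpoly_rmorph_eq (f := @muni n k \o @mwiden n k) (g := @polyC _)) => [c|i] /=.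
    by rewrite mwidenC muniC.
  by rewrite mwidenX mnmwiden1 muni_widen.
elim/poly_ind => [|p c IH]; first by rewrite !rmorph0.
have XK : muni (mpoly_of_poly k n 'X) = 'X.
  by rewrite /= map_polyX /horner_eval hornerX muni_max.
have CK' : muni (mpoly_of_poly k n c%:P) = c%:P.
  by rewrite /= map_polyC /horner_eval hornerC CK.
by rewrite rmorphD rmorphM muniD muniM IH XK CK'.
Qed.

Lemma mpoly_unitE n (a : {mpoly k[n]}) : (a \is a GRing.unit) = (msize a == 1%N).
Proof.
apply/idP/msize_poly1P => [/andP[/eqP aE c]|[c c0 ->]].
  by exists a@_0%MM; rewrite -?unitfE.
by apply: (rmorph_unit (@mpolyC n k)); rewrite unitfE.
Qed.

Lemma mpoly_factorial n : factorial_ring {mpoly k[n]}.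
Proof.
have step m : (forall a : {mpoly k[m]}, a != 0 -> a \isn't a GRing.unit ->
    exists2 p, prime_element p & divides p a) -> factorial_ring {mpoly k[m]}.
  move=> hasp a a0; have [N] := ubnP (msize a).
  elim: N a a0 => // N IH a a0; rewrite ltnS => aN.
  have [ua|nua] := boolP (a \is a GRing.unit).
    by exists a, [::]; rewrite big_nil mulr1.
  have [p pp [c aE]] := hasp a a0 nua; have [p0 pu _] := pp.
  have c0 : c != 0 by apply: contraNneq a0 => c0; rewrite aE c0 mul0r.
  have [|u [ps [uu psP cE]]] := IH c c0.
    have sp : (1 < msize p)%N.
      by rewrite ltn_neqAle eq_sym -mpoly_unitE pu lt0n msize_poly_eq0.
    move: aN sp; rewrite aE msizeM //.
    by move: (msize c) (msize p) => x y; lia.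
  exists u, (p :: ps); rewrite big_cons aE cE; split=> //.
    by move=> q; rewrite inE => /predU1P[->|/psP].
  by ring.
elim: n => [|n IH].
  apply: step => a a0 /negP[]; rewrite (nvar0_mpolyC a).
  apply: (rmorph_unit (@mpolyC 0 k)); rewrite unitfE.
  by apply: contraNneq a0 => c0; rewrite (nvar0_mpolyC a) c0.
apply: step => a a0 nua.
have [||q qp [c e]] := @poly_prime_divisor _ (muni a) IH.
- by rewrite muni_eq0.
- by apply: contraNN nua => ua; rewrite -(muniK a) rmorph_unit.
exists (mpoly_of_poly k n q); first exact: (prime_element_iso (@muniK k n) (@mpoly_of_polyK n)).
by exists (mpoly_of_poly k n c); rewrite -rmorphM -e muniK.
Qed.

Lemma mpoly_prime_divisor n (a : {mpoly k[n]}) : a != 0 -> msize a != 1%N ->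
  exists2 p, prime_element p & divides p a.
Proof.
rewrite -mpoly_unitE => a0 nua; have [u [[|p ps] [uu psP aE]]] := mpoly_factorial a0.
  by case/negP: nua; rewrite aE big_nil mulr1.
exists p; first by apply: psP; rewrite mem_head.
by exists (u * \prod_(j <- ps) j); rewrite aE big_cons; ring.
Qed.

End MpolyFactorial.

(** * The relation module of [S/P] over the ring of the linear forms *)

Lemma mpoly_ring_ind (R : comNzRingType) n (Q : {mpoly R[n]} -> Prop) :
  (forall c, Q c%:MP) -> (forall i, Q 'X_i) ->
  (forall p q, Q p -> Q q -> Q (p + q)) -> (forall p q, Q p -> Q q -> Q (p * q)) ->
  forall p, Q p.
Proof.
move=> QC QX QD QM p; rewrite [p]mpolyE.
apply: big_ind => [||m _]; [by rewrite -mpolyC0; apply: QC | exact: QD |].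
rewrite -mul_mpolyC; apply: (QM) => //; rewrite mpolyXE_id.
apply: big_ind => [||i _]; [by rewrite -mpolyC1; apply: QC | exact: (QM) |].
by elim: (m i) => [|e IH]; rewrite ?expr0 -?mpolyC1 // exprS; apply: QM.
Qed.

Lemma ltn_pred_addl x y : (1 < x)%N -> (0 < y)%N -> (y < (x + y).-1)%N.
Proof. by lia. Qed.

Section Relations.
Variables (k : fieldType) (n s : nat).
Local Notation S := {mpoly k[n]}.
Local Notation T := {mpoly k[s.+1]}.
Local Notation G := {mpoly T[n]}.
Local Notation hcomp := (pihomog mdeg).
Variables (L : 'I_s.+1 -> S) (P : S -> Prop).
Hypotheses (L1 : forall a, L a \is 1.-homog) (idP : ideal P) (grP : graded P).
Hypothesis primeP : forall a b, P (a * b) -> P a \/ P b.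

Definition gen_ideal i (f : S) :=
  exists q : 'I_s.+1 -> S, P (f - \sum_(a < s.+1 | (a < i)%N) q a * L a).

Lemma ideal_gen i : ideal (gen_ideal i).
Proof.
split; first by exists (fun=> 0); rewrite big1 ?subr0 => [|a _]; [exact: ideal0 | rewrite mul0r].
  move=> f g [q Pf] [r Pg]; exists (fun a => q a + r a).
  under eq_bigr do rewrite mulrDl; rewrite big_split opprD addrACA; exact: idealD.
move=> a f [q Pf]; exists (fun b => a * q b).
under eq_bigr do rewrite -mulrA; rewrite -mulr_sumr -mulrBr; exact: ideal_mull.
Qed.

Lemma gen_ideal_homog i j f : f \is j.-homog -> gen_ideal i f ->
  exists q : 'I_s.+1 -> S, P (f - \sum_(a < s.+1 | (a < i)%N) q a * L a) /\
    forall a, if j is j'.+1 then q a \is j'.-homog else q a = 0.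
Proof.
move=> fj [q /grP/(_ j)]; rewrite hcompB hcomp_sum pihomog_dE // => Pf.
exists (fun a => if j is j'.+1 then hcomp j' (q a) else 0); split; last first.
  by case: j {fj Pf} => // j a; apply: pihomogP.
rewrite (eq_bigr (fun a => hcomp j (q a * L a))) // => a _; rewrite (hcompM _ _ (L1 a)).
by case: j {fj Pf} => [|j] /=; rewrite ?mul0r // subn1.
Qed.

Lemma graded_gen i : graded (gen_ideal i).
Proof.
move=> f [q /grP Pf] j; have := Pf j; rewrite hcompB hcomp_sum => {}Pf.
exists (fun a => if (0 < j)%N then hcomp (j - 1) (q a) else 0).
rewrite (eq_bigr (fun a => hcomp j (q a * L a))) // => a _.
by rewrite (hcompM _ _ (L1 a)); case: ifP; rewrite ?mul0r.
Qed.

Local Notation I := (gen_ideal s.+1).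

Definition evT : {rmorphism T -> S} := comp_mpoly [tuple L a | a < s.+1].

Lemma evTX a : evT 'X_a = L a.
Proof. by rewrite /= comp_mpolyXU -tnth_nth tnth_mktuple. Qed.

Lemma evTC c : evT c%:MP = c%:MP.
Proof. exact: comp_mpolyC. Qed.

(** [S/P] is presented over [T = k[y_0, .., y_s]], where [y_a] acts as [L_a],
    by the free module on the standard monomials of [I = P + (L)], the
    submodule [reduced] of [T[x_1, .., x_n]]. *)
Definition ev : {rmorphism G -> S} := mmap evT (fun i => 'X_i).

Lemma evC c : ev c%:MP = evT c.
Proof. exact: mmapC. Qed.

Lemma evX m : ev 'X_[m] = 'X_[m].
Proof. by rewrite /= mmapX /mmap1 [RHS]mpolyXE_id. Qed.

Definition reduced (g : G) := forall m, leading I m -> g@_m = 0.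

Definition bihomog j (g : G) := forall m,
  if (mdeg m <= j)%N then g@_m \is (j - mdeg m).-homog : Prop else g@_m = 0.

Lemma reducedD g h : reduced g -> reduced h -> reduced (g + h).
Proof. by move=> rg rh m lm; rewrite mcoeffD rg ?rh ?addr0. Qed.

Lemma reducedB g h : reduced g -> reduced h -> reduced (g - h).
Proof. by move=> rg rh m lm; rewrite mcoeffB rg ?rh ?subrr. Qed.

Lemma reducedM c g : reduced g -> reduced (c%:MP * g).
Proof. by move=> rg m lm; rewrite mcoeffCM rg ?mulr0. Qed.

Lemma reduced_sum (J : Type) (r : seq J) (p : pred J) (F : J -> G) :
  (forall j, p j -> reduced (F j)) -> reduced (\sum_(j <- r | p j) F j).
Proof.
by move=> rF; apply: big_ind => //; [move=> m _; rewrite mcoeff0 | exact: reducedD].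
Qed.

Lemma bihomogD j g h : bihomog j g -> bihomog j h -> bihomog j (g + h).
Proof.
move=> jg jh m; have := jg m; have := jh m; rewrite mcoeffD.
by case: ifP => _ => [h1 g1|-> ->]; [rewrite rpredD | rewrite addr0].
Qed.

Lemma bihomogN j g : bihomog j g -> bihomog j (- g).
Proof.
move=> jg m; have := jg m; rewrite mcoeffN.
by case: ifP => _ => [g1|->]; [rewrite rpredN | rewrite oppr0].
Qed.

Lemma bihomog_sum j (J : Type) (r : seq J) (p : pred J) (F : J -> G) :
  (forall i, p i -> bihomog j (F i)) -> bihomog j (\sum_(i <- r | p i) F i).
Proof.
move=> jF; apply: big_ind => //; last exact: bihomogD.
by move=> m; rewrite mcoeff0; case: ifP => // _; apply: rpred0.
Qed.

Lemma bihomogM i j c g : c \is i.-homog -> bihomog j g -> bihomog (i + j) (c%:MP * g).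
Proof.
move=> ci jg m; have := jg m; rewrite mcoeffCM; case: (leqP (mdeg m) j) => mj.
  rewrite (leq_trans mj (leq_addl _ _)) => gm.
  by rewrite -addnBA //; apply: dhomogM.
by move=> ->; rewrite mulr0; case: ifP => // _; apply: rpred0.
Qed.

Lemma bihomogX m : bihomog (mdeg m) 'X_[m].
Proof.
move=> m'; rewrite mcoeffX; have [->|_] := eqVneq m m'.
  by rewrite leqnn subnn dhomog1.
by case: ifP => // _; apply: rpred0.
Qed.

Lemma T_homogX a : ('X_a : T) \is 1.-homog.
Proof. by rewrite dhomogX /= mdeg1. Qed.

Definition gmono j (t : {m in stdset I j}) : G := 'X_[val (val t)].

Lemma ev_gmono j (t : {m in stdset I j}) : ev (gmono t) = mono t.
Proof. exact: evX. Qed.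

Lemma reduced_gmono j (t : {m in stdset I j}) : reduced (gmono t).
Proof.
move=> m lm; rewrite mcoeffX; case: eqP => // e.
by have /andP[_ /stdP] := valP t; rewrite e.
Qed.

Lemma bihomog_gmono j (t : {m in stdset I j}) : bihomog j (gmono t).
Proof. by have /andP[/eqP e _] := valP t; have := bihomogX (val (val t)); rewrite e. Qed.

Lemma T_homogC c : (c%:MP : T) \is 0.-homog.
Proof.
apply/dhomogP => m; rewrite msuppC; case: eqP => // _; rewrite inE => /eqP ->.
exact: mdeg0.
Qed.

(** Graded Nakayama: the standard monomials of [I] generate [S/P] over [T]. *)
Lemma reduced_lift j f : f \is j.-homog ->
  exists g, [/\ reduced g, bihomog j g & P (f - ev g)].
Proof.
elim/ltn_ind: j f => j IH f fj.
have [a Ia] := hf_span (ideal_gen s.+1) (@graded_gen s.+1) fj.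
set r := \sum_t _ in Ia.
have rj : r \is j.-homog.
  by apply: rpred_sum => t _; rewrite mul_mpolyC; apply/rpredZ/mono_homog.
have [q [Pq qj]] := gen_ideal_homog (rpredB fj rj) Ia.
have /choice[g gP] : forall b, exists g, [/\ reduced g, bihomog j (('X_b)%:MP * g) &
    P (q b - ev g)].
  move=> b; have := qj b; case: j IH {fj a r Ia rj Pq qj} => [|j] IH qb.
    exists 0; rewrite mulr0 rmorph0 qb subrr; split; last exact: ideal0.
      by move=> m _; rewrite mcoeff0.
    by move=> m; rewrite mcoeff0; case: ifP => // _; apply: rpred0.
  have [g [rg jg Pg]] := IH j (ltnSn j) _ qb; exists g; split=> //.
  by rewrite -add1n; apply: bihomogM => //; apply: T_homogX.
exists (\sum_t ((a t)%:MP)%:MP * gmono t + \sum_b ('X_b)%:MP * g b); split.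
- apply: reducedD; apply: reduced_sum => t _; apply: reducedM.
    exact: reduced_gmono.
  by have [] := gP t.
- apply: bihomogD; apply: bihomog_sum => t _; last by have [] := gP t.
  by have := bihomogM (T_homogC (a t)) (bihomog_gmono t); rewrite add0n.
have e1 : ev (\sum_t ((a t)%:MP)%:MP * gmono t) = r.
  by rewrite rmorph_sum; apply: eq_bigr => t _; rewrite rmorphM evC evTC ev_gmono.
have e2 : ev (\sum_b ('X_b)%:MP * g b) = \sum_b L b * ev (g b).
  by rewrite rmorph_sum; apply: eq_bigr => b _; rewrite rmorphM evC evTX.
rewrite rmorphD e1 e2.
apply: (ideal_congr (g := f - r - \sum_(b < s.+1) q b * L b) idP); last first.
  by rewrite (eq_bigl (fun b : 'I_s.+1 => (b < s.+1)%N)) // => b; rewrite ltn_ord.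
rewrite (_ : _ - _ = \sum_b L b * (q b - ev (g b))); last first.
  under [RHS]eq_bigr do rewrite mulrBr [L _ * q _]mulrC.
  by rewrite sumrB; ring.
by apply: (ideal_sum idP) => b _; apply: (ideal_mull idP); have [_ _] := gP b.
Qed.

(** Reduction modulo [(y_0, .., y_(i-1))]. *)
Definition kill i : {rmorphism T -> T} :=
  comp_mpoly [tuple if (a < i)%N then 0 else 'X_a | a < s.+1].

Lemma killX i a : kill i 'X_a = if (a < i)%N then 0 else 'X_a.
Proof. by rewrite /= comp_mpolyXU -tnth_nth tnth_mktuple. Qed.

Lemma kill_mod i c : exists q : 'I_s.+1 -> T,
  c - kill i c = \sum_(a < s.+1 | (a < i)%N) q a * 'X_a.
Proof.
elim/mpoly_ring_ind: c => [c|a|p p' [q e] [q' e']|p p' [q e] [q' e']].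
- exists (fun=> 0); rewrite /= comp_mpolyC subrr big1 // => a _; exact: mul0r.
- rewrite killX; case: ifPn => ai.
    exists (fun b => (b == a)%:R); rewrite subr0 (bigD1 a) //= eqxx mul1r big1 ?addr0 //.
    by move=> b /andP[_ /negPf ->]; rewrite mul0r.
  by exists (fun=> 0); rewrite subrr big1 // => b _; exact: mul0r.
- exists (fun a => q a + q' a); under eq_bigr do rewrite mulrDl.
  by rewrite big_split /= -e -e' rmorphD; ring.
exists (fun a => q a * p' + kill i p * q' a).
transitivity ((p - kill i p) * p' + kill i p * (p' - kill i p')).
  by rewrite rmorphM; ring.
rewrite e e' mulr_suml mulr_sumr -big_split; apply: eq_bigr => a _ /=.
by move: (_ \mPo _) => x; ring.
Qed.

Lemma kill_eq0_leq i j c : (i <= j)%N -> kill i c = 0 -> kill j c = 0.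
Proof.
move=> ij c0; have [q] := kill_mod i c; rewrite c0 subr0 => ->.
rewrite rmorph_sum big1 // => a ai; rewrite rmorphM killX.
by rewrite (leq_trans ai ij) mulr0.
Qed.

Definition killG i : {rmorphism G -> G} := map_mpoly (kill i).

Lemma killG_coef i g m : (killG i g)@_m = kill i g@_m.
Proof. exact: mcoeff_map_mpoly. Qed.

Lemma killGC i c : killG i c%:MP = (kill i c)%:MP.
Proof. exact: map_mpolyC. Qed.

Lemma killG_eq0_leq i j g : (i <= j)%N -> killG i g = 0 -> killG j g = 0.
Proof.
move=> ij g0; apply/mpolyP => m; rewrite killG_coef mcoeff0.
by apply: (kill_eq0_leq ij); rewrite -killG_coef g0 mcoeff0.
Qed.

Lemma killG_eq0 i g : killG i g = 0 ->
  exists h : 'I_s.+1 -> G, g = \sum_(a < s.+1 | (a < i)%N) ('X_a)%:MP * h a.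
Proof.
move=> g0; have /choice[q qP] : forall m, exists q : 'I_s.+1 -> T,
    g@_m = \sum_(a < s.+1 | (a < i)%N) q a * 'X_a.
  move=> m; have [q e] := kill_mod i g@_m; exists q.
  by rewrite -e -killG_coef g0 mcoeff0 subr0.
exists (fun a => \sum_(m <- msupp g) (q m a)%:MP * 'X_[m]).
rewrite {1}[g]mpolyE; under [RHS]eq_bigr do rewrite mulr_sumr.
rewrite exchange_big; apply: eq_bigr => m _ /=; rewrite -mul_mpolyC {1}qP rmorph_sum mulr_suml.
by apply: eq_bigr => a _; rewrite rmorphM /=; ring.
Qed.

Lemma killG_sum0 i (h : 'I_s.+1 -> G) :
  killG i (\sum_(a < s.+1 | (a < i)%N) ('X_a)%:MP * h a) = 0.
Proof.
rewrite rmorph_sum big1 // => a ai.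
by rewrite rmorphM killGC killX ai mpolyC0 mul0r.
Qed.

Lemma killG_mulX (a : 'I_s.+1) g : killG a (('X_a)%:MP * g) = 0 -> killG a g = 0.
Proof.
move=> kw; apply/mpolyP => m; rewrite killG_coef mcoeff0; have := congr1 (mcoeff m) kw.
rewrite killG_coef mcoeff0 mcoeffCM rmorphM killX ltnn => /eqP.
rewrite mulf_eq0 => /orP[/eqP X0|/eqP //].
have := congr1 (mcoeff U_(a)%MM) X0; rewrite mcoeffXU eqxx mcoeff0 => /eqP.
by rewrite oner_eq0.
Qed.

Lemma gen_of_kill i f g : killG i g = 0 -> P (f - ev g) -> gen_ideal i f.
Proof.
case/killG_eq0=> h -> Pf; exists (fun a => ev (h a)); move: Pf.
rewrite rmorph_sum; congr (P (_ - _)); apply: eq_bigr => a _.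
by rewrite rmorphM evC evTX mulrC.
Qed.

Definition relation (g : G) := reduced g /\ P (ev g).

(** Lifting both sides of [L_a f = sum_(b < i) q_b L_b] to the free module. *)
Lemma relation_of_zerodivisor (a : 'I_s.+1) i j f : f \is j.-homog -> gen_ideal i (L a * f) ->
  exists g (h : 'I_s.+1 -> G), let z := ('X_a)%:MP * g - \sum_(b < s.+1 | (b < i)%N) ('X_b)%:MP * h b in
   [/\ P (f - ev g), relation z & bihomog j.+1 z].
Proof.
move=> fj Pf; have af : L a * f \is (j.+1).-homog by rewrite -add1n; apply: dhomogM.
have [q [Pq qj]] := gen_ideal_homog af Pf.
have [g [rg jg Pg]] := reduced_lift fj.
have /choice[h hP] := fun b => reduced_lift (qj b).
exists g, h => z; have homX b g' : bihomog j g' -> bihomog j.+1 (('X_b)%:MP * g').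
  by rewrite -add1n; apply: bihomogM; apply: T_homogX.
split=> //; last first.
  apply: bihomogD; first exact: homX.
  by apply/bihomogN/bihomog_sum => b _; apply: homX; have [] := hP b.
split.
  apply: reducedB; first exact: reducedM.
  by apply: reduced_sum => b _; apply: reducedM; have [] := hP b.
have -> : ev z = (L a * f - \sum_(b < s.+1 | (b < i)%N) q b * L b) - L a * (f - ev g) +
    \sum_(b < s.+1 | (b < i)%N) L b * (q b - ev (h b)).
  have e1 : ev (\sum_(b < s.+1 | (b < i)%N) ('X_b)%:MP * h b) =
      \sum_(b < s.+1 | (b < i)%N) L b * ev (h b).
    by rewrite rmorph_sum; apply: eq_bigr => b _; rewrite rmorphM evC evTX.
  rewrite rmorphB rmorphM evC evTX e1 (eq_bigr _ (fun b _ => mulrBr (L b) _ _)) sumrB.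
  rewrite (eq_bigr _ (fun b _ => mulrC (q b) (L b))).
  by move: (\sum_(_ < _ | _) L _ * q _) (\sum_(_ < _ | _) L _ * ev _) => x y; ring.
apply: (idealD idP); first by apply: (idealB idP) => //; apply: (ideal_mull idP).
by apply: (ideal_sum idP) => b _; apply: (ideal_mull idP); have [_ _] := hP b.
Qed.

Section Principal.
Hypothesis evT_inj : forall c, P (evT c) -> c = 0.

Definition proportional (g h : G) := forall m m', g@_m * h@_m' = g@_m' * h@_m.

Hypothesis relations_proportional : forall i j g h,
  relation g -> bihomog i g -> relation h -> bihomog j h -> proportional g h.

Lemma divides_coefs c (g : G) : (forall m, divides c g@_m) ->
  exists h, g = c%:MP * h.
Proof.
move=> /choice[q qP]; exists (\sum_(m <- msupp g) (q m)%:MP * 'X_[m]).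
rewrite {1}[g]mpolyE mulr_sumr; apply: eq_bigr => m _.
by rewrite -mul_mpolyC {1}qP rmorphM /=; ring.
Qed.

(** The relations form a torsion-free module of rank one with torsion-free
    quotient [S/P]: dividing out the primes of [T] that divide a relation leads
    to one of which all the others are multiples. *)
Lemma principal_relations j z0 : relation z0 -> bihomog j z0 -> z0 != 0 ->
  exists zeta, relation zeta /\
    forall i z, relation z -> bihomog i z -> exists c, z = c%:MP * zeta.
Proof.
move=> rz0 jz0 z0n0.
(* Among the nonzero relations proportional to all others, one whose leading
   coefficient has least degree is divisible by no prime of [T]. *)
pose cand zeta := [/\ relation zeta, zeta != 0 &
  forall i z, relation z -> bihomog i z -> proportional zeta z].
have exN : exists N, `[< exists2 zeta, cand zeta & msize (mleadc zeta) = N >].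
  exists (msize (mleadc z0)); apply/asboolP; exists z0; last by [].
  split; [exact: rz0 | exact: z0n0 | move=> i z rz iz].
  exact: (relations_proportional rz0 jz0 rz iz).
case: (ex_minnP exN) => N /asboolP[zeta [rzeta n0 propz] sz] minN.
exists zeta; split=> // i z rz iz; have pz := propz i z rz iz.
have lc0 : mleadc zeta != 0 by rewrite mleadc_eq0.
(* From [a z = b zeta], remove the prime factors of [a]: each divides [b]. *)
suff main M : forall a b : T, (msize a < M)%N -> a != 0 -> a%:MP * z = b%:MP * zeta ->
    exists c, z = c%:MP * zeta.
  apply: (main _ (mleadc zeta) z@_(mlead zeta) (ltnSn _)) => //.
  by apply/mpolyP => m; rewrite !mcoeffCM pz mulrC.
elim: M => // M IH a b; rewrite ltnS => aM a0 e.
have [/eqP/msize_poly1P[c c0 ac]|sa] := eqVneq (msize a) 1%N.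
  exists ((c^-1)%:MP * b); rewrite rmorphM -mulrA -e ac mulrA -rmorphM -mpolyCM.
  by rewrite mulVf // !mpolyC1 mul1r.
have [p pp [a1 aE]] := mpoly_prime_divisor a0 sa; have [p0 pu pM] := pp.
have a10 : a1 != 0 by apply: contraNneq a0 => a10; rewrite aE a10 mul0r.
have sp : (1 < msize p)%N.
  by rewrite ltn_neqAle eq_sym -mpoly_unitE pu lt0n msize_poly_eq0.
have pC0 : p%:MP != 0 :> G by rewrite mpolyC_eq0.
have [[b1 bE]|npb] := pselect (divides p b).
  apply: (IH a1 b1) => //; last first.
    apply/mpolyP => m; apply: (mulfI p0); have := congr1 (mcoeff m) e.
    by rewrite !mcoeffCM !mulrA ![p * _]mulrC -aE -bE.
  apply: leq_trans aM; rewrite aE msizeM // addnC.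
  by apply: ltn_pred_addl; rewrite // lt0n msize_poly_eq0.
have [zeta1 zE] : exists h, zeta = p%:MP * h.
  apply: divides_coefs => m; have [|//|//] := pM b zeta@_m.
  exists (a1 * z@_m); have := congr1 (mcoeff m) e; rewrite !mcoeffCM => <-.
  by rewrite aE mulrAC.
have z10 : zeta1 != 0 by apply: contraNneq n0 => z10; rewrite zE z10 mulr0.
have lE : mleadc zeta = p * mleadc zeta1.
  by rewrite zE mul_mpolyC mleadZ // mcoeffZ.
have lc10 : mleadc zeta1 != 0 by rewrite mleadc_eq0.
suff /minN : `[< exists2 zeta', cand zeta' & msize (mleadc zeta') = msize (mleadc zeta1) >].
  rewrite -sz lE msizeM // leqNgt => /negP[].
  by apply: ltn_pred_addl; rewrite // lt0n msize_poly_eq0.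
apply/asboolP; exists zeta1; last by [].
split; [|exact: z10|].
  split=> [m lm|].
    have := rzeta.1 m lm; rewrite zE mcoeffCM => /eqP.
    by rewrite mulf_eq0 (negPf p0) => /eqP.
  have Pz : P (evT p * ev zeta1) by rewrite -evC -rmorphM -zE; apply: rzeta.2.
  by case: (primeP Pz) => // /evT_inj p0'; rewrite p0' eqxx in p0.
move=> i' z' rz' iz' m m'; have := propz i' z' rz' iz' m m'.
by rewrite zE !mcoeffCM -!mulrA => /(mulfI p0).
Qed.

(** The relation [z = y_a g - sum_(b < a) y_b h_b] given by a zero-divisor is
    [c zeta].  Modulo [(y_0, .., y_a)] it vanishes and [zeta] does not, so [c]
    is in that ideal; subtracting a multiple of [zeta] from [g] then makes
    [y_a g], hence [g], vanish modulo [(y_0, .., y_(a-1))]. *)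
Lemma regular_of_principal zeta (a : 'I_s.+1) j f :
    (forall i z, relation z -> bihomog i z -> exists c, z = c%:MP * zeta) ->
    P (ev zeta) -> killG s zeta != 0 -> (a < s)%N ->
    f \is j.-homog -> gen_ideal a (L a * f) ->
  gen_ideal a f.
Proof.
move=> princ Pz kz as_ fj /(relation_of_zerodivisor fj)[g [h [Pg rz jz]]].
have [c e] := princ _ _ rz jz.
have [m0 kz'] : exists m, kill a.+1 zeta@_m != 0.
  apply: contrapT => /forallNP no; case/eqP: kz; apply: (killG_eq0_leq as_).
  by apply/mpolyP => m; rewrite killG_coef mcoeff0; apply/eqP/negPn/negP/no.
have [q cE] : exists q : 'I_s.+1 -> T, c = \sum_(b < s.+1 | (b < a.+1)%N) q b * 'X_b.
  have [q cE] := kill_mod a.+1 c; exists q.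
  suff c0 : kill a.+1 c = 0 by rewrite -cE c0 subr0.
  have : killG a.+1 (c%:MP * zeta) = 0.
    rewrite -e rmorphB rmorphM killGC killX ltnSn mpolyC0 mul0r sub0r.
    by rewrite (killG_eq0_leq (leqnSn a) (killG_sum0 _ _)) oppr0.
  move/(congr1 (mcoeff m0)); rewrite killG_coef mcoeffCM mcoeff0 rmorphM => /eqP.
  by rewrite mulf_eq0 (negPf kz') orbF => /eqP.
have sumS (F : 'I_s.+1 -> G) : \sum_(b < s.+1 | (b < a.+1)%N) F b =
    F a + \sum_(b < s.+1 | (b < a)%N) F b.
  rewrite (bigD1 a) //=; congr (_ + _); apply: eq_bigl => b.
  by rewrite ltnS leq_eqVlt -(inj_eq val_inj); case: ltngtP.
have e2 : c%:MP * zeta = ('X_a)%:MP * ((q a)%:MP * zeta) +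
    \sum_(b < s.+1 | (b < a)%N) ('X_b)%:MP * ((q b)%:MP * zeta).
  have qX b : (q b * 'X_b)%:MP * zeta = ('X_b)%:MP * ((q b)%:MP * zeta).
    by rewrite mulrA -mpolyCM; congr (_%:MP * _); apply: mulrC.
  rewrite cE rmorph_sum mulr_suml sumS; congr (_ + _); first exact: qX.
  by apply: eq_bigr => b _; apply: qX.
have : ('X_a)%:MP * (g - (q a)%:MP * zeta) =
    \sum_(b < s.+1 | (b < a)%N) ('X_b)%:MP * (h b + (q b)%:MP * zeta).
  rewrite (eq_bigr _ (fun b _ => mulrDr ('X_b)%:MP (h b) _)) big_split /= mulrBr.
  move/eqP: e; rewrite subr_eq e2 => /eqP ->.
  by rewrite -addrA addrAC addrCA subrr addr0.
move/(congr1 (killG a)); rewrite killG_sum0 => kw.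
have k0 : killG a (g - (q a)%:MP * zeta) = 0 by apply: killG_mulX.
apply: (gen_of_kill k0); rewrite rmorphB rmorphM opprB addrCA.
by rewrite addrC; apply: idealD => //; apply: ideal_mull.
Qed.

End Principal.
End Relations.

(** * Counting relations *)

(** Partial sums: on Hilbert series, division by [1 - t]. *)
Definition cumulate (F : nat -> nat) j := (\sum_(i < j.+1) F i)%N.

Lemma cumulateD F F' j : cumulate (fun i => F i + F' i)%N j = (cumulate F j + cumulate F' j)%N.
Proof. exact: big_split. Qed.

Lemma eq_cumulate F F' : F =1 F' -> cumulate F =1 cumulate F'.
Proof. by move=> e j; apply: eq_bigr => i _; apply: e. Qed.

Lemma leq_cumulate F F' : (forall j, F j <= F' j)%N -> forall j, (cumulate F j <= cumulate F' j)%N.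
Proof. by move=> le j; apply: leq_sum => i _; apply: le. Qed.

Lemma eq_iter_cumulate r F F' : F =1 F' -> iter r cumulate F =1 iter r cumulate F'.
Proof. by move=> e; elim: r => //= r IH; apply: eq_cumulate. Qed.

Lemma leq_iter_cumulate r F F' : (forall j, F j <= F' j)%N ->
  forall j, (iter r cumulate F j <= iter r cumulate F' j)%N.
Proof. by move=> le; elim: r => //= r IH; apply: leq_cumulate. Qed.

Lemma iter_cumulateD r F F' j :
  iter r cumulate (fun i => F i + F' i)%N j = (iter r cumulate F j + iter r cumulate F' j)%N.
Proof.
elim: r j => //= r IH j; rewrite -cumulateD; exact: eq_cumulate.
Qed.

Lemma iter_cumulate_bounded r F K j : (forall i, F i <= K)%N ->
  (iter r cumulate F j <= K * j.+1 ^ r)%N.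
Proof.
move=> FK; elim: r j => [|r IH] j /=; first by rewrite muln1.
apply: leq_trans (_ : \sum_(i < j.+1) K * j.+1 ^ r <= _)%N; last first.
  by rewrite sum_nat_const card_ord expnS mulnCA.
apply: leq_sum => i _; apply: leq_trans (IH _) _; rewrite leq_mul2l.
by case: r {IH} => [|r]; rewrite ?orbT // leq_exp2r // ltn_ord orbT.
Qed.

Lemma iter_cumulate_binomial r F j :
  iter r.+1 cumulate F j = (\sum_(i < j.+1) F i * 'C(j - i + r, r))%N.
Proof.
elim: r j => [|r IH] j.
  by apply: eq_bigr => i _; rewrite bin0 muln1.
rewrite -[LHS]/(cumulate (iter r.+1 cumulate F) j) (eq_cumulate IH) /cumulate.
elim: j => [|j IHj]; first by rewrite !big_ord1 subn0 !binn.
rewrite big_ord_recr IHj [in RHS]big_ord_recr [X in (_ + X)%N = _]big_ord_recr /=.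
rewrite !subnn !binn addnA -big_split; congr (_ + _)%N; apply: eq_bigr => i _ /=.
have ij : (i <= j)%N by rewrite -ltnS.
by rewrite subSn // [in RHS]addSn binS mulnDr addSnnS.
Qed.

Lemma iter_cumulate1 r j : iter r cumulate (fun=> 1%N) j = 'C(j + r, r).
Proof.
have e : (fun=> 1%N) =1 cumulate (fun i => i == 0%N).
  by move=> i; rewrite /cumulate big_ord_recl big1.
rewrite (eq_iter_cumulate r e) -iterSr iter_cumulate_binomial big_ord_recl mul1n subn0.
by rewrite big1 ?addn0.
Qed.

Lemma binomial_leq_expn r j : ('C(j + r, r) <= j.+1 ^ r)%N.
Proof. by rewrite -iter_cumulate1 -[leqRHS]mul1n iter_cumulate_bounded. Qed.

Lemma expn_leq_binomial r i : (i.+1 ^ r <= r`! * 'C(i + r, r))%N.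
Proof.
rewrite mulnC bin_ffact; elim: r => [|r IH]; first by rewrite ffactn0.
by rewrite addnS ffactSS expnS leq_mul // ltnS leq_addr.
Qed.

Lemma binomial_leq_shift r x e : ('C(x + e, r.+1) <= 'C(x, r.+1) + e * 'C(x + e, r))%N.
Proof.
elim: e => [|e IH]; first by rewrite addn0 leq_addr.
rewrite addnS binS mulSn addnCA addnC leq_add ?leq_bin2l //.
by apply: leq_trans IH _; rewrite leq_add2l leq_mul2l leq_bin2l ?orbT.
Qed.

(** ['C(j + s, s)] has exact growth [j ^ s], so a free module of rank one
    cannot contain, up to lower-dimensional terms, one of rank two. *)
Lemma binomial_not_doubled s E K :
  ~ (forall i, 2 * 'C(i + s, s) <= 'C(i + E + s, s) +
       (if s is r.+1 then K * (i + E).+1 ^ r else 0))%N.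
Proof.
case: s => [|r] le; first by have := le 0%N; rewrite !bin0.
(* The inequality at [D] bounds ['C(D + r.+1, r.+1)], of order [D ^ r.+1], by
   [(E + K) * ((D + 1) * (E + 2)) ^ r]; this [D] is large enough to make it fail. *)
pose D := (r.+1`! * ((E + K) * E.+2 ^ r))%N.
have := expn_leq_binomial r.+1 D; apply/negP; rewrite -ltnNge.
have h : ('C(D + r.+1, r.+1) <= (E + K) * (D.+1 * E.+2) ^ r)%N.
  have := le D; rewrite mul2n -addnn.
  have -> : (D + E + r.+1 = D + r.+1 + E)%N by lia.
  have := binomial_leq_shift r (D + r.+1) E.
  have -> : (D + r.+1 + E = (D + E).+1 + r)%N by lia.
  have := binomial_leq_expn r (D + E).+1.
  have m1 : ((D + E).+2 ^ r <= (D.+1 * E.+2) ^ r)%N.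
    by case: (r) => // r'; rewrite leq_exp2r //; nia.
  have m2 : ((D + E).+1 ^ r <= (D.+1 * E.+2) ^ r)%N.
    by case: (r) => // r'; rewrite leq_exp2r //; nia.
  move: m1 m2; rewrite mulnDl.
  move: ((D.+1 * E.+2) ^ r)%N ((D + E).+2 ^ r)%N ((D + E).+1 ^ r)%N => X Y Z.
  move: 'C((D + E).+1 + r, r) 'C((D + E).+1 + r, r.+1) 'C(D + r.+1, r.+1) => A B C.
  by nia.
apply: leq_ltn_trans (leq_mul (leqnn _) h) _; rewrite expnMn expnS.
have : (0 < D.+1 ^ r)%N by rewrite expn_gt0.
move: (D.+1 ^ r)%N => X X0.
have -> : (r.+1`! * ((E + K) * (X * E.+2 ^ r)) = D * X)%N.
  by rewrite /D; ring.
by rewrite ltn_pmul2r.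
Qed.

Section Counting.
Variables (k : fieldType) (n s : nat).
Local Notation S := {mpoly k[n]}.
Local Notation T := {mpoly k[s.+1]}.
Local Notation G := {mpoly T[n]}.
Variables (L : 'I_s.+1 -> S) (P : S -> Prop).
Hypotheses (L1 : forall a, L a \is 1.-homog) (idP : ideal P) (grP : graded P).
Local Notation I := (gen_ideal L P s.+1).
Local Notation ev := (ev L).
Local Notation evT := (evT L).

Definition zero_ideal (A : comNzRingType) (f : A) : Prop := f = 0.

Lemma ideal_zero (A : comNzRingType) : ideal (@zero_ideal A).
Proof.
by split=> [|f g -> ->|a f ->]; rewrite /zero_ideal ?addr0 ?mulr0.
Qed.

Lemma std_zero r (m : 'X_{1..r}) : std (@zero_ideal {mpoly k[r]}) m.
Proof. by apply/stdP => -[f [-> /eqP]]. Qed.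

Lemma hf_zero j : hf (@zero_ideal T) j = 'C(j + s, s).
Proof.
rewrite -(bin_sub (leq_addl _ _)) addnK -(size_basis s j) /hf cardE -(size_map val).
apply/perm_size/uniq_perm; first by rewrite map_inj_uniq ?enum_uniq //; apply: val_inj.
  exact: uniq_basis.
move=> m; rewrite -basis_cover; apply/mapP/eqP => [[m' mm' ->]|mj].
  by move: mm'; rewrite mem_enum inE => /andP[/eqP].
have mlt : (mdeg m < j.+1)%N by rewrite mj.
by exists (BMultinom mlt) => //; rewrite mem_enum inE /= mj eqxx std_zero.
Qed.

Definition scalar : {rmorphism k -> G} := @mpolyC n T \o @mpolyC s.+1 k.

Lemma ev_scalar c : ev (scalar c) = c%:MP.
Proof. by rewrite evC evTC. Qed.

(** They index a basis of the part of degree [j] of the free [T]-module on the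
    standard monomials of [I]. *)
Definition pairs j : pred ('X_{1..n < j.+1} * 'X_{1..s.+1 < j.+1}) :=
  fun p => std I p.1 && (mdeg p.1 + mdeg p.2 == j)%N.

Lemma card_pairs j : #|@pairs j| = (\sum_(i < j.+1) hf I i * 'C(j - i + s, s))%N.
Proof.
rewrite -sum1_card (partition_big (fun p => Ordinal (bmdeg p.1)) predT) //=.
apply: eq_bigr => i _; rewrite sum1_card -hf_zero.
have ij : (i <= j)%N by rewrite -ltnS.
rewrite {1}/hf (@card_bounded_monomials _ i.+1 j.+1 (fun m => (mdeg m == i) && std I m)) //; last first.
  by move=> m /andP[/eqP ->].
rewrite /hf (@card_bounded_monomials _ (j - i).+1 j.+1
  (fun m => (mdeg m == (j - i)%N) && std (@zero_ideal T) m)); first last.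
- by rewrite ltnS leq_subr.
- by move=> m /andP[/eqP ->].
rewrite -cardX; apply: eq_card => -[m e]; rewrite !inE /= std_zero andbT unfold_in /pairs /=.
rewrite -(inj_eq val_inj) /= andbC; case: (mdeg m =P i) => [mi|_] /=.
- by rewrite unfold_in /= [mdeg m]mi; congr (_ && _); lia.
- by [].
Qed.

Lemma bihomog_expand j g : reduced L P g -> bihomog j g ->
  exists a : {p in @pairs j} -> k,
    g = \sum_t scalar (a t) * (('X_[val (val t).2])%:MP * 'X_[val (val t).1]).
Proof.
move=> rg jg; exists (fun t => (g@_(val (val t).1))@_(val (val t).2)).
have sg : (msize g <= j.+1)%N.
  apply/msize_leqP => m mj; have := jg m; rewrite leqNgt mj; exact.
rewrite {1}(mpolywE sg).
rewrite -(big_sub (@pairs j) (fun p => scalar ((g@_(val p.1))@_(val p.2)) *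
  (('X_[val p.2])%:MP * 'X_[val p.1]))) big_mkcond /=.
transitivity (\sum_(m : 'X_{1..n < j.+1}) \sum_(e : 'X_{1..s.+1 < j.+1})
  if (m, e) \in @pairs j then scalar ((g@_m)@_e) * (('X_[e])%:MP * 'X_[m]) else 0);
  last first.
  by rewrite pair_bigA [RHS]big_mkcond; apply: eq_bigr => -[].
apply: eq_bigr => m _; have mj : (mdeg m <= j)%N by rewrite -ltnS bmdeg.
have := jg m; rewrite mj => gm.
have sgm : (msize g@_m <= j.+1)%N.
  apply/msize_leqP => e je; apply: (dhomog_nemf_coeff gm).
  by rewrite gtn_eqF // (leq_ltn_trans (leq_subr _ _)).
rewrite -mul_mpolyC {1}(mpolywE sgm) rmorph_sum mulr_suml; apply: eq_bigr => e _ /=.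
rewrite -mul_mpolyC mpolyCM -mulrA; case: ifPn => // np.
suff -> : (g@_m)@_e = 0 by rewrite !mpolyC0 mul0r.
move: np; rewrite unfold_in /pairs /= negb_and => /orP[/negbNE/asboolP lm|me].
  by rewrite rg ?mcoeff0.
apply: (dhomog_nemf_coeff gm); apply: contra_neq me => ->.
by rewrite subnKC.
Qed.

(** Two relations that are not proportional span a free module of rank two, so
    [T]-freeness of the module on the standard monomials leaves that much less
    room for [S/P]. *)
Lemma count_independent_relations j i i' g h :
    relation L P g -> bihomog i g -> relation L P h -> bihomog i' h ->
    ~ proportional g h -> (i <= j)%N -> (i' <= j)%N ->
  (hf P j + ('C(j - i + s, s) + 'C(j - i' + s, s)) <= #|@pairs j|)%N.
Proof.
move=> [rg Pg] ig [rh Ph] ih' nprop ij i'j.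
have [m [m' ne]] : exists m m', g@_m * h@_m' != g@_m' * h@_m.
  apply: contrapT => no; apply: nprop => m m'; apply/eqP/negPn/negP => ne.
  by apply: no; exists m, m'.
rewrite -!hf_zero -!card_stdset -!card_sum -[leqRHS]card_subset_type.
have /choice[g0 g0P] := fun t : {m in stdset P j} => reduced_lift L1 idP grP (mono_homog t).
pose u (t : {m in stdset P j} + ({m in stdset (@zero_ideal T) (j - i)} +
    {m in stdset (@zero_ideal T) (j - i')})) : G :=
  match t with
  | inl t => g0 t
  | inr (inl t) => (mono t)%:MP * g
  | inr (inr t) => (mono t)%:MP * h
  end.
apply: (lindep_span (u := u) (@ideal_zero G) (iota := scalar)
  (w := fun t : {p in @pairs j} => ('X_[val (val t).2])%:MP * 'X_[val (val t).1])); last first.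
  have ured t : reduced L P (u t) /\ bihomog j (u t).
    case: t => [t|[t|t]] /=; first by have [] := g0P t.
      split; first exact: reducedM.
      by have := bihomogM (mono_homog t) ig; rewrite subnK.
    split; first exact: reducedM.
    by have := bihomogM (mono_homog t) ih'; rewrite subnK.
  move=> t; have [a e] := bihomog_expand (ured t).1 (ured t).2.
  by exists a; rewrite {1}e subrr.
move=> c; rewrite !big_sumType /=.
set A := \sum_t _; set B := \sum_t _; set C := \sum_t _ => sum0.
pose cg := \sum_t (c (inr (inl t)))%:MP * mono t : T.
pose ch := \sum_t (c (inr (inr t)))%:MP * mono t : T.
have BE : B = cg%:MP * g.
  rewrite rmorph_sum mulr_suml; apply: eq_bigr => t _.
  by rewrite rmorphM -mulrA.
have CE : C = ch%:MP * h.
  rewrite rmorph_sum mulr_suml; apply: eq_bigr => t _.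
  by rewrite rmorphM -mulrA.
have cA : forall t, c (inl t) = 0.
  apply: (@hf_lindep _ _ P j (fun t => c (inl t))).
  apply: (ideal_congr (g := ev A) idP).
    rewrite rmorph_sum -sumrB; apply: (ideal_sum idP) => t _.
    rewrite rmorphM ev_scalar -mulrBr; apply: (ideal_mull idP).
    by have [_ _] := g0P t.
  have -> : ev A = - (evT cg * ev g + evT ch * ev h).
    have := congr1 ev sum0; rewrite rmorph0 rmorphD rmorphD BE CE !rmorphM !evC => /eqP.
    by rewrite addr_eq0 => /eqP.
  by apply: (idealN idP); apply: (idealD idP); apply: (ideal_mull idP).
have A0 : A = 0 by apply: big1 => t _; rewrite cA rmorph0 mul0r.
have rel m1 : cg * g@_m1 + ch * h@_m1 = 0.
  have := congr1 (mcoeff m1) sum0.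
  by rewrite A0 add0r BE CE mcoeffD !mcoeffCM mcoeff0.
have det0 x y a b a' b' : x * a + y * b = 0 :> T -> x * a' + y * b' = 0 ->
    a * b' != a' * b -> x = 0.
  move=> e e' ne'; apply/eqP; have : x * (a * b' - a' * b) = 0.
    rewrite (_ : x * _ = (x * a + y * b) * b' - (x * a' + y * b') * b); last by ring.
    by rewrite e e' !mul0r subrr.
  by move=> /eqP; rewrite mulf_eq0 subr_eq0 (negPf ne') orbF.
(* Cramer's rule on two rows where [g] and [h] are not proportional. *)
have cg0 : cg = 0 by apply: det0 (rel m) (rel m') ne.
have ch0 : ch = 0.
  apply: (det0 ch cg h@_m g@_m h@_m' g@_m').
  - by rewrite addrC; apply: rel.
  - by rewrite addrC; apply: rel.
  - by rewrite mulrC [h@_m' * _]mulrC eq_sym.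
case=> [//|[]].
  by apply: (@hf_lindep _ _ (@zero_ideal T) (j - i) (fun t => c (inr (inl t)))); exact: cg0.
by apply: (@hf_lindep _ _ (@zero_ideal T) (j - i') (fun t => c (inr (inr t)))); exact: ch0.
Qed.

(** If [c(L)] were in [P], then [S/P] would be a quotient of the tensor product
    of [S/I] and [T/(c)], of too small a dimension. *)
Lemma linear_forms_independent d : (s < d)%N ->
  ~ dim_lt P d -> dim_lt I (d - s) -> forall c, P (evT c) -> c = 0.
Proof.
move=> sd ndP dI c Pc; apply/eqP; apply: contrapT => /negP c0; apply: ndP.
pose J := adjoin (@zero_ideal T) c; have idJ := ideal_adjoin (@ideal_zero T) c.
have dJ : dim_lt J s.+1.
  apply: (dim_lt_sub_prime (Q0 := @zero_ideal T) (f := c)).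
  - exact: ideal_zero.
  - exact: idJ.
  - by move=> g; apply: sub_adjoin.
  - by move=> g /eqP; rewrite mulf_eq0 (negPf c0) => /eqP.
  - exact: mem_adjoin (@ideal_zero T) c.
  - exact: dim_lt_nvars.
(* Products of standard monomials of [I] and of [(c)] span [S/P]. *)
have le j : (hfa P j <= hfa I j * hfa J j)%N.
  rewrite -[hfa I j]card_astdset -[hfa J j]card_astdset -card_prod.
  apply: (span_geq_hfa (w := fun t => 'X_[val (val t.1)] * evT (mono t.2)) idP) => f fj.
  have /choice[g gP] := fun i : 'I_j.+1 => reduced_lift L1 idP grP (pihomogP mdeg i f).
  pose g1 := \sum_i g i.
  have Pf : P (f - ev g1).
    rewrite {1}(@pihomog_partitionE _ _ mdeg j.+1 f) // rmorph_sum -sumrB.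
    by apply: (ideal_sum idP) => i _; have [] := gP i.
  have rg1 : reduced L P g1 by apply: reduced_sum => i _; have [] := gP i.
  have small m : (msize g1@_m <= j.+1)%N /\ (m \in msupp g1 -> (mdeg m < j.+1)%N).
    have gm (i : 'I_j.+1) : (msize (g i)@_m <= j.+1)%N /\ ((j < mdeg m)%N -> (g i)@_m = 0).
      have [_ /(_ m) gim _] := gP i; have ij : (i <= j)%N by rewrite -ltnS.
      case: (leqP (mdeg m) i) gim => [mi gim|im ->]; last by rewrite msize0.
      split; last by rewrite ltnNge (leq_trans mi ij).
      apply/msize_leqP => e je; apply: (dhomog_nemf_coeff gim).
      by rewrite gtn_eqF // (leq_ltn_trans (leq_subr _ _)) // (leq_ltn_trans ij).
    split.
      apply/msize_leqP => e je; rewrite raddf_sum raddf_sum big1 // => i _.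
      by have /msize_leqP := (gm i).1; apply.
    rewrite mcoeff_msupp; apply: contraR; rewrite -leqNgt => jm.
    by rewrite raddf_sum big1 // => i _; apply: (gm i).2.
  have /choice[b bP] := fun m => hfa_span idJ (small m).1.
  exists (fun t => b (val (val t.1)) t.2).
  rewrite -(subrKA (ev g1)); apply: (idealD idP) => //.
  rewrite (@expand_monomials _ _ j.+1 (fun m => std I m) g1) => [|m mg]; last first.
    split; first exact: (small m).2.
    by apply/stdP => lm; move: mg; rewrite mcoeff_msupp rg1 ?eqxx.
  rewrite -(pair_bigA _ (fun t1 t2 => (b (val (val t1)) t2)%:MP * ('X_[val (val t1)] * evT (mono t2)))) /=.
  rewrite rmorph_sum -sumrB; apply: (ideal_sum idP) => t _.
  rewrite rmorphM evC evX.
  have -> : \sum_t2 (b (val (val t)) t2)%:MP * ('X_[val (val t)] * evT (mono t2)) =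
      evT (\sum_t2 (b (val (val t)) t2)%:MP * mono t2) * 'X_[val (val t)].
    rewrite rmorph_sum mulr_suml; apply: eq_bigr => t2 _.
    by rewrite rmorphM evTC mulrCA mulrC.
  rewrite -mulrBl -rmorphB; apply: (ideal_mulr idP).
  have [h] := bP (val (val t)); rewrite /zero_ideal => /eqP; rewrite subr_eq0 => /eqP ->.
  by rewrite rmorphM; apply: (ideal_mull idP).
have [C hC] := dI; have [D hD] := dJ.
exists (C * D)%N => j; have := leq_mul (hC j) (hD j); rewrite mulnACA [leqRHS]mulnACA -expnD.
have -> : (d - s + s.+1 = d.+1)%N by lia.
rewrite expnSr !mulnA leq_mul2r /= => h; apply: leq_trans h.
by rewrite leq_mul2r le orbT.
Qed.

End Counting.

Section CountingTower.
Variables (k : fieldType) (n : nat).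
Local Notation S := {mpoly k[n]}.
Implicit Types (P J : S -> Prop) (vs : seq 'rV[k]_n).

Lemma homog_cancel J l : ideal J -> graded J -> l \is 1.-homog ->
  (forall j f, f \is j.-homog -> J (l * f) -> J f) -> forall f, J (l * f) -> J f.
Proof.
move=> idJ grJ l1 reg f Jlf; rewrite [f](pihomog_partitionE (leqnn (msize f))).
apply: (ideal_sum idJ) => i _; apply: (reg i); first exact: pihomogP.
exact: (graded_colon grJ l1).
Qed.

Definition defect_sum P vs a j :=
  (\sum_(q < j) defect (tower P (take a vs)) (lform (nth 0%R vs a)) q)%N.

Lemma cumulate_adjoin J l j : ideal J -> graded J -> l \is 1.-homog ->
  cumulate (hf (adjoin J l)) j = (hf J j + \sum_(q < j) defect J l q)%N.
Proof.
move=> idJ grJ l1; elim: j => [|j IH].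
  by rewrite /cumulate big_ord1 big_ord0 addn0 hf_adjoin_step0.
rewrite /cumulate big_ord_recr /= -/(cumulate _ j) IH big_ord_recr /=.
by have := hf_adjoin_step j idJ grJ l1; lia.
Qed.

(** In terms of Hilbert series,
    [h_(A_s) / (1 - t)^s = h_A + sum_a t p_a / (1 - t)^(a+1)], with [A_a] and
    [p_a] as above. *)
Lemma iter_cumulate_tower P vs j : ideal P -> graded P ->
  iter (size vs) cumulate (hf (tower P vs)) j =
  (hf P j + \sum_(a < size vs) iter a cumulate (defect_sum P vs a) j)%N.
Proof.
move=> idP grP; elim/last_ind: vs j => [|vs v IH] j; first by rewrite big_ord0 addn0.
have idJ := ideal_tower vs idP; have grJ := @graded_tower _ _ _ vs idP grP.
rewrite size_rcons big_ord_recr tower_rcons /= -iterS iterSr.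
rewrite (eq_iter_cumulate _ (fun i => cumulate_adjoin i idJ grJ (lform_homog v))).
rewrite iter_cumulateD IH -addnA; congr (_ + (_ + _))%N.
  apply: eq_bigr => a _; apply: eq_iter_cumulate => i; apply: eq_bigr => q _.
  by rewrite /= -cats1 nth_cat ltn_ord takel_cat // ltnW.
apply: eq_iter_cumulate => i; apply: eq_bigr => q _.
by rewrite -cats1 take_size_cat // nth_cat ltnn subnn.
Qed.

Lemma defect_sum_bounded P vs : ideal P -> graded P -> filter_regular_seq P vs ->
  exists K, forall a j, (a < size vs)%N -> (defect_sum P vs a j <= K)%N.
Proof.
move=> idP grP fr.
have /choice[K hK] : forall a : 'I_(size vs), exists K, forall j, (defect_sum P vs a j <= K)%N.
  move=> a; move: fr.
  rewrite -{1}(cat_take_drop a vs) (drop_nth 0) // => /filter_regular_seq_cat[_ [fr _]].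
  have [Q hQ] := filter_regular_defect (ideal_tower _ idP) (graded_tower idP grP)
    (lform_homog _) fr.
  by eexists => j; apply: sum_defect_bounded hQ.
exists (\sum_a K a)%N => a j lt; apply: leq_trans (hK (Ordinal lt) j) _.
by rewrite (bigD1 (Ordinal lt)) //= leq_addr.
Qed.

Section SingleDefect.
Variables (s : nat) (P : S -> Prop) (vs : seq 'rV[k]_n).
Hypotheses (idP : ideal P) (grP : graded P) (vs_s : size vs = s.+1).
Hypothesis primeP : forall a b, P (a * b) -> P a \/ P b.
Let L (a : 'I_s.+1) : S := lform (nth 0 vs a).
Let L1 a : L a \is 1.-homog. Proof. exact: lform_homog. Qed.

Lemma tower_gen_ideal i : (i <= s.+1)%N -> tower P (take i vs) = gen_ideal L P i.
Proof.
elim: i => [|i IH] lt; apply: funext => f; apply: propext.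
  rewrite take0 /=; split=> [Pf|[q]].
    by exists (fun=> 0); rewrite big_pred0 ?subr0.
  by rewrite big_pred0 ?subr0.
rewrite (take_nth 0) ?vs_s // tower_rcons IH 1?ltnW //.
have sumE (q : 'I_s.+1 -> S) : \sum_(a < s.+1 | (a < i.+1)%N) q a * L a =
    q (Ordinal lt) * lform (nth 0 vs i) + \sum_(a < s.+1 | (a < i)%N) q a * L a.
  rewrite (bigD1 (Ordinal lt)) //=; congr (_ + _); apply: eq_bigl => a.
  by rewrite -(inj_eq val_inj) /= ltnS ltn_neqAle andbC.
split=> [[c [q Pq]]|[q]].
  exists (fun a => if a == Ordinal lt then c else q a); rewrite sumE eqxx.
  rewrite opprD addrA; move: Pq; congr (P (_ - _)); apply: eq_bigr => a ai.
  by case: eqP ai => [->|] //=; rewrite ltnn.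
by rewrite sumE opprD addrA => Pq; exists (q (Ordinal lt)), q.
Qed.

(** The last form kills at most one class, so [S/P] is too large for the
    relations to contain a free module of rank two. *)
Lemma relations_proportional_of_defect : filter_regular_seq P vs ->
    (forall j, (defect_sum P vs s j <= 1)%N) ->
  forall i j g h, relation L P g -> bihomog i g -> relation L P h -> bihomog j h ->
  proportional g h.
Proof.
move=> fr d1 i i' g h Rg ig Rh ih'; apply: contrapT => nprop.
have [K hK] := defect_sum_bounded idP grP fr.
apply: (@binomial_not_doubled s (i + i') (s * K)) => x.
set j := (x + (i + i'))%N.
have := count_independent_relations L1 idP grP Rg ig Rh ih' nprop (j := j).
have -> : (i <= j)%N by rewrite /j; lia.
have -> : (i' <= j)%N by rewrite /j; lia.
move=> /(_ isT isT); rewrite card_pairs -iter_cumulate_binomial -tower_gen_ideal //.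
rewrite -{2}vs_s take_size -vs_s iter_cumulate_tower // vs_s leq_add2l big_ord_recr /=.
move=> le; apply: leq_trans (leq_trans le _).
  by rewrite mul2n -addnn; apply: leq_add; apply: leq_bin2l; rewrite /j; lia.
rewrite addnC; apply: leq_add.
  rewrite -[X in (_ <= X)%N]iter_cumulate1; exact: leq_iter_cumulate.
case: s vs_s hK {le} => [|r] vs_r hK; first by rewrite big_ord0.
rewrite -mulnA -[X in (_ <= X * _)%N]card_ord -sum_nat_const; apply: leq_sum => a _.
apply: leq_trans (iter_cumulate_bounded _ _ (K := K) _) _.
  by move=> e; apply: hK; rewrite vs_r ltnS ltnW.
by rewrite leq_mul2l leq_pexp2l ?orbT // -ltnS.
Qed.

(** The relation coming from the last zero-divisor generates all of them and is
    nonzero modulo the other forms, so none of those is a zero-divisor. *)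
Lemma regular_of_single_defect d : filter_regular_seq P vs -> (s < d)%N ->
    dim_lt P d.+1 -> ~ dim_lt P d ->
    (forall j, (defect_sum P vs s j <= 1)%N) ->
    (exists j, defect (tower P (take s vs)) (lform (nth 0 vs s)) j <> 0%N) ->
  forall a f, (a < s)%N -> tower P (take a vs) (lform (nth 0 vs a) * f) ->
  tower P (take a vs) f.
Proof.
move=> fr sd dP ndP d1 [j dj] a.
have prop := relations_proportional_of_defect fr d1.
have dI : dim_lt (gen_ideal L P s.+1) (d - s).
  rewrite -tower_gen_ideal // -{1}vs_s take_size -[(d - s)%N]prednK ?subn_gt0 //.
  apply: dim_lt_tower => //; rewrite vs_s (_ : (_ + _)%N = d) //; lia.
have evT_inj c : P (evT L c) -> c = 0.
  exact: (linear_forms_independent L1 idP grP sd ndP dI).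
have ltS : (s < s.+1)%N by [].
pose l := @ord_max s.
have [f0 [jf0 If0 nIf0]] : exists z, [/\ z \is j.-homog, gen_ideal L P s (L l * z) & ~ gen_ideal L P s z].
  rewrite -tower_gen_ideal //; apply: defect_neq0 dj => //.
  - exact: ideal_tower.
  - exact: graded_tower.
  - exact: lform_homog.
have [g [h [Pfg Rz jz]]] := relation_of_zerodivisor L1 idP grP jf0 If0.
set z := _ - _ in Rz jz.
(* Otherwise the class killed by the last form would be zero modulo the others. *)
have kz : @killG k n s s z != 0.
  apply/eqP => z0; apply: nIf0; have kg : @killG k n s s g = 0.
    apply: (@killG_mulX _ _ _ l).
    by move: z0; rewrite /z rmorphB killG_sum0 subr0.
  exact: gen_of_kill kg Pfg.
have z0 : z != 0 by apply: contraNneq kz => ->; rewrite rmorph0.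
have [zeta [[rzeta Pzeta] princ]] := principal_relations primeP evT_inj prop Rz jz z0.
have kzeta : @killG k n s s zeta != 0.
  have [c e] := princ _ _ Rz jz; apply: contraNneq kz => k0.
  by rewrite e rmorphM k0 mulr0.
move=> f lta; have ltas : (a < s.+1)%N by apply: ltnW.
rewrite tower_gen_ideal 1?ltnW //; apply: homog_cancel.
- exact: ideal_gen.
- exact: graded_gen.
- exact: lform_homog.
move=> i h' ih'.
exact: (regular_of_principal L1 idP grP (a := Ordinal ltas) princ Pzeta kzeta lta ih').
Qed.

End SingleDefect.
End CountingTower.

(** * The Hilbert function is constant on general sections *)

Section GenericSections.
Variables (k : fieldType) (n s : nat).
Local Notation S := {mpoly k[n]}.
Local Notation R := {mpoly k[(s * n)%N]}.
Local Notation hcomp := (pihomog mdeg).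

Definition at_mx (A : 'M[k]_(s, n)) : 'I_(s * n) -> k := mxvec A 0.

Definition specialize (A : 'M[k]_(s, n)) : {rmorphism {mpoly R[n]} -> S} :=
  map_mpoly (meval (at_mx A)).

Definition section_rows (A : 'M[k]_(s, n)) : seq 'rV[k]_n :=
  [seq row a A | a <- enum 'I_s].

Definition generic_form (a : 'I_s) : {mpoly R[n]} :=
  \sum_i ('X_(mxvec_index a i))%:MP * 'X_i.

Lemma specialize_coef A f m : (specialize A f)@_m = (f@_m).@[at_mx A].
Proof. exact: mcoeff_map_mpoly. Qed.

Lemma specialize_generic_form A a : specialize A (generic_form a) = lform (row a A).
Proof.
rewrite rmorph_sum; apply: eq_bigr => i _; rewrite rmorphM /= map_mpolyC map_mpolyX.
by rewrite -mul_mpolyC mxE; congr (_%:MP * _); rewrite [LHS]mevalXU /at_mx mxvecE.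
Qed.

Definition lift_const (f : S) : {mpoly R[n]} := map_mpoly (@mpolyC _ k) f.

Lemma specialize_const A f : specialize A (lift_const f) = f.
Proof. by apply/mpolyP => m; rewrite specialize_coef mcoeff_map_mpoly mevalC. Qed.

Lemma specialize_hcomp A j f : specialize A (hcomp j f) = hcomp j (specialize A f).
Proof.
apply/mpolyP => m; rewrite specialize_coef !mcoeff_hcomp specialize_coef.
by case: ifP; rewrite ?meval0.
Qed.

Variables (P : S -> Prop) (idP : ideal P) (grP : graded P).
Local Notation I A := (tower P (section_rows A)).

Lemma lift_tower A f : I A f ->
  exists f', specialize A f' = f /\ forall B, I B (specialize B f').
Proof.
rewrite /section_rows; elim/last_ind: (enum _) f => [|r a IH] f /=.
  by move=> Pf; exists (lift_const f); split=> [|B]; rewrite specialize_const.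
rewrite map_rcons tower_rcons => -[h /IH[f' [e If']]].
exists (f' + lift_const h * generic_form a); split=> [|B].
  by rewrite rmorphD rmorphM specialize_const specialize_generic_form e subrK.
rewrite map_rcons tower_rcons; exists h.
by rewrite rmorphD rmorphM specialize_const specialize_generic_form addrK.
Qed.

(** Families of elements of the ideals [I A] that are polynomial in the matrix
    [A]. *)
Definition family_ideal (f : {mpoly R[n]}) := forall A, I A (specialize A f).

Lemma ideal_family : ideal family_ideal.
Proof.
have idI A := ideal_tower (section_rows A) idP.
split=> [A|f g If Ig A|a f If A].
- by rewrite rmorph0; apply: ideal0.
- by rewrite rmorphD; apply: (idealD (idI A)).
- by rewrite rmorphM; apply: (ideal_mull (idI A)).
Qed.

(** [F] is the product of the leading coefficients of families whose leading
    monomials generate all the others. *)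
Lemma generic_leading : exists2 F : R, F != 0 &
  forall A, F.@[at_mx A] != 0 -> forall m, leading family_ideal m -> leading (I A) m.
Proof.
have [Fs FsE genE] := dickson (leading family_ideal).
have /choice[f fP] : forall m, exists f, leading family_ideal m ->
    [/\ family_ideal f, f != 0 & mlead f = m].
  move=> m; have [[f fm]|nl] := pselect (leading family_ideal m); first by exists f.
  by exists 0.
exists (\prod_(m <- Fs) mleadc (f m)).
  rewrite prodf_seq_neq0; apply/allP => m /FsE/fP[_ f0 _]; by rewrite /= mleadc_eq0.
move=> A FA m /genE[m' m'F] m'm; apply: (leadingD (ideal_tower _ idP)) m'm.
have [If f0 lf] := fP m' (FsE _ m'F).
have fm' : (specialize A (f m'))@_m' != 0.
  move: FA; rewrite specialize_coef rmorph_prod prodf_seq_neq0 => /allP/(_ _ m'F) /=.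
  by rewrite lf.
have g0 : specialize A (f m') != 0 by apply: contraNneq fm' => ->; rewrite mcoeff0.
exists (specialize A (f m')); split=> //.
apply/eqP; rewrite eq_le; apply/andP; split; last by apply: msupp_le_mlead; rewrite mcoeff_msupp.
rewrite -[X in (_ <= X)%O]lf; apply: msupp_le_mlead; rewrite mcoeff_msupp.
have := mlead_supp g0; rewrite mcoeff_msupp specialize_coef.
by apply: contraNneq => ->; rewrite meval0.
Qed.

(** If [I A] had more leading monomials of degree [j] than the family, lift
    elements of [I A] with those leading monomials.  The lifts have a matrix of
    coefficients that specializes to the identity at [A], so they are linearly
    independent; but a combination of them has no coefficient on the leading
    monomials of the family, and so is zero. *)
Lemma card_leading_section A j :
  (#|[pred m : 'X_{1..n < j.+1} | (mdeg m == j) && ~~ std (I A) m]| <=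
   #|[pred m : 'X_{1..n < j.+1} | (mdeg m == j) && `[<leading family_ideal m>]]|)%N.
Proof.
set TA := [pred m : 'X_{1..n < j.+1} | _ && ~~ _].
set TB := [pred m : 'X_{1..n < j.+1} | _ && `[<_>]].
have idI := ideal_tower (section_rows A) idP.
have grI B := @graded_tower _ _ _ (section_rows B) idP grP.
have /choice[f fP] : forall t : {m in TA}, exists f : {mpoly R[n]}, [/\ family_ideal f,
    (forall m, mdeg m != j -> f@_m = 0) &
    forall t' : {m in TA}, (f@_(val (val t'))).@[at_mx A] = (t == t')%:R].
  move=> t; have [r [Ir rlead]] := normal_form 'X_[val (val t)] idI.
  have [g [ge Ig]] := lift_tower Ir.
  exists (hcomp j g); split=> [B|m mj|t'].
  - by rewrite specialize_hcomp; apply: grI.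
  - by rewrite mcoeff_hcomp (negPf mj).
  have /andP[t'j /negbNE/asboolP lead'] : val t' \in TA := valP t'.
  rewrite mcoeff_hcomp t'j -specialize_coef ge mcoeffB mcoeffX.
  rewrite [r@__]memN_msupp_eq0 ?subr0 ?(inj_eq val_inj) //.
  by apply/negP => /rlead[/(_ lead')].
rewrite leqNgt; apply/negP; rewrite -card_subset_type -[ltnRHS]card_subset_type.
case/(wide_dependence (fun t t' => (f t)@_(val (val t')))) => c [t0 ct0] c0.
pose g := \sum_t (c t)%:MP * f t.
have gcoef m : g@_m = \sum_t c t * (f t)@_m.
  by rewrite raddf_sum; apply: eq_bigr => t _; apply: mcoeffCM.
have g0 : g = 0.
  apply: contrapT => /eqP g0.
  have Ig : family_ideal g.
    by apply: (ideal_sum ideal_family) => t _; apply: (ideal_mull ideal_family); have [] := fP t.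
  have gj : mdeg (mlead g) = j.
    apply/eqP; apply: contraT => mj; move: g0; rewrite -mleadc_eq0 gcoef big1 ?eqxx // => t _.
    by have [_ -> //] := fP t; rewrite mulr0.
  have mlt : (mdeg (mlead g) < j.+1)%N by rewrite gj.
  have mB : BMultinom mlt \in TB.
    by rewrite inE /= gj eqxx; apply/asboolP; exists g.
  move: g0; rewrite -mleadc_eq0 gcoef.
  by rewrite (c0 (exist _ (BMultinom mlt) mB)) eqxx.
(* The matrix that specializes to the identity at [A]. *)
pose M := \matrix_(i < #|{: {m in TA}}|, i' < #|{: {m in TA}}|)
  (f (enum_val i))@_(val (val (enum_val i'))).
have detM : \det M = 0.
  apply/eqP/det0P; exists (\row_i c (enum_val i)).
    apply: contraNneq ct0 => v0; have := congr1 (fun v : 'rV_ _ => v 0 (enum_rank t0)) v0.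
    by rewrite !mxE enum_rankK => ->.
  apply/rowP => i'; rewrite !mxE.
  transitivity (g@_(val (val (enum_val i')))); last by rewrite g0 mcoeff0.
  rewrite gcoef; transitivity
    (\sum_(t in {: {m in TA}}) c t * (f t)@_(val (val (enum_val i')))); last exact: eq_bigl.
  by rewrite [RHS]big_enum_val; apply: eq_bigr => i _; rewrite !mxE.
have := congr1 (meval (at_mx A)) detM; rewrite meval0 -det_map_mx.
rewrite (_ : map_mx _ M = 1%:M) ?det1 => [/eqP|]; first by rewrite oner_eq0.
apply/matrixP => i i'; rewrite !mxE; have [_ _ fi] := fP (enum_val i).
by rewrite [LHS](fi (enum_val i')) (inj_eq enum_val_inj).
Qed.

Lemma generic_hf : exists2 F : R, F != 0 &
  exists H : nat -> nat, forall A, F.@[at_mx A] != 0 -> forall j, hf (I A) j = H j.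
Proof.
have [F F0 FP] := generic_leading; exists F => //.
exists (fun j => #|[pred m : 'X_{1..n < j.+1} |
  (mdeg m == j) && ~~ `[<leading family_ideal m>]]|) => A FA j.
set TA := [pred m : 'X_{1..n < j.+1} | (mdeg m == j) && ~~ std (I A) m].
set TB := [pred m : 'X_{1..n < j.+1} | (mdeg m == j) && `[<leading family_ideal m>]].
have sub : TB \subset TA.
  apply/fintype.subsetP => m; rewrite !inE => /andP[-> /asboolP lm] /=.
  by apply/negPn/asboolP/FP.
have cardT : #|TB| = #|TA|.
  by apply/eqP; rewrite eqn_leq subset_leq_card // card_leading_section.
have eqT := subset_cardP cardT sub.
apply: eq_card => m; have := eqT m; rewrite !inE.
by case: eqP => //= _; rewrite /std negbK => ->.
Qed.

End GenericSections.

(** * Projections along linear forms *)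

Section OneProjection.
Variables (k : fieldType) (m : nat).
Local Notation hcomp := (pihomog mdeg).
Implicit Types (u v : 'rV[k]_m.+1).

Definition proj_row u v : 'rV[k]_m :=
  \row_j (v 0 (lift ord_max j) - v 0 ord_max / u 0 ord_max * u 0 (lift ord_max j)).

Lemma lform_coef n (v : 'rV[k]_n) i : (lform v)@_U_(i) = v 0 i.
Proof.
rewrite raddf_sum (bigD1 i) //= mcoeffZ mcoeffX eqxx mulr1 big1 ?addr0 // => j ji.
by rewrite mcoeffZ mcoeffX eq_mnm1 (negPf ji) mulr0.
Qed.

Lemma last_coef_lform u : last_coef (lform u) = u 0 ord_max.
Proof. exact: lform_coef. Qed.

Lemma proj_form_lform u v : proj_form (lform u) (lform v) = lform (proj_row u v).
Proof.
have e i : widen_ord (leqnSn m) i = lift ord_max i.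
  by apply: val_inj; rewrite /= /bump leqNgt ltn_ord.
have piX i := proj_formX (lform u) i; rewrite /proj_form in piX.
rewrite {2}/lform /proj_form raddf_sum big_ord_recr /= comp_mpolyZ piX.
rewrite {2}/proj_var unlift_none last_coef_lform.
transitivity (\sum_(i < m) v 0 (lift ord_max i) *: 'X_i -
   (v 0 ord_max / u 0 ord_max) *: (\sum_(i < m) u 0 (lift ord_max i) *: 'X_i : {mpoly k[m]})).
  congr (_ + _).
    apply: eq_bigr => i _; rewrite comp_mpolyZ piX e.
    by rewrite /proj_var liftK.
  rewrite scalerA mulrN scaleNr; congr (- (_ *: _)); apply: eq_bigr => i _.
  by rewrite lform_coef.
rewrite scaler_sumr -sumrB; apply: eq_bigr => i _.
by rewrite scalerA -scalerBl mxE.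
Qed.

Lemma proj_form_homog u j p : p \is j.-homog -> proj_form (lform u) p \is j.-homog.
Proof.
have var i : proj_var (lform u) i \is 1.-homog.
  rewrite /proj_var; case: unlift => [i'|]; first by rewrite dhomogX; apply/eqP/mdeg1.
  by apply/rpredZ/rpred_sum => i' _; apply: rpredZ; rewrite dhomogX; apply/eqP/mdeg1.
move=> pj; rewrite /proj_form comp_mpolyE; rewrite big_seq; apply: rpred_sum => mm mp.
apply: rpredZ; have <- : mdeg mm = j by apply/eqP; move/dhomogP: pj => /(_ _ mp) ->.
rewrite mdegE; elim/big_rec2: _ => [|i q e _ IH]; first exact: dhomog1.
apply: dhomogM => //; rewrite tnth_mktuple.
elim: (mm i) => [|d IHd]; first by rewrite expr0 dhomog1.
by rewrite exprS; apply: (dhomogM (var i) IHd).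
Qed.

Lemma mwiden_homog j (p : {mpoly k[m]}) : p \is j.-homog -> mwiden p \is j.-homog.
Proof.
move=> pj; rewrite [p]mpolyE raddf_sum big_seq; apply: rpred_sum => mm mp /=.
have dw : mdeg (mnmwiden mm) = mdeg mm.
  rewrite !mdegE big_ord_recr /= mnmwiden_ordmax addn0.
  by apply: eq_bigr => i _; rewrite mnmwiden_widen.
rewrite mwidenZ mwidenX; apply: rpredZ; rewrite dhomogX; apply/eqP.
by rewrite [LHS]dw; move/dhomogP: pj => /(_ _ mp).
Qed.

Definition image (A B : Type) (f : A -> B) (I : A -> Prop) : B -> Prop :=
  fun y => exists2 x, I x & f x = y.

Variables (u : 'rV[k]_m.+1) (u_last : u 0 ord_max != 0).
Local Notation pi := (proj_form (lform u)).

Let pi_rmorph : {rmorphism {mpoly k[m.+1]} -> {mpoly k[m]}} :=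
  comp_mpoly [tuple proj_var (lform u) i | i < m.+1].

Lemma proj_form_split f : exists h, f = mwiden (pi f) + h * lform u.
Proof.
have [|h e] := proj_form_mod (lform_homog u) _ f; first by rewrite last_coef_lform.
by exists h; rewrite mulrC -e addrC subrK.
Qed.

Lemma proj_form_u : pi (lform u) = 0.
Proof. by apply: proj_form_l; [exact: lform_homog | rewrite last_coef_lform]. Qed.

Lemma image_ideal_proj K : ideal K -> ideal (image pi K).
Proof.
move=> idK; split=> [|f g [f' Kf <-] [g' Kg <-]|a f [f' Kf <-]].
- by exists 0; [exact: ideal0 | exact: (rmorph0 pi_rmorph)].
- by exists (f' + g'); [exact: idealD | exact: (rmorphD pi_rmorph)].
exists (mwiden a * f'); first exact: ideal_mull.
by rewrite [LHS](rmorphM pi_rmorph) [X in X * _]proj_form_mwiden.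
Qed.

Lemma image_adjoin K v f : image pi (adjoin K (lform v)) f <->
  adjoin (image pi K) (lform (proj_row u v)) f.
Proof.
split=> [[f' [h Kf] <-]|[h [g Kg e]]].
  exists (pi h); exists (f' - h * lform v) => //.
  rewrite [LHS](rmorphB pi_rmorph) [X in _ - X](rmorphM pi_rmorph).
  by rewrite [X in _ - _ * X]proj_form_lform.
exists (g + mwiden h * lform v).
  by exists (mwiden h); rewrite addrK.
rewrite [LHS](rmorphD pi_rmorph) [X in _ + X](rmorphM pi_rmorph) [X in X + _]e.
by rewrite [X in _ + X * _]proj_form_mwiden [X in _ + _ * X]proj_form_lform subrK.
Qed.

Lemma image_adjoin_u K f : ideal K -> image pi (adjoin K (lform u)) f <-> image pi K f.
Proof.
move=> idK; split=> [[f' [h Kf] <-]|[f' Kf <-]]; last by exists f' => //; apply: sub_adjoin.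
exists (f' - h * lform u) => //.
rewrite [LHS](rmorphB pi_rmorph) [X in _ - X](rmorphM pi_rmorph).
by rewrite [X in _ - _ * X]proj_form_u mulr0 subr0.
Qed.

Lemma image_mwiden K f : ideal K -> K (lform u) -> image pi K f <-> K (mwiden f).
Proof.
move=> idK Ku; split=> [[f' Kf <-]|Kf]; last by exists (mwiden f); rewrite ?proj_form_mwiden.
have [h e] := proj_form_split f'; apply: (ideal_congr_sym (f := f') idK) => //.
by rewrite {1}e addrAC subrr add0r; apply: ideal_mull.
Qed.

Lemma graded_image K : ideal K -> graded K -> K (lform u) -> graded (image pi K).
Proof.
move=> idK grK Ku f /(image_mwiden _ idK Ku) Kf i; apply/(image_mwiden _ idK Ku).
suff <- : hcomp i (mwiden f) = mwiden (hcomp i f) by apply: grK.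
have split_f : mwiden f = \sum_(j < msize f) mwiden (hcomp j f).
  by rewrite {1}(pihomog_partitionE (leqnn (msize f))) raddf_sum.
rewrite split_f hcomp_sum.
rewrite (eq_bigr (fun j : 'I_(msize f) => if i == j then mwiden (hcomp j f) else 0)); last first.
  by move=> j _; rewrite (hcomp_homog _ (mwiden_homog (pihomogP _ _ _))).
rewrite -big_mkcond; case: (ltnP i (msize f)) => [lt|le].
  by rewrite (big_pred1 (Ordinal lt)) // => j; rewrite eq_sym -(inj_eq val_inj).
rewrite (hcomp_eq0 le) mwiden0 big_pred0 // => j.
by apply: contraTF (ltn_ord j) => /eqP <-; rewrite -leqNgt.
Qed.

(** As [l] is in [K], the projection induces an isomorphism from [S(m+1)/K] to
    [S(m)/pi(K)], with inverse induced by [mwiden]. *)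
Lemma hf_image K j : ideal K -> graded K -> K (lform u) -> hf (image pi K) j = hf K j.
Proof.
move=> idK grK Ku; have idI := image_ideal_proj idK; have grI := graded_image idK grK Ku.
apply/eqP; rewrite eqn_leq; apply/andP; split.
  rewrite -card_stdset; apply: (lindep_leq_hf (u := fun t => mwiden (mono t)) idK grK).
    by move=> t; apply/mwiden_homog/mono_homog.
  move=> c Kc; apply: (@hf_lindep _ _ (image pi K) j).
  apply/(image_mwiden _ idK Ku); move: Kc; rewrite raddf_sum; congr (K _).
  by apply: eq_bigr => t _ /=; rewrite mwidenM mwidenC.
rewrite -(card_stdset (image pi K)); apply: (span_geq_hf (w := fun t => mwiden (mono t)) idK) => f fj.
have [a /(image_mwiden _ idK Ku)] := hf_span idI grI (proj_form_homog u fj).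
have sE : mwiden (\sum_t (a t)%:MP * mono t) = \sum_t (a t)%:MP * mwiden (mono t).
  by rewrite raddf_sum; apply: eq_bigr => t _ /=; rewrite mwidenM mwidenC.
rewrite mwidenB sE => Ka; exists a.
have [h e] := proj_form_split f; apply: (ideal_congr_sym idK) Ka.
rewrite [X in _ - (X - _)]e (_ : _ - _ = - (h * lform u)); last by ring.
exact/(idealN idK)/(ideal_mull idK).
Qed.

End OneProjection.

Section Projections.
Variable k : fieldType.

Lemma image_tower m (u : 'rV[k]_m.+1) (K : {mpoly k[m.+1]} -> Prop) vs :
  image (proj_form (lform u)) (tower K vs) =
  tower (image (proj_form (lform u)) K) (map (proj_row u) vs).
Proof.
elim/last_ind: vs => [//|vs v IH].
rewrite map_rcons !tower_rcons -IH; apply: funext => f; apply: propext.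
exact: image_adjoin.
Qed.

Lemma proj_form_lforms m (u : 'rV[k]_m.+1) vs :
  map (proj_form (lform u)) (map (@lform k _) vs) = map (@lform k _) (map (proj_row u) vs).
Proof. by rewrite -!map_comp; apply: eq_map => v; apply: proj_form_lform. Qed.

(** By [hf_image], one form at a time: projecting along the first form turns
    the tower over the others into the tower over their projections. *)
Lemma image_Proj n s (vs : seq 'rV[k]_n) (K : {mpoly k[n]} -> Prop) :
    size vs = s -> Proj_defined s (map (@lform k n) vs) -> ideal K -> graded K ->
  let J := image (@Proj k n s (map (@lform k n) vs)) K in
  [/\ ideal J, graded J & forall j, hf J j = hf (tower K vs) j].
Proof.
have image_id A (I : A -> Prop) : image id I = I.
  by apply: funext => x; apply: propext; split=> [[y Iy <-]|Ix]; last exists x.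
elim: n s vs K => [|n IH] [|s] [|v vs] K //=; try by rewrite image_id.
case=> vs_s; rewrite last_coef_lform proj_form_lforms => /andP[v0 defd] idK grK.
set pi := proj_form (lform v).
have idKv := ideal_adjoin idK (lform v).
have grKv : graded (adjoin K (lform v)) by apply: graded_adjoin => //; exact: lform_homog.
have Kv : adjoin K (lform v) (lform v) by apply: mem_adjoin.
have K1E : image pi K = image pi (adjoin K (lform v)).
  by apply: funext => f; apply: propext; split=> [/(image_adjoin_u v0 _ idK)|/(image_adjoin_u v0 _ idK)].
have idK1 : ideal (image pi K) by exact: image_ideal_proj.
have grK1 : graded (image pi K) by rewrite K1E; apply: graded_image.
have := IH s (map (proj_row v) vs) (image pi K); rewrite size_map => /(_ vs_s defd idK1 grK1).
set Pr := Proj _ _ => -[idJ grJ hJ].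
have -> : image (fun p => Pr (pi p)) K = image Pr (image pi K).
  apply: funext => f; apply: propext; split=> [[g Kg <-]|[_ [g Kg <-] <-]]; last by exists g.
  by exists (pi g) => //; exists g.
split=> // j; rewrite hJ K1E -image_tower.
apply: hf_image => //; [exact: ideal_tower | exact: graded_tower | exact: sub_tower].
Qed.

(** No [vs`_i] is a combination of the previous rows up to linear forms in the
    first [n - i.+1] variables: the condition under which Gaussian elimination
    from the last column never meets a zero pivot. *)
Definition trailing_free n (vs : seq 'rV[k]_n) := forall i (c : nat -> k), (i < size vs)%N ->
  exists j : 'I_n, (n <= j + i.+1)%N /\ (vs`_i + \sum_(a < i) c a *: vs`_a) 0 j != 0.

Lemma trailing_free_Proj_defined n (vs : seq 'rV[k]_n) :
  trailing_free vs -> Proj_defined (size vs) (map (@lform k n) vs).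
Proof.
elim: n vs => [|n IH] [|v vs] //= free.
  by have [[j lt] _] := free 0%N (fun=> 0) isT.
rewrite last_coef_lform proj_form_lforms.
have v0 : v 0 ord_max != 0.
  have [j [nj]] := free 0%N (fun=> 0) isT; rewrite big_ord0 addr0 /=.
  suff -> : j = ord_max by [].
  by apply: val_inj => /=; have := ltn_ord j; lia.
rewrite v0 /= -(size_map (proj_row v)); apply: IH => i c; rewrite size_map => ivs.
set w := vs`_i + \sum_(a < i) c a *: vs`_a.
have wE : (map (proj_row v) vs)`_i + \sum_(a < i) c a *: (map (proj_row v) vs)`_a = proj_row v w.
  rewrite (nth_map 0) //; apply/rowP => j; rewrite !mxE !summxE.
  under eq_bigr do rewrite (nth_map 0) ?(ltn_trans (ltn_ord _) ivs) // !mxE mulrBr.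
  rewrite sumrB [in RHS]mulrDl [in RHS]mulrDl -!mulrA.
  have -> : \sum_(a < i) c a * (vs`_a 0 ord_max / v 0 ord_max * v 0 (lift ord_max j)) =
      (\sum_(a < i) (c a *: vs`_a) 0 ord_max) * ((v 0 ord_max)^-1 * v 0 (lift ord_max j)).
    by rewrite mulr_suml; apply: eq_bigr => a _; rewrite mxE !mulrA.
  under [in RHS]eq_bigr do rewrite mxE.
  by rewrite opprD addrACA.
(* The coefficient of [v] is the one that cancels the last entry of [w]. *)
have [j [nj]] := free i.+1 (fun a => if a is a'.+1 then c a' else - (w 0 ord_max / v 0 ord_max)) ivs.
have rowE (x y : 'rV[k]_n.+1) b i' : (x + b *: y) 0 i' = x 0 i' + b * y 0 i' by rewrite !mxE.
rewrite big_ord_recl /= addrCA -/w addrC rowE => wj.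
have [j' jE|jE] := unliftP ord_max j; last first.
  by move: wj; rewrite jE mulNr divfK // subrr eqxx.
exists j'; split; first by move: nj; rewrite jE lift_max; lia.
by rewrite wE mxE -mulNr -jE.
Qed.

End Projections.

Section GenericProjection.
Variables (k : fieldType) (n s : nat).
Local Notation R := {mpoly k[(s * n)%N]}.

Lemma size_section_rows (A : 'M[k]_(s, n)) : size (section_rows A) = s.
Proof. by rewrite size_map size_enum_ord. Qed.

Lemma nth_section_rows (A : 'M[k]_(s, n)) (a : 'I_s) : (section_rows A)`_a = row a A.
Proof. by rewrite (nth_map a) ?nth_ord_enum // size_enum_ord. Qed.

(** The last [i.+1] rows are the forms [0], .., [i] in reverse order, the others
    those of the identity; its determinant is nonzero exactly when these forms
    are independent modulo the first [n - i.+1] variables. *)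
Definition trailing_mx (A : 'M[k]_(s, n)) i : 'M[k]_n :=
  \matrix_(r, c) if (r + i.+1 < n)%N then (r == c)%:R else (section_rows A)`_(n - r.+1) 0 c.

Lemma trailing_free_det (A : 'M[k]_(s, n)) : (s <= n)%N ->
  (forall i, (i < s)%N -> \det (trailing_mx A i) != 0) -> trailing_free (section_rows A).
Proof.
move=> sn dets i c; rewrite size_section_rows => lt_is.
pose vs := section_rows A; pose w := vs`_i + \sum_(a < i) c a *: vs`_a.
apply: contrapT => /forallNP w0; have := dets i lt_is; apply/negP; rewrite negbK.
have wj (j : 'I_n) : (n <= j + i.+1)%N -> w 0 j = 0.
  by move=> nj; apply: contrapT => /eqP ne; apply: (w0 j).
pose b a := if a == i then 1 else c a.
have wE : w = \sum_(a < i.+1) b a *: vs`_a.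
  rewrite big_ord_recr /= /b eqxx scale1r addrC; congr (_ + _).
  by apply: eq_bigr => a _; rewrite ltn_eqF ?ltn_ord.
clearbody w.
have lt_in : (n - i.+1 < n)%N by lia.
apply/det0P; exists (\row_(r < n) if (r + i.+1 < n)%N then - w 0 r else b (n - r.+1)%N).
  apply/eqP => /rowP/(_ (Ordinal lt_in)); rewrite !mxE /=.
  have -> : (n - i.+1 + i.+1 < n)%N = false by lia.
  have -> : (n - (n - i.+1).+1 = i)%N by lia.
  by rewrite /b eqxx => /eqP; rewrite oner_eq0.
apply/rowP => j; rewrite !mxE.
under eq_bigr do rewrite !mxE.
rewrite (bigID (fun r : 'I_n => r + i.+1 < n)%N) /=.
rewrite (eq_bigr (fun r : 'I_n => - w 0 r * (r == j)%:R)); last by move=> r ->.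
rewrite [X in _ + X](eq_bigr (fun r : 'I_n => b (n - r.+1)%N * vs`_(n - r.+1) 0 j)); last first.
  by move=> r /negPf ->.
have -> : \sum_(r < n | ~~ (r + i.+1 < n)%N) b (n - r.+1)%N * vs`_(n - r.+1) 0 j = w 0 j.
  rewrite wE summxE (reindex_inj rev_ord_inj) /=.
  rewrite (big_ord_widen n (fun a => (b a *: vs`_a) 0 j)) //; last by lia.
  apply: eq_big => r; first by have := ltn_ord r; lia.
  have -> : (n - (n - r.+1).+1 = r)%N by have := ltn_ord r; lia.
  by rewrite mxE.
case: (ltnP (j + i.+1)%N n) => [lt|le].
  rewrite (bigD1 j) //= eqxx mulr1 big1 ?addr0 ?addNr // => r /andP[_ /negPf ->].
  exact: mulr0.
rewrite (wj j le) addr0 big1 // => r lt; case: eqP => [rj|_]; last exact: mulr0.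
by move: lt; rewrite rj ltnNge le.
Qed.

(** All the determinants are [1] when the forms are the last variables in
    reverse order. *)
Lemma generic_trailing_free : (s <= n)%N -> exists2 F : R, F != 0 &
  forall A : 'M[k]_(s, n), F.@[at_mx A] != 0 -> trailing_free (section_rows A).
Proof.
move=> sn.
pose M i : 'M[R]_n := \matrix_(r, c) if (r + i.+1 < n)%N then (r == c)%:R else
  if insub (n - r.+1)%N : option 'I_s is Some a then 'X_(mxvec_index a c) else 0.
have ME A (i : 'I_s) : map_mx (meval (at_mx A)) (M i) = trailing_mx A i.
  apply/matrixP => r c; rewrite !mxE; case: ifP => [_|/negbT ri].
    by case: (r == c); rewrite ?meval1 ?meval0.
  have lt_s : (n - r.+1 < s)%N by have := ltn_ord i; lia.
  rewrite (insubT (fun a => a < s)%N lt_s) /= mevalXU /at_mx mxvecE.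
  by rewrite -[(n - r.+1)%N]/(val (Ordinal lt_s)) nth_section_rows mxE.
have detE A (i : 'I_s) : (\det (M i)).@[at_mx A] = \det (trailing_mx A i).
  by rewrite -det_map_mx ME.
exists (\prod_(i < s) \det (M i)); last first.
  move=> A; rewrite rmorph_prod prodf_seq_neq0 => /allP nz; apply: trailing_free_det => // i lt.
  by have := nz (Ordinal lt) (mem_index_enum _); rewrite -(detE A (Ordinal lt)).
pose A0 : 'M[k]_(s, n) := \matrix_(a, c) (c == n - a.+1 :> nat)%N%:R.
suff : (\prod_(i < s) \det (M i)).@[at_mx A0] != 0 by apply: contraNneq => ->; rewrite meval0.
rewrite rmorph_prod big1 ?oner_eq0 // => i _; rewrite [LHS]detE.
rewrite (_ : trailing_mx A0 i = 1%:M) ?det1 //; apply/matrixP => r c; rewrite !mxE.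
case: ifP => [//|/negbT ri].
have lt_s : (n - r.+1 < s)%N by have := ltn_ord i; lia.
rewrite -[(n - r.+1)%N]/(val (Ordinal lt_s)) nth_section_rows !mxE /=.
have -> : (n - (n - r.+1).+1 = r)%N by have := ltn_ord r; lia.
by rewrite eq_sym.
Qed.

End GenericProjection.

(** * Choosing general linear forms one after the other *)

Section SequentialChoice.
Variables (k : fieldType) (n : nat).
Hypothesis k_infinite : infinite_set [set: k].

Lemma generic_all (N : nat) (E : nat -> 'rV[k]_n -> Prop) :
  (forall m, generic (E m)) -> generic (fun v => forall m, (m < N)%N -> E m v).
Proof.
move=> gE; elim: N => [|N IH]; first by apply: genericT.
apply: genericW (genericI IH (gE N)) => v [Ev EN] m.
by rewrite ltnS leq_eqVlt => /orP[/eqP -> //|]; apply: Ev.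
Qed.

Definition set_row s (A : 'M[k]_(s, n)) (t : 'I_s) (v : 'rV[k]_n) : 'M[k]_(s, n) :=
  \matrix_(a, i) if a == t then v 0 i else A a i.

Lemma generic_set_row s (F : {mpoly k[(s * n)%N]}) (A : 'M[k]_(s, n)) t :
  F.@[at_mx A] != 0 -> generic (fun v => F.@[at_mx (set_row A t v)] != 0).
Proof.
move=> FA; pose B : 'M[{mpoly k[n]}]_(s, n) :=
  \matrix_(a, i) if a == t then 'X_i else (A a i)%:MP.
pose G := F \mPo [tuple mxvec B 0 j | j < (s * n)%N].
have GE (v : 'rV[k]_n) : G.@[v 0] = F.@[at_mx (set_row A t v)].
  rewrite comp_mpoly_meval; apply: meval_eq => j; rewrite tnth_map tnth_ord_tuple /at_mx.
  case/mxvec_indexP: j => a i; rewrite !mxvecE !mxE; case: ifP => _; [exact: mevalXU | exact: mevalC].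
exists G => [|v]; last by rewrite GE.
apply: contraNneq FA => G0; have := GE (row t A); rewrite G0 meval0.
suff -> : set_row A t (row t A) = A by move=> <-.
by apply/matrixP => a i; rewrite !mxE; case: eqP => [->|].
Qed.

Definition chosen (E : seq 'rV[k]_n -> 'rV[k]_n -> Prop) (vs : seq 'rV[k]_n) :=
  forall i, (i < size vs)%N -> E (take i vs) vs`_i.

Lemma chosen_rcons E vs v : chosen E (rcons vs v) <-> chosen E vs /\ E vs v.
Proof.
split=> [ch|[ch Ev] i].
  split=> [i lt|].
    have := ch i; rewrite size_rcons ltnS => /(_ (ltnW lt)).
    by rewrite -cats1 takel_cat 1?ltnW // nth_cat lt.
  by have := ch (size vs); rewrite size_rcons -cats1 take_size_cat // nth_cat ltnn subnn; apply.
rewrite size_rcons ltnS leq_eqVlt => /orP[/eqP ->|lt].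
  by rewrite -cats1 take_size_cat // nth_cat ltnn subnn.
by rewrite -cats1 takel_cat 1?ltnW // nth_cat lt; apply: ch.
Qed.

Lemma exists_point N (F : {mpoly k[N]}) : F != 0 -> exists v : 'rV[k]_N, F.@[v 0] != 0.
Proof.
move=> /(exists_nonvanishing k_infinite)[w Fw]; exists (\row_j w j).
by apply: contraNneq Fw => e; rewrite -[X in _ == X]e; apply/eqP/meval_eq => j; rewrite mxE.
Qed.

Lemma exists_matrix s (F : {mpoly k[(s * n)%N]}) : F != 0 ->
  exists A : 'M[k]_(s, n), F.@[at_mx A] != 0.
Proof. by case/exists_point => v Fv; exists (vec_mx v); rewrite /at_mx vec_mxK. Qed.

(** Start from a matrix where [F] is nonzero and replace its rows one at a time:
    a general new row keeps [F] nonzero. *)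
Lemma choose_rows s (F : {mpoly k[(s * n)%N]}) E : F != 0 -> (forall vs, generic (E vs)) ->
  exists A : 'M[k]_(s, n), F.@[at_mx A] != 0 /\ chosen E (section_rows A).
Proof.
move=> F0 gE.
suff : forall t, (t <= s)%N -> exists A : 'M[k]_(s, n),
    F.@[at_mx A] != 0 /\ chosen E (take t (section_rows A)).
  move/(_ s (leqnn s)) => [A [FA ch]]; exists A; split=> //.
  by move: ch; rewrite take_oversize // size_section_rows.
elim=> [|t IH] lt; first by have [A FA] := exists_matrix F0; exists A; rewrite take0.
have [A [FA ch]] := IH (ltnW lt); pose t' := Ordinal lt.
have [v [Fv Ev]] := generic_exists k_infinite
  (genericI (generic_set_row t' FA) (gE (take t (section_rows A)))).
exists (set_row A t' v); split=> //.
have nthB (a : 'I_s) : (section_rows (set_row A t' v))`_a =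
    if a == t' then v else (section_rows A)`_a.
  rewrite !nth_section_rows; apply/rowP => i; rewrite !mxE.
  by case: ifP => _ //; rewrite mxE.
rewrite (take_nth 0) ?size_section_rows // -[t]/(val t') nthB eqxx /=.
suff -> : take t (section_rows (set_row A t' v)) = take t (section_rows A).
  by apply/chosen_rcons.
apply: (@eq_from_nth _ 0) => [|a]; first by rewrite !size_take !size_section_rows.
rewrite size_take size_section_rows lt => at_; rewrite !nth_take //.
have las : (a < s)%N by apply: ltn_trans (lt).
by rewrite -[a]/(val (Ordinal las)) nthB -(inj_eq val_inj) /= ltn_eqF.
Qed.

Lemma chosen_extend E vs N : (forall ws, generic (E ws)) -> chosen E vs ->
  exists2 ws, size ws = N & chosen E (vs ++ ws).
Proof.
move=> gE ch; elim: N => [|N [ws wsN chN]]; first by exists [::]; rewrite ?cats0.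
have [v Ev] := generic_exists k_infinite (gE (vs ++ ws)).
exists (rcons ws v); first by rewrite size_rcons wsN.
by rewrite -rcons_cat; apply/chosen_rcons.
Qed.

End SequentialChoice.

(** * Regular sequences against general linear forms *)

Section RegularSequences.
Variables (k : fieldType) (n : nat).
Local Notation S := {mpoly k[n]}.
Implicit Types (I J : S -> Prop) (f l : S) (fs : seq S) (vs : seq 'rV[k]_n).

Definition adjoin_seq I fs : S -> Prop := foldl (@adjoin S) I fs.

Lemma adjoin_seq_rcons I fs f : adjoin_seq I (rcons fs f) = adjoin (adjoin_seq I fs) f.
Proof. exact: foldl_rcons. Qed.

Lemma tower_adjoin_seq I vs : tower I vs = adjoin_seq I (map (@lform k n) vs).
Proof. by elim: vs I => //= v vs IH I; rewrite IH. Qed.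

Lemma ideal_adjoin_seq I fs : ideal I -> ideal (adjoin_seq I fs).
Proof. by elim: fs I => //= f fs IH I idI; apply/IH/ideal_adjoin. Qed.

Lemma adjoinC I f g : adjoin (adjoin I f) g = adjoin (adjoin I g) f.
Proof.
suff sub f' g' h : adjoin (adjoin I f') g' h -> adjoin (adjoin I g') f' h.
  by apply: funext => h; apply: propext; split; apply: sub.
by move=> [a [b Ih]]; exists b, a; rewrite addrAC.
Qed.

Lemma adjoin_seqC I fs f : adjoin_seq (adjoin I f) fs = adjoin (adjoin_seq I fs) f.
Proof. by elim: fs I => //= g fs IH I; rewrite adjoinC IH. Qed.

Lemma gen_byE (p : {pred S}) fs : gen_by p fs = adjoin_seq (fun f => f \in p) fs.
Proof.
elim/last_ind: fs => [|fs f IH]; apply: funext => g; apply: propext.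
  by split=> [[c]|pg]; [|exists (fun=> 0)]; rewrite big_ord0 subr0.
have lt (i : 'I_(size fs)) : (i < size (rcons fs f))%N by rewrite size_rcons ltnS ltnW.
have sumE (c : 'I_(size (rcons fs f)) -> S) (b : nat -> S) : (forall i, c i = b i) ->
    \sum_i c i * (rcons fs f)`_i = \sum_(i < size fs) b i * fs`_i + b (size fs) * f.
  move=> cb; rewrite (eq_bigr (fun i : 'I_(size (rcons fs f)) => b i * (rcons fs f)`_i)); last first.
    by move=> i _; rewrite cb.
  rewrite -(big_mkord xpredT (fun i => b i * (rcons fs f)`_i)) size_rcons big_mkord big_ord_recr /=.
  rewrite nth_rcons ltnn eqxx; congr (_ + _); apply: eq_bigr => i _.
  by rewrite nth_rcons ltn_ord.
have szlt : (size fs < size (rcons fs f))%N by rewrite size_rcons.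
rewrite adjoin_seq_rcons -IH; split=> [[c pg]|[h [c pg]]].
  exists (c (Ordinal szlt)), (fun i => c (Ordinal (lt i))).
  pose b i := if insub i is Some i' then c i' else 0.
  move: pg; rewrite (sumE c b) => [|i]; last by rewrite /b valK.
  rewrite opprD addrA addrAC; congr (_ - _ - _ \in p).
    by rewrite /b (insubT (fun j => j < _)%N szlt).
  by apply: eq_bigr => i _; rewrite /b (insubT (fun j => j < _)%N (lt i)).
pose b i := if insub i is Some i' then c i' else h.
exists (fun i => b i); rewrite (sumE _ b) // opprD addrA addrAC.
move: pg; congr (_ - _ - _ \in p); first by rewrite /b insubF // ltnn.
by apply: eq_bigr => i _; rewrite /b valK.
Qed.

Definition regular_on I f := forall g, I (f * g) -> I g.

Definition no_socle I := forall z, (forall i, I ('X_i * z)) -> I z.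

Lemma regular_no_socle I f : ideal I -> f@_0%MM = 0 -> regular_on I f -> no_socle I.
Proof. by move=> idI f0 reg z soc; apply: reg; apply: (socle_mul idI soc f0). Qed.

(** Transposing two elements of a regular sequence. *)
Lemma regular_on_adjoin I f l : ideal I -> regular_on I f -> regular_on (adjoin I f) l ->
  regular_on (adjoin I l) f.
Proof.
move=> idI regf regl g [h Ih].
have [|h' Ih'] := regl h.
  exists g; rewrite -opprB; apply: (idealN idI).
  by rewrite [g * f]mulrC [l * h]mulrC.
exists h'; apply: regf.
rewrite (_ : _ * _ = f * g - h * l + l * (h - h' * f)); last by ring.
by apply: (idealD idI) => //; apply: (ideal_mull idI).
Qed.

(** What is asked from a form so that it can be compared with a sequence [fs]
    that may be regular modulo [I]. *)
Definition good_form fs I v :=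
  filter_regular I (lform v) /\
  forall m, (m < (size fs).+1)%N -> no_socle (adjoin_seq I (take m fs)) ->
  regular_on (adjoin_seq I (take m fs)) (lform v).

Lemma generic_good_form fs I : ideal I -> graded I ->
  generic (good_form fs I).
Proof.
move=> idI grI; apply: genericI; first exact: generic_filter_regular_graded.
apply: (@generic_all k n _ (fun m v => no_socle (adjoin_seq I (take m fs)) ->
  regular_on (adjoin_seq I (take m fs)) (lform v))) => m.
have [ns|s] := pselect (no_socle (adjoin_seq I (take m fs))); last first.
  by apply: genericT => v /s.
apply: genericW (generic_regular (ideal_adjoin_seq (take m fs) idI) ns) => v reg _ z.
exact: reg.
Qed.

(** Each general linear form can replace the last element of a regular
    sequence: it is regular modulo every initial part of the sequence but the
    whole, and can be transposed past the elements one by one. *)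
Lemma exchange I fs vs : ideal I -> graded I ->
    (forall f, f \in fs -> f@_0%MM = 0) ->
    (forall j, (j < size fs)%N -> regular_on (adjoin_seq I (take j fs)) fs`_j) ->
    chosen (fun ws => good_form fs (tower I ws)) vs ->
  forall i, (i <= size vs)%N ->
  forall j, (j + i < size fs)%N -> regular_on (adjoin_seq (tower I (take i vs)) (take j fs)) fs`_j.
Proof.
move=> idI grI fs0 reg ch; elim=> [|i IH] lt j ji.
  by rewrite take0; apply: reg; rewrite addn0 in ji.
have lti := ltnW lt; have idT := ideal_tower (take i vs) idI.
rewrite (take_nth 0) // tower_rcons adjoin_seqC; apply: regular_on_adjoin.
- exact: ideal_adjoin_seq.
- by apply: IH => //; lia.
have [_] := ch i lt.
have jfs : (j < size fs)%N by lia.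
rewrite -adjoin_seq_rcons -take_nth //; apply; first by lia.
have ltj : (j.+1 + i < size fs)%N by rewrite addSnnS.
have j1fs : (j.+1 < size fs)%N by lia.
apply: (@regular_no_socle _ fs`_j.+1).
- exact: ideal_adjoin_seq.
- exact/fs0/mem_nth.
by apply: IH => //; lia.
Qed.

(** By [exchange] the first element of [fs] is still regular modulo the
    previous forms, so there is no socle and the next form is regular. *)
Lemma defect_eq0_of_regular_seq I fs vs : ideal I -> graded I ->
    (forall f, f \in fs -> f@_0%MM = 0) ->
    (forall j, (j < size fs)%N -> regular_on (adjoin_seq I (take j fs)) fs`_j) ->
    chosen (fun ws => good_form fs (tower I ws)) vs ->
  forall i j, (i < size vs)%N -> (i < size fs)%N ->
  defect (tower I (take i vs)) (lform vs`_i) j = 0%N.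
Proof.
move=> idI grI fs0 reg ch i j ivs ifs.
have idT := ideal_tower (take i vs) idI.
have [_ /(_ 0%N isT)] := ch i ivs; rewrite take0 /= => regl.
apply: defect_eq0 => //; [exact: graded_tower | exact: lform_homog | move=> z _].
apply: regl; apply: (@regular_no_socle _ fs`_0) => //.
  by apply/fs0/mem_nth/(leq_ltn_trans _ ifs).
have := exchange idI grI fs0 reg ch (ltnW ivs) (j := 0%N); rewrite take0; exact.
Qed.

End RegularSequences.

(** * Hilbert coefficients and depth under general projections *)

Lemma hilbert_numerator_hf (k : fieldType) n n' (I : {mpoly k[n]} -> Prop)
    (J : {mpoly k[n']} -> Prop) D q : (forall j, hf I j = hf J j) ->
  hilbert_numerator I D q -> hilbert_numerator J D q.
Proof. by move=> e h i; rewrite h; apply: eq_convolution => j; rewrite e. Qed.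

Lemma dim_lt_hf (k : fieldType) n n' (I : {mpoly k[n]} -> Prop)
    (J : {mpoly k[n']} -> Prop) d : (forall j, hf I j = hf J j) ->
  dim_lt I d -> dim_lt J d.
Proof.
move=> e [C hC]; exists C => j; rewrite hfa_sum; under eq_bigr do rewrite -e.
by rewrite -hfa_sum.
Qed.

Section Compare.
Variables (k : fieldType) (n : nat) (I : {mpoly k[n]} -> Prop).
Hypotheses (k_infinite : infinite_set [set: k]) (idI : ideal I) (grI : graded I).
Implicit Types (fs : seq {mpoly k[n]}) (vs ws us : seq 'rV[k]_n).
Local Notation good fs := (chosen (fun ws => good_form fs (tower I ws))).

Lemma good_filter_regular fs vs : good fs vs -> filter_regular_seq I vs.
Proof.
elim/last_ind: vs => [//|vs v IH] /chosen_rcons[/IH fr [frv _]].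
by rewrite -cats1; apply/filter_regular_seq_cat.
Qed.

Lemma good_generic fs ws : generic (good_form fs (tower I ws)).
Proof. by apply: generic_good_form => //; [exact: ideal_tower | exact: graded_tower]. Qed.

(** The zero-divisors of the last form contribute their total number [c] to
    the coefficient of index [D], and those of the other forms only to
    coefficients of larger index. *)
Lemma compare_numerators fs ws v D : good fs (rcons ws v) ->
    dim_lt I (D.+1 + size ws).+1 ->
  exists q qJ Q, let c := (\sum_(j < Q) defect (tower I ws) (lform v) j)%N in
    [/\ hilbert_numerator I (D.+1 + size ws) q,
        hilbert_numerator (tower I (rcons ws v)) D qJ,
        forall j, (Q <= j)%N -> defect (tower I ws) (lform v) j = 0%N,
        forall i, (i < D)%N -> (shifted q)`_i = (shifted qJ)`_i &
        (shifted q)`_D = (shifted qJ)`_D - (-1) ^+ D * c%:Z].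
Proof.
move=> ch dimI.
have [us usD chus] := chosen_extend k_infinite D (good_generic fs) ch.
have /filter_regular_seq_cat[fr frus] := good_filter_regular chus.
move: (fr); rewrite -{1}cats1 => /filter_regular_seq_cat[frws [frv _]].
have idT := ideal_tower ws idI; have grT := @graded_tower _ _ _ ws idI grI.
have idJ := ideal_tower (rcons ws v) idI; have grJ := @graded_tower _ _ _ (rcons ws v) idI grI.
have dimJ : dim_lt (tower I (rcons ws v)) (size us).+1.
  by apply: dim_lt_tower => //; rewrite size_rcons usD addnS.
have [qJ hJ] := hilbert_numerator_exists idJ grJ frus dimJ.
rewrite usD in hJ; move: (hJ); rewrite {1}tower_rcons => hJ'.
have [Q [dQ hT]] := hilbert_numerator_step idT grT (lform_homog v) frv hJ'.
have [q [hq eq_q]] := hilbert_numerator_tower idI grI frws hT.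
exists q, qJ, Q; split=> //.
  by move=> i iD; rewrite eq_q 1?ltnW // coef_shifted_lt.
rewrite eq_q // coef_shifted_eq; congr (_ - _ * _).
rewrite horner_poly /=; under eq_bigr do rewrite expr1n mulr1.
by rewrite -(big_morph _ PoszD (erefl _)).
Qed.

End Compare.

Lemma single_defect (F : nat -> nat) Q : (forall j, (Q <= j)%N -> F j = 0%N) ->
  (\sum_(j < Q) F j = 1)%N ->
  (forall j, (\sum_(q < j) F q <= 1)%N) /\ exists j, F j <> 0%N.
Proof.
move=> F0 sum1; split=> [j|]; first by rewrite -sum1; apply: sum_defect_bounded.
apply: contrapT => /forallNP no; move: sum1; rewrite big1 // => j _.
exact: contrapT (no j).
Qed.

Section Depth.
Variables (k : fieldType) (n d s : nat) (P : prime_idealr {mpoly k[n]}).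
Local Notation I := (fun f => f \in P).
Hypotheses (k_infinite : infinite_set [set: k]) (idI : ideal I) (grI : graded I).
Hypotheses (dimP : dim_lt I d.+1) (ndimP : ~ dim_lt I d) (sd : (s < d)%N).
Local Notation good fs := (chosen (fun ws => good_form fs (tower I ws))).

Definition single_defect_rows vs := exists Q,
  (forall j, (Q <= j)%N -> defect (tower I (take s vs)) (lform vs`_s) j = 0%N) /\
  (\sum_(j < Q) defect (tower I (take s vs)) (lform vs`_s) j = 1)%N.

Lemma prime_mem a b : I (a * b) -> I a \/ I b.
Proof. by move=> Pab; apply/orP; rewrite -prime_idealrM. Qed.

Lemma depth_lower vs : size vs = s.+1 -> good [::] vs -> single_defect_rows vs ->
  exists fs, [/\ size fs = s, (forall f, f \in fs -> f@_0%MM = 0) & regular_seq P fs].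
Proof.
move=> vs_s ch [Q [dQ c1]]; have [d1 dn0] := single_defect dQ c1.
have fr := good_filter_regular ch.
have reg := regular_of_single_defect idI grI vs_s prime_mem fr sd dimP ndimP d1 dn0.
exists (map (@lform k n) (take s vs)); split.
- by rewrite size_map size_takel // vs_s.
- move=> _ /mapP[v _ ->]; apply: (dhomog_nemf_coeff (lform_homog v)).
  by rewrite /= mdeg0.
split=> [j|].
  rewrite size_map size_takel ?vs_s // => js g.
  rewrite gen_byE -map_take -tower_adjoin_seq take_takel ?(ltnW js) //.
  rewrite (nth_map 0) ?size_takel ?vs_s // nth_take //.
  exact: reg.
rewrite gen_byE -tower_adjoin_seq => I1.
apply: (@ndim_lt_tower _ _ I (take s vs) (d - s) idI grI).
  by rewrite size_takel ?vs_s // subnK // ltnW.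
apply: (@growth_leq_exp _ 0) => //; apply/dim_lt0 => //; exact: ideal_tower.
Qed.

Lemma depth_upper fs vs : size vs = s.+1 -> good fs vs -> single_defect_rows vs ->
  (forall f, f \in fs -> f@_0%MM = 0) -> regular_seq P fs -> (size fs <= s)%N.
Proof.
move=> vs_s ch [Q [dQ c1]] fs0 [reg _]; have [_ [j dn0]] := single_defect dQ c1.
rewrite leqNgt; apply/negP => sfs; apply: dn0.
apply: (defect_eq0_of_regular_seq idI grI fs0 _ ch) => [i ifs g||//]; last by rewrite vs_s.
by have := reg i ifs g; rewrite gen_byE.
Qed.

End Depth.

Theorem theorem5p4 (k : fieldType) (k_infinite : infinite_set [set: k])
    (n d s : nat) (P : prime_idealr {mpoly k[n]})
    (P_homogeneous : homogeneous_ideal P)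
    (dimP : krull_dim P = d)
    (s_gt0 : (1 <= s)%N) (s_le_d : (s <= d)%N) :
  let r := (n - s)%N in
  for_general_forms (fun l : s.-tuple {mpoly k[n]} =>
    let Ps : {pred {mpoly k[r]}} := image_ideal (@Proj k n s l) P in
    [/\ @Proj_defined k n s l,
        (forall i : nat, (i < d - s)%N -> hilbert_coef P i = hilbert_coef Ps i) &
        hilbert_coef P (d - s) = hilbert_coef Ps (d - s) - (-1) ^+ (d - s) ->
        depth P = (n - r - 1)%N]).
Proof.
move=> r; pose I : {mpoly k[n]} -> Prop := fun f => f \in P.
have idI : ideal I.
  by split=> [|f g|a f]; [exact: idealr0 | exact: rpredD | exact: idealMr].
have grI : graded I := P_homogeneous.
have [ndim dim1] : ~ dim_lt I d /\ dim_lt I d.+1.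
  by rewrite -dimP; apply: dim_of_krull_dim => //; rewrite /I idealr1.
have dn : (d <= n)%N.
  rewrite leqNgt; apply/negP => nd; apply: ndim.
  exact: growth_leq_exp nd (dim_lt_nvars I).
case: s s_gt0 s_le_d @r => // s' _ sd r; set s := s'.+1 in sd r *.
have [F1 F10 [H hH]] := generic_hf s idI grI.
have [F2 F20 freeF2] := generic_trailing_free k (leq_trans sd dn).
pose F := F1 * F2; have F0 : F != 0 by apply: mulf_neq0.
exists [set A | F.@[at_mx A] != 0]; split.
- exists [set F]; apply: funext => A; apply: propext; split=> [FA|[_ -> //]].
  by exists F.
- by have [A FA] := exists_matrix k_infinite F0; exists A.
move=> l l1 FA Ps; rewrite /= in FA; set A := coef_mx l in FA.
have lE : l = map (@lform k n) (section_rows A) :> seq _.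
  apply: (@eq_from_nth _ 0) => [|i]; first by rewrite size_map size_section_rows size_tuple.
  rewrite size_tuple => lt; rewrite (nth_map 0) ?size_section_rows //.
  rewrite -[i]/(val (Ordinal lt)) nth_section_rows -tnth_nth.
  rewrite {1}(linear_formE (l1 (Ordinal lt))) /lform.
  by apply: eq_bigr => j _; rewrite !mxE.
have [FA1 FA2] : F1.@[at_mx A] != 0 /\ F2.@[at_mx A] != 0.
  by move: FA; rewrite rmorphM mulf_eq0 negb_or => /andP.
have defd : @Proj_defined k n s l.
  by have := trailing_free_Proj_defined (freeF2 A FA2); rewrite size_section_rows lE.
pose J : {mpoly k[r]} -> Prop := fun f => f \in Ps.
have PsE : J = image (@Proj k n s (map (@lform k n) (section_rows A))) I.
  apply: funext => f; apply: propext; rewrite -lE.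
  by split=> [/asboolP[g Pg <-]|[g Pg <-]]; [exists g | apply/asboolP; exists g].
have [idPs grPs hPs] : [/\ ideal J, graded J & forall j, hf J j = H j].
  rewrite PsE; have defA := defd; rewrite lE in defA.
  have [idJ grJ hJ] := image_Proj (size_section_rows A) defA idI grI.
  by split=> // j; rewrite hJ hH.
(* Where [F] does not vanish the Hilbert functions are the same: the comparisons
   can be made for a second matrix [B], chosen in general position with respect
   to [fs] as well. *)
have compare fs : exists vs c, [/\ size vs = s,
    chosen (fun ws => good_form fs (tower I ws)) vs,
    forall i, (i < d - s)%N -> hilbert_coef P i = hilbert_coef Ps i,
    hilbert_coef P (d - s) = hilbert_coef Ps (d - s) - (-1) ^+ (d - s) * c%:Z &
    c = 1%N -> single_defect_rows s' P vs].
  have [B [FB chB]] := choose_rows k_infinite F0 (good_generic idI grI fs).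
  have FB1 : F1.@[at_mx B] != 0 by move: FB; rewrite rmorphM mulf_eq0 negb_or => /andP[].
  have hB := hH B FB1; have := size_section_rows B.
  case/lastP: (section_rows B) chB hB => // ws v ch hB; rewrite size_rcons => -[ws_s].
  have dE : ((d - s).+1 + size ws = d)%N by rewrite ws_s /s; lia.
  have [|q [qJ [Q [hq hJ dQ lt_D eq_D]]]] := compare_numerators (D := (d - s)%N) k_infinite idI grI ch.
    by rewrite dE.
  rewrite dE in hq.
  have hfPs j : hf (tower I (rcons ws v)) j = hf J j by rewrite hB hPs.
  have frs := good_filter_regular ch.
  have krullPs : krull_dim Ps = (d - s)%N.
    apply: krull_dim_eq => //.
      move/(dim_lt_hf (fun j => esym (hfPs j))); apply: ndim_lt_tower => //.
      by rewrite size_rcons ws_s subnK.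
    apply: (dim_lt_hf hfPs); apply: dim_lt_tower => //.
    by rewrite size_rcons ws_s subnK.
  have numP : hilbert_num P = q by apply: hilbert_numE => //; rewrite dimP.
  have numPs : hilbert_num Ps = qJ.
    by apply: hilbert_numE => //; rewrite krullPs; apply: hilbert_numerator_hf hJ.
  exists (rcons ws v), (\sum_(j < Q) defect (tower I ws) (lform v) j)%N.
  rewrite /hilbert_coef numP numPs; split=> //; first by rewrite size_rcons ws_s.
  move=> c1; exists Q; rewrite nth_rcons -ws_s ltnn eqxx.
  by rewrite -cats1 take_size_cat.
split=> //; first by have [vs [c []]] := compare [::].
move=> eq_D.
have single fs : exists vs, [/\ size vs = s, chosen (fun ws => good_form fs (tower I ws)) vs &
    single_defect_rows s' P vs].
  have [vs [c [vs_s ch _ eq_c c1]]] := compare fs; exists vs; split=> //; apply: c1.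
  move/eqP: eq_c; rewrite eq_D (inj_eq (addrI _)) eqr_opp -{1}[_ ^+ _]mulr1.
  by rewrite (inj_eq (mulfI (negbT (signr_eq0 _ _)))) => /eqP[].
have -> : (n - r - 1 = s')%N by rewrite /r /s; lia.
apply: supremum_max.
  have [vs [vs_s ch sg]] := single [::].
  exact: (depth_lower idI grI dim1 ndim sd vs_s ch sg).
move=> t [fs [<- fs0 reg]]; have [vs [vs_s ch sg]] := single fs.
exact: (depth_upper idI grI vs_s ch sg fs0 reg).
Qed.
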